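(* Let $\nu$ range over real numbers with $\nu>-1$, $\nu\neq 0$, and let $f_\nu(z)=\left(2^{\nu}\Gamma(\nu+1)J_{\nu}(z)\right)^{1/\nu}$. Let $\nu^{\ast}\simeq0.3901\dots$ be the root of the equation $J_{\nu}'(1)=0$ (in the unknown $\nu$). For each $\alpha\in(0,1)$ the equation $$\nu(\nu^2-1)J_{\nu}^2(1)+(1-\nu)(J_{\nu}'(1))^2=\alpha\nu J_{\nu}(1)J_{\nu}'(1)$$ has a unique root $\nu_\alpha$ in $(\nu^{\ast},\infty)$, and $f_{\nu}$ is convex of order $\alpha$ in the open unit disk $\mathbb{D}$ if and only if $\nu\geq\nu_{\alpha}$. Moreover, $f_{\nu}$ is convex in $\mathbb{D}$ if and only if $\nu\geq1$.
   Context: $J_\nu$ is the Bessel function of the first kind, $J_{\nu}(z)=\sum_{n\geq0}\frac{(-1)^{n}}{n!\,\Gamma(n+\nu+1)}\left(\frac{z}{2}\right)^{2n+\nu}$; $J_\nu'$ is its derivative in $z$. $\mathbb{D}=\{z\in\mathbb{C}:|z|<1\}$. The function $f_\nu(z)=\left(2^{\nu}\Gamma(\nu+1)J_{\nu}(z)\right)^{1/\nu}=z-\frac{1}{4\nu(\nu+1)}z^3+\dots$ is the branch normalized by $f_\nu(0)=0$, $f_\nu'(0)=1$; that is, $f_\nu(z)=z\,\bigl(2^{\nu}\Gamma(\nu+1)z^{-\nu}J_\nu(z)\bigr)^{1/\nu}$, where the even entire function $2^{\nu}\Gamma(\nu+1)z^{-\nu}J_\nu(z)$ equals $1$ at $z=0$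 and its power $1/\nu$ is the analytic branch equal to $1$ at $z=0$. A function $f$ with $f(0)=f'(0)-1=0$ is convex of order $\alpha\in[0,1)$ in $\mathbb{D}$ if it is analytic and univalent in $\mathbb{D}$ and $\operatorname{Re}\left(1+\frac{zf''(z)}{f'(z)}\right)>\alpha$ for all $z\in\mathbb{D}$; convex means convex of order $0$.
   Formalization: The printed digits 0.3901… of ν* are slightly off (numerically ν* = 0.39001…); the formal statement asserts only |ν* − 0.3901| < 0.0001, together with existence and uniqueness of the root among ν > −1, ν ≠ 0. *)

(* Defs.v *)
(* Stdlib reals with Coquelicot. *)
From Stdlib Require Export Reals Factorial.
From Coquelicot Require Export Coquelicot.
Open Scope R_scope.

(* Euler's integral, so meaningful for x > 0 only.  For nu > -1 every
   argument n + nu + 1 used below is positive. *)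
Definition Gamma (x : R) : R :=
  RInt_gen (fun t => Rpower t (x - 1) * exp (- t))
           (at_right 0) (Rbar_locally p_infty).

Definition bessel_coef (nu : R) (n : nat) : R :=
  (-1) ^ n / (INR (fact n) * Gamma (INR n + nu + 1)).

(* The Bessel function J_nu at x > 0 (Rpower is the real power of a positive
   base).  J_nu'(1) is Derive (besselJ nu) 1. *)
Definition besselJ (nu x : R) : R :=
  Series (fun n => bessel_coef nu n * Rpower (x / 2) (2 * INR n + nu)).

Definition CSeries (a : nat -> C) : C :=
  (Series (fun n => Re (a n)), Series (fun n => Im (a n))).

Definition Cexp (z : C) : C :=
  (exp (Re z) * cos (Im z), exp (Re z) * sin (Im z)).

(* The even entire function 2^nu Gamma(nu+1) z^(-nu) J_nu(z): the factor
   2^nu z^(-nu) cancels (z/2)^nu in each term of the Bessel series. *)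
Definition bessel_normalized (nu : R) (z : C) : C :=
  CSeries (fun n =>
    (RtoC (Gamma (nu + 1) * bessel_coef nu n) * Cpow (z / RtoC 2) (2 * n))%C).

Definition in_disk (z : C) : Prop := Cmod z < 1.

Definition Cdifferentiable (f : C -> C) (z : C) : Prop :=
  @ex_derive C_AbsRing C_NormedModule f z.

(* The points of the disk that are joined to 0 by a segment free of zeros of
   bessel_normalized nu: a star-shaped open set, equal to the whole disk when
   bessel_normalized nu has no zero there. *)
Definition branch_domain (nu : R) (z : C) : Prop :=
  in_disk z /\
  forall t : R, 0 <= t <= 1 -> bessel_normalized nu (RtoC t * z)%C <> RtoC 0.

(* f is f_nu(z) = z (2^nu Gamma(nu+1) z^(-nu) J_nu(z))^(1/nu), where w^(1/nu)
   means exp (L / nu) for the analytic logarithm L of w with L 0 = 0.  The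
   branch exists and is unique on branch_domain nu.  On the rest of the disk
   (nonempty only if bessel_normalized nu has a zero in the disk) the values of
   f are left free; an analytic f on the disk is then determined by its values
   on branch_domain nu, so it is the analytic extension of f_nu, if any. *)
Definition is_f_nu (nu : R) (f : C -> C) : Prop :=
  exists L : C -> C,
    L (RtoC 0) = RtoC 0 /\
    forall z : C, branch_domain nu z ->
      Cdifferentiable L z /\
      Cexp (L z) = bessel_normalized nu z /\
      f z = (z * Cexp (L z / RtoC nu))%C.

Definition univalent_in_disk (f : C -> C) : Prop :=
  forall z w : C, in_disk z -> in_disk w -> f z = f w -> z = w.

Definition convex_of_order (alpha : R) (f : C -> C) : Prop :=
  f (RtoC 0) = RtoC 0 /\
  C_derive f (RtoC 0) = RtoC 1 /\
  (forall z : C, in_disk z -> Cdifferentiable f z) /\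
  univalent_in_disk f /\
  forall z : C, in_disk z ->
    alpha < Re (RtoC 1 + z * C_derive (C_derive f) z / C_derive f z)%C.

(* When f_nu has no analytic extension to the disk this is false for every
   alpha, as it should be. *)
Definition f_nu_convex_of_order (nu alpha : R) : Prop :=
  exists f : C -> C, is_f_nu nu f /\ convex_of_order alpha f.

(* Main.v *)
Require Import Defs.
From Stdlib Require Import Lra Lia.

(* Put x = z^2 and let phi(x) be the normalized Bessel function. For nu > 0 the
   function P = - z phi'/phi = nu - z J_nu'/J_nu solves the Riccati equation
   2 x P' = x + P^2 - 2 nu P, so it is a power series in x whose coefficients
   are positive, decrease in nu, and decay like 4^(-n). Hence
     1 + z f''/f' = 1 - P/nu - 2 x P' / (nu - P)
   has real part at least its value at |z|, hence larger than its value
   G(nu) at z = 1, as long as p = nu - P(1) = J_nu'(1)/J_nu(1) is positive.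
   The root of p is nu^*, and G increases on (nu^*, oo) with G(1) = 0 and
   G(nu) >= 1 - 1/nu. By the Riccati equation at x = 1,
   G = (1 - nu) p / nu + (nu^2 - 1) / p, so G = alpha is the equation for
   nu_alpha. Necessity for nu > 0 is seen on the real axis, letting z tend to 1
   or to a zero of f'. For -1 < nu < 0 the quotient is nonpositive at some point
   of the imaginary axis. Univalence for nu >= 1 follows from Re f' > 0. *)

(** * Complex differentiation *)

(** The classical access to P is its expansion over the zeros of J_nu, which presupposes their
    reality and a product formula. Here the coefficients of B = P/x are instead defined by the
    recursion that the Riccati equation forces on them, so that positivity, monotonicity in nu and
    decay are plain inductions. That this series belongs to the Bessel function is shown by
    combining the two differential equations, without dividing by phi; the absence of zeros of phi
    in |x| < 4 is then a by-product, because phi turns out to be an exponential. Since 4 exceeds 1,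
    the point x = 1 is interior and boundary values are ordinary values. The series of B represents
    P only up to the first zero of phi. As nu tends to -1 this zero tends to 0, so negative orders
    need an argument on phi itself, near the imaginary axis, where Re phi is at least 1. Univalence
    has to be proved only for nu >= 1, where all constants are small: for 0 < nu < 1 the condition
    on the real part already fails. *)

Definition cderiv (f : C -> C) (z l : C) : Prop :=
  @is_derive C_AbsRing C_NormedModule f z l.

Lemma cderiv_eps (f : C -> C) (z l : C) :
  cderiv f z l <->
  forall eps : R, 0 < eps -> exists delta : R, 0 < delta /\
    forall y : C, Cmod (y - z) < delta ->
      Cmod (f y - f z - l * (y - z)) <= eps * Cmod (y - z).
Proof.
  split.
  - intros [_ H] eps Heps.
    destruct (H z (fun P HP => HP) (mkposreal eps Heps)) as [d Hd].
    exists d; split; [apply cond_pos|].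
    intros y Hy; specialize (Hd y Hy).
    replace (l * (y - z))%C with ((y - z) * l)%C by ring.
    exact Hd.
  - intros H; split.
    + split.
      * intros x y; change ((x + y) * l = x * l + y * l)%C; ring.
      * intros k x; change ((k * x) * l = k * (x * l))%C; ring.
      * exists (Cmod l + 1); split.
        { generalize (Cmod_ge_0 l); lra. }
        intros x; change (Cmod (x * l) <= (Cmod l + 1) * Cmod x).
        rewrite Cmod_mult; generalize (Cmod_ge_0 x); nra.
    + intros x Hx eps.
      assert (Hzx : z = x).
      { apply (@is_filter_lim_locally_unique C_AbsRing (AbsRing_NormedModule C_AbsRing) z x Hx). }
      subst x.
      destruct (H eps (cond_pos eps)) as [d [Hd Hy]].
      exists (mkposreal d Hd); intros y By; specialize (Hy y By).
      replace (l * (y - z))%C with ((y - z) * l)%C in Hy by ring.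
      exact Hy.
Qed.

(** The product and chain rules are stated over [AbsRing_NormedModule C_AbsRing], differentiability
    here over [C_NormedModule]. Both structures have the same operations, so only the record has to
    be rebuilt. *)
Lemma cderiv_AbsRing (f : C -> C) (z l : C) :
  cderiv f z l <-> @is_derive C_AbsRing (AbsRing_NormedModule C_AbsRing) f z l.
Proof.
  split; intros [[H1 H2 H3] H]; (split; [split; assumption|exact H]).
Qed.

Lemma cderiv_C_derive (f : C -> C) (z l : C) : cderiv f z l -> C_derive f z = l.
Proof. apply is_C_derive_unique. Qed.

Lemma cderiv_ext_ball (f g : C -> C) (z l : C) (d : R) :
  0 < d -> (forall y, Cmod (y - z) < d -> f y = g y) ->
  cderiv f z l -> cderiv g z l.
Proof.
  intros Hd Hfg. unfold cderiv. apply is_derive_ext_loc.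
  exists (mkposreal d Hd); intros y Hy; apply Hfg; exact Hy.
Qed.

Lemma cderiv_ext (f g : C -> C) (z l : C) :
  (forall y, f y = g y) -> cderiv f z l -> cderiv g z l.
Proof. intros H; apply (cderiv_ext_ball f g z l 1); [lra|auto]. Qed.

Lemma cderiv_const (c z : C) : cderiv (fun _ => c) z 0.
Proof. exact (@is_derive_const C_AbsRing C_NormedModule c z). Qed.

Lemma cderiv_id (z : C) : cderiv (fun y => y) z 1.
Proof. apply cderiv_AbsRing. exact (@is_derive_id C_AbsRing z). Qed.

Lemma cderiv_plus (f g : C -> C) (z a b : C) :
  cderiv f z a -> cderiv g z b -> cderiv (fun y => f y + g y)%C z (a + b)%C.
Proof. exact (@is_derive_plus C_AbsRing C_NormedModule f g z a b). Qed.

Lemma cderiv_mult (f g : C -> C) (z a b : C) :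
  cderiv f z a -> cderiv g z b ->
  cderiv (fun y => f y * g y)%C z (a * g z + f z * b)%C.
Proof.
  rewrite !cderiv_AbsRing; intros Hf Hg.
  exact (@is_derive_mult C_AbsRing f g z a b Hf Hg Cmult_comm).
Qed.

Lemma cderiv_scal (k : C) (f : C -> C) (z a : C) :
  cderiv f z a -> cderiv (fun y => k * f y)%C z (k * a)%C.
Proof.
  intros Hf. replace (k * a)%C with (0 * f z + k * a)%C by ring.
  apply (cderiv_mult (fun _ => k)); [apply cderiv_const|exact Hf].
Qed.

Lemma cderiv_comp (f g : C -> C) (z a b : C) :
  cderiv f (g z) a -> cderiv g z b -> cderiv (fun y => f (g y)) z (b * a)%C.
Proof.
  rewrite !cderiv_AbsRing.
  exact (@is_derive_comp C_AbsRing (AbsRing_NormedModule C_AbsRing) f g z a b).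
Qed.

Lemma cderiv_sqr (z : C) : cderiv (fun y => y * y)%C z (RtoC 2 * z)%C.
Proof.
  replace (RtoC 2 * z)%C with (1 * z + z * 1)%C.
  - apply cderiv_mult; apply cderiv_id.
  - replace (RtoC 2) with (1 + 1)%C by (rewrite <- RtoC_plus; f_equal; lra); ring.
Qed.

Lemma Cmod_le_Rabs (z : C) : Cmod z <= Rabs (Re z) + Rabs (Im z).
Proof.
  destruct z as [a b]; simpl.
  replace (a, b) with (RtoC a + Ci * RtoC b)%C
    by (unfold RtoC, Ci, Cplus, Cmult; simpl; f_equal; ring).
  eapply Rle_trans; [apply Cmod_triangle|].
  rewrite Cmod_mult, Cmod_Ci, !Cmod_R; lra.
Qed.

Lemma im_le_Cmod (z : C) : Rabs (Im z) <= Cmod z.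
Proof.
  eapply Rle_trans; [|apply Rmax_Cmod]. apply Rmax_r.
Qed.

(** Real forms Re (k f) along a segment reduce statements about complex functions to the real mean
    value theorem. *)
Lemma cderiv_line (f : C -> C) (z0 v l k : C) (t : R) :
  cderiv f (z0 + RtoC t * v)%C l ->
  is_derive (fun s : R => Re (k * f (z0 + RtoC s * v)%C)%C) t (Re (k * (l * v))%C).
Proof.
  intros H. apply is_derive_Reals. intros eps Heps.
  rewrite cderiv_eps in H.
  set (M := Cmod k * Cmod v + 1).
  assert (HM : 0 < M).
  { unfold M; generalize (Cmod_ge_0 k) (Cmod_ge_0 v); nra. }
  destruct (H (eps / (2 * M))) as [d [Hd Hy]].
  { apply Rdiv_lt_0_compat; lra. }
  assert (Hd' : 0 < d / (Cmod v + 1)).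
  { apply Rdiv_lt_0_compat; [lra|generalize (Cmod_ge_0 v); lra]. }
  exists (mkposreal _ Hd'). intros h Hh0 Hh. simpl in Hh.
  specialize (Hy (z0 + RtoC (t + h) * v)%C).
  assert (Hyz : (z0 + RtoC (t + h) * v - (z0 + RtoC t * v) = RtoC h * v)%C).
  { rewrite RtoC_plus; ring. }
  rewrite Hyz in Hy. rewrite Cmod_mult, Cmod_R in Hy.
  assert (Hlt : Rabs h * Cmod v < d).
  { assert (Rabs h * (Cmod v + 1) < d).
    { apply (Rmult_lt_compat_r (Cmod v + 1)) in Hh; [|generalize (Cmod_ge_0 v); lra].
      replace (d / (Cmod v + 1) * (Cmod v + 1)) with d in Hh; [exact Hh|].
      field. generalize (Cmod_ge_0 v); lra. }
    generalize (Rabs_pos h); lra. }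
  specialize (Hy Hlt).
  set (E := (f (z0 + RtoC (t + h) * v) - f (z0 + RtoC t * v) - l * (RtoC h * v))%C) in *.
  assert (HE : Re (k * f (z0 + RtoC (t + h) * v))%C - Re (k * f (z0 + RtoC t * v))%C
               = Re (k * (l * v))%C * h + Re (k * E)%C).
  { unfold E.
    replace (k * f (z0 + RtoC (t + h) * v))%C with
      (k * f (z0 + RtoC t * v) + RtoC h * (k * (l * v)) +
       k * (f (z0 + RtoC (t + h) * v) - f (z0 + RtoC t * v) - l * (RtoC h * v)))%C by ring.
    set (A := (k * f (z0 + RtoC t * v))%C). set (B := (k * (l * v))%C).
    set (D := (k * _)%C). unfold Re, Cplus, Cmult, RtoC; simpl; ring. }
  rewrite HE.
  replace ((Re (k * (l * v))%C * h + Re (k * E)%C) / h - Re (k * (l * v))%C)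
    with (Re (k * E)%C / h) by (field; exact Hh0).
  unfold Rdiv; rewrite Rabs_mult, Rabs_inv.
  assert (HkE : Rabs (Re (k * E)%C) <= Cmod k * (eps / (2 * M) * (Rabs h * Cmod v))).
  { eapply Rle_trans; [apply re_le_Cmod|]. rewrite Cmod_mult.
    apply Rmult_le_compat_l; [apply Cmod_ge_0|exact Hy]. }
  assert (Hh1 : 0 < Rabs h) by (apply Rabs_pos_lt; exact Hh0).
  apply Rle_lt_trans with (eps / (2 * M) * (Cmod k * Cmod v)).
  - apply (Rmult_le_reg_r (Rabs h)); [exact Hh1|].
    rewrite Rmult_assoc, Rinv_l, Rmult_1_r by lra.
    eapply Rle_trans; [exact HkE|]. right; ring.
  - apply Rle_lt_trans with (eps / (2 * M) * M).
    + apply Rmult_le_compat_l; [left; apply Rdiv_lt_0_compat; lra|unfold M; lra].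
    + replace (eps / (2 * M) * M) with (eps / 2) by (field; lra). lra.
Qed.

(** * The complex exponential and logarithmic derivatives *)

Lemma Cexp_plus (z w : C) : Cexp (z + w)%C = (Cexp z * Cexp w)%C.
Proof.
  destruct z as [a b], w as [c d]; unfold Cexp, Cplus, Cmult; simpl.
  rewrite exp_plus, cos_plus, sin_plus; f_equal; ring.
Qed.

Lemma Cexp_0 : Cexp 0 = 1.
Proof.
  unfold Cexp; simpl. rewrite exp_0, cos_0, sin_0. unfold RtoC; f_equal; ring.
Qed.

Lemma Cexp_opp_r (z : C) : (Cexp z * Cexp (- z))%C = 1.
Proof. rewrite <- Cexp_plus. replace (z + - z)%C with (RtoC 0) by ring. apply Cexp_0. Qed.

Lemma Cexp_neq_0 (z : C) : Cexp z <> 0.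
Proof.
  intros H. generalize (Cexp_opp_r z). rewrite H, Cmult_0_l.
  intros E; apply (f_equal Re) in E; simpl in E; lra.
Qed.

(** The upper bound comes from the lower one: squaring exp (- a/2) >= 1 - a/2 gives exp a <= (1 -
    a/2)^(-2), and 1 + a + 2 a^2 dominates the right side on [-1, 1]. *)
Lemma exp_quadratic_bound (a : R) : Rabs a <= 1 -> 0 <= exp a - 1 - a <= 2 * a ^ 2.
Proof.
  intros Ha; split; [generalize (exp_ineq1_le a); lra|].
  apply Rabs_le_between in Ha.
  assert (H2 : exp (- (a / 2)) >= 1 - a / 2) by (generalize (exp_ineq1_le (- (a / 2))); lra).
  assert (H3 : exp a * (exp (- (a / 2)) * exp (- (a / 2))) = 1).
  { rewrite <- !exp_plus. rewrite <- exp_0; f_equal; lra. }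
  assert (Hp := exp_pos a).
  assert (H4 : exp a * (1 - a / 2) ^ 2 <= 1).
  { rewrite <- H3. apply Rmult_le_compat_l; [lra|]. nra. }
  assert (H5 : 1 <= (1 + a + 2 * a ^ 2) * (1 - a / 2) ^ 2).
  { replace ((1 + a + 2 * a ^ 2) * (1 - a / 2) ^ 2)
      with (1 + a ^ 2 * ((1 - a) * (5 / 4 - a / 2))) by field.
    assert (0 <= a ^ 2) by nra.
    assert (0 <= (1 - a) * (5 / 4 - a / 2)) by nra. nra. }
  assert (0 < (1 - a / 2) ^ 2) by nra.
  assert (exp a <= 1 + a + 2 * a ^ 2); [|lra].
  apply (Rmult_le_reg_r ((1 - a / 2) ^ 2)); lra.
Qed.

Lemma Rabs_sin_le (b : R) : Rabs (sin b) <= Rabs b.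
Proof.
  assert (H : forall c, 0 <= c -> Rabs (sin c) <= c).
  { intros c Hc. apply Rabs_le; split.
    - destruct (Rle_dec c 1) as [h|h].
      + generalize PI2_1; intros. generalize (sin_ge_0 c Hc). lra.
      + generalize (SIN_bound c); lra.
    - destruct Hc as [Hc|<-]; [left; apply sin_lt_x; exact Hc|rewrite sin_0; lra]. }
  destruct (Rle_dec 0 b) as [h|h].
  - rewrite (Rabs_pos_eq b) by exact h. auto.
  - rewrite <- (Rabs_Ropp b), <- (Rabs_Ropp (sin b)), <- sin_neg.
    rewrite (Rabs_pos_eq (- b)) by lra. apply H; lra.
Qed.

Lemma cos_quadratic_bound (b : R) : 0 <= 1 - cos b <= b ^ 2 / 2.
Proof.
  split; [generalize (COS_bound b); lra|].
  replace b with (2 * (b / 2)) at 1 by lra.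
  rewrite cos_2a_sin.
  generalize (Rsqr_le_abs_1 _ _ (Rabs_sin_le (b / 2))). unfold Rsqr; nra.
Qed.

Lemma sin_quadratic_bound (b : R) : Rabs (sin b - b) <= b ^ 2.
Proof.
  assert (H : forall c, 0 <= c -> Rabs (sin c - c) <= c ^ 2).
  { intros c Hc.
    destruct (MVT_gen (fun t => sin t - t) 0 c (fun t => cos t - 1)) as [x [Hx E]].
    - intros x _. auto_derive; [auto|ring].
    - intros x _. apply derivable_continuous_pt, ex_derive_Reals_0.
      auto_derive; auto.
    - rewrite Rmin_left, Rmax_right in Hx by lra.
      rewrite sin_0 in E. replace (sin c - c) with ((cos x - 1) * (c - 0)) by lra.
      generalize (cos_quadratic_bound x) (COS_bound x); intros.
      assert (0 <= 1 - cos x <= c).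
      (* For c <= 2 the bound x^2 / 2 on 1 - cos x is at most c; beyond 2 the trivial bound 2 is
         enough. *)
      { split; [lra|]. destruct (Rle_dec c 2); [|lra].
        assert (x ^ 2 <= c ^ 2) by (apply pow_incr; lra). nra. }
      apply Rabs_le; split; nra. }
  destruct (Rle_dec 0 b) as [h|h]; [auto|].
  replace (sin b - b) with (- (sin (- b) - - b)) by (rewrite sin_neg; ring).
  rewrite Rabs_Ropp. replace (b ^ 2) with ((- b) ^ 2) by ring. apply H; lra.
Qed.

Lemma Cexp_quadratic_bound (h : C) :
  Cmod h <= 1 -> Cmod (Cexp h - 1 - h) <= 8 * Cmod h ^ 2.
Proof.
  intros Hh. destruct h as [a b].
  assert (Ha : Rabs a <= Cmod (a, b)) by apply (re_le_Cmod (a, b)).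
  assert (Hb : Rabs b <= Cmod (a, b)) by apply (im_le_Cmod (a, b)).
  set (m := Cmod (a, b)) in *.
  assert (He := exp_quadratic_bound a ltac:(lra)).
  assert (Hc := cos_quadratic_bound b). assert (Hs := sin_quadratic_bound b).
  assert (Hs1 := Rabs_sin_le b).
  eapply Rle_trans; [apply Cmod_le_Rabs|].
  unfold Cexp, Cminus, Cplus, Copp, RtoC, Re, Im; simpl fst; simpl snd.
  assert (Ha2 : a ^ 2 <= m ^ 2).
  { generalize (Rsqr_le_abs_1 a m). unfold Rsqr. intros K.
    replace (a ^ 2) with (a * a) by ring. replace (m ^ 2) with (m * m) by ring.
    apply K. rewrite (Rabs_pos_eq m); [exact Ha|unfold m; apply Cmod_ge_0]. }
  assert (Hb2 : b ^ 2 <= m ^ 2).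
  { generalize (Rsqr_le_abs_1 b m). unfold Rsqr. intros K.
    replace (b ^ 2) with (b * b) by ring. replace (m ^ 2) with (m * m) by ring.
    apply K. rewrite (Rabs_pos_eq m); [exact Hb|unfold m; apply Cmod_ge_0]. }
  apply Rabs_le_between in Ha. apply Rabs_le_between in Hb.
  apply Rabs_le_between in Hs. apply Rabs_le_between in Hs1.
  assert (Hbb : Rabs b <= m) by (apply Rabs_le; lra).
  assert (H1 : Rabs (exp a * cos b + - (1) + - a) <= 4 * m ^ 2).
  { replace (exp a * cos b + - (1) + - a)
      with ((exp a - 1 - a) * cos b - (1 + a) * (1 - cos b)) by ring.
    generalize (COS_bound b); intros. apply Rabs_le; split; nra. }
  assert (H2 : Rabs (exp a * sin b + - 0 + - b) <= 4 * m ^ 2).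
  { replace (exp a * sin b + - 0 + - b) with ((exp a - 1) * sin b + (sin b - b)) by ring.
    eapply Rle_trans; [apply Rabs_triang|].
    rewrite Rabs_mult.
    assert (Rabs (exp a - 1) <= 3 * m) by (apply Rabs_le; split; nra).
    assert (Rabs (sin b) <= m) by (apply Rabs_le; lra).
    assert (Rabs (sin b - b) <= m ^ 2) by (apply Rabs_le; lra).
    generalize (Rabs_pos (exp a - 1)) (Rabs_pos (sin b)); intros. nra. }
  lra.
Qed.

Lemma cderiv_Cexp (z : C) : cderiv Cexp z (Cexp z).
Proof.
  apply cderiv_eps. intros eps Heps.
  set (M := 8 * (Cmod (Cexp z) + 1)).
  assert (HM : 0 < M) by (unfold M; generalize (Cmod_ge_0 (Cexp z)); lra).
  exists (Rmin 1 (eps / M)); split.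
  { apply Rmin_pos; [lra|apply Rdiv_lt_0_compat; lra]. }
  intros y Hy.
  assert (Hy1 := Rlt_le_trans _ _ _ Hy (Rmin_l _ _)).
  assert (Hy2 := Rlt_le_trans _ _ _ Hy (Rmin_r _ _)).
  replace (Cexp y) with (Cexp z * Cexp (y - z))%C
    by (rewrite <- Cexp_plus; f_equal; ring).
  replace (Cexp z * Cexp (y - z) - Cexp z - Cexp z * (y - z))%C
    with (Cexp z * (Cexp (y - z) - 1 - (y - z)))%C by ring.
  rewrite Cmod_mult.
  assert (B := Cexp_quadratic_bound (y - z)%C ltac:(lra)).
  set (h := Cmod (y - z)) in *. assert (Hh : 0 <= h) by apply Cmod_ge_0.
  assert (HMh : M * h <= eps).
  { apply (Rmult_lt_compat_l M) in Hy2; [|exact HM].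
    replace (M * (eps / M)) with eps in Hy2 by (field; lra). lra. }
  apply Rle_trans with (Cmod (Cexp z) * (8 * h ^ 2)).
  - apply Rmult_le_compat_l; [apply Cmod_ge_0|exact B].
  - apply Rle_trans with (M * h * h).
    + unfold M. generalize (Cmod_ge_0 (Cexp z)); intros. nra.
    + apply Rmult_le_compat_r; assumption.
Qed.

(** Any differentiable logarithm of g has derivative g'/g. Writing 1/g as [Cexp (- L z)] avoids a
    division and leaves an expression that the chain rule can differentiate once more. *)
Lemma Cexp_log_deriv (L : C -> C) (z l w : C) (d : R) (g : C -> C) :
  0 < d -> (forall y, Cmod (y - z) < d -> Cexp (L y) = g y) ->
  cderiv L z l -> cderiv g z w -> l = (w * Cexp (- L z))%C.
Proof.
  intros Hd Hg HL Hw.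
  assert (H : cderiv g z (l * Cexp (L z))%C).
  { apply (cderiv_ext_ball (fun y => Cexp (L y)) g z _ d Hd Hg).
    apply cderiv_comp; [apply cderiv_Cexp|exact HL]. }
  assert (E : w = (l * Cexp (L z))%C).
  { rewrite <- (cderiv_C_derive _ _ _ Hw). apply cderiv_C_derive; exact H. }
  rewrite E, <- Cmult_assoc, Cexp_opp_r; ring.
Qed.

(** * Complex power series with real coefficients *)
Definition csummable (u : nat -> C) : Prop := ex_series (fun n => Cmod (u n)).

Lemma ex_series_dom (u v : nat -> R) :
  (forall n, Rabs (u n) <= v n) -> ex_series v -> ex_series u.
Proof. intros H; apply (@ex_series_le R_AbsRing R_CompleteNormedModule u v H). Qed.

Lemma csummable_Re (u : nat -> C) : csummable u -> ex_series (fun n => Re (u n)).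
Proof. apply ex_series_dom; intros n; apply re_le_Cmod. Qed.

Lemma csummable_Im (u : nat -> C) : csummable u -> ex_series (fun n => Im (u n)).
Proof. apply ex_series_dom; intros n; apply im_le_Cmod. Qed.

Lemma csummable_plus (u v : nat -> C) :
  csummable u -> csummable v -> csummable (fun n => u n + v n)%C.
Proof.
  intros Hu Hv. apply (ex_series_dom _ (fun n => Cmod (u n) + Cmod (v n))).
  - intros n; rewrite Rabs_pos_eq by apply Cmod_ge_0; apply Cmod_triangle.
  - exact (@ex_series_plus R_AbsRing R_NormedModule _ _ Hu Hv).
Qed.

Lemma csummable_scal (k : C) (u : nat -> C) :
  csummable u -> csummable (fun n => k * u n)%C.
Proof.
  intros Hu. apply (ex_series_ext (fun n => Cmod k * Cmod (u n))).
  - intros n; rewrite Cmod_mult; reflexivity.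
  - exact (@ex_series_scal R_AbsRing R_NormedModule (Cmod k) _ Hu).
Qed.

Lemma csummable_incr (u : nat -> C) :
  csummable u -> csummable (fun n => u (S n)).
Proof. intros Hu; apply (ex_series_incr_1 (fun n => Cmod (u n))); exact Hu. Qed.

Lemma CSeries_ext (u v : nat -> C) : (forall n, u n = v n) -> CSeries u = CSeries v.
Proof.
  intros H; unfold CSeries; f_equal; apply Series_ext; intros n; rewrite H; reflexivity.
Qed.

Lemma CSeries_plus (u v : nat -> C) :
  csummable u -> csummable v ->
  CSeries (fun n => u n + v n)%C = (CSeries u + CSeries v)%C.
Proof.
  intros Hu Hv. unfold CSeries, Cplus; simpl. f_equal.
  - apply (Series_plus (fun n => Re (u n)) (fun n => Re (v n)));
      apply csummable_Re; assumption.
  - apply (Series_plus (fun n => Im (u n)) (fun n => Im (v n)));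
      apply csummable_Im; assumption.
Qed.

Lemma CSeries_scal (k : C) (u : nat -> C) :
  csummable u -> CSeries (fun n => k * u n)%C = (k * CSeries u)%C.
Proof.
  intros Hu. assert (Hr := csummable_Re _ Hu). assert (Hi := csummable_Im _ Hu).
  unfold CSeries, Cmult; simpl. f_equal.
  - rewrite <- !Series_scal_l. apply Series_minus.
    + exact (@ex_series_scal R_AbsRing R_NormedModule (fst k) _ Hr).
    + exact (@ex_series_scal R_AbsRing R_NormedModule (snd k) _ Hi).
  - rewrite <- !Series_scal_l. apply Series_plus.
    + exact (@ex_series_scal R_AbsRing R_NormedModule (fst k) _ Hi).
    + exact (@ex_series_scal R_AbsRing R_NormedModule (snd k) _ Hr).
Qed.

Lemma CSeries_incr (u : nat -> C) :
  csummable u -> CSeries u = (u O + CSeries (fun n => u (S n)))%C.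
Proof.
  intros Hu. unfold CSeries, Cplus; simpl. f_equal; apply Series_incr_1.
  - apply csummable_Re; exact Hu.
  - apply csummable_Im; exact Hu.
Qed.

Lemma Series_zero : Series (fun _ => 0) = 0.
Proof.
  transitivity (Series (fun _ : nat => 0 * 0)).
  - apply Series_ext; intros; ring.
  - rewrite Series_scal_l; ring.
Qed.

Lemma Series_le_Rabs (u v : nat -> R) :
  (forall n, Rabs (u n) <= v n) -> ex_series v -> Rabs (Series u) <= Series v.
Proof.
  intros H Hv. eapply Rle_trans.
  - apply Series_Rabs. apply (ex_series_dom _ v); [|exact Hv].
    intros n; rewrite Rabs_Rabsolu; apply H.
  - apply Series_le; [|exact Hv]. intros n; split; [apply Rabs_pos|apply H].
Qed.

(* Projecting the sum onto its own direction reduces the bound to real series. *)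
Lemma Cmod_CSeries (u : nat -> C) :
  csummable u -> Cmod (CSeries u) <= Series (fun n => Cmod (u n)).
Proof.
  intros Hu. set (s := CSeries u).
  destruct (Req_dec (Cmod s) 0) as [H0|H0].
  { rewrite H0. apply Rle_trans with (Rabs (Series (fun n => 0))); [apply Rabs_pos|].
    apply Series_le_Rabs; [|exact Hu]. intros n; rewrite Rabs_R0; apply Cmod_ge_0. }
  assert (Hs : 0 < Cmod s) by (generalize (Cmod_ge_0 s); lra).
  apply (Rmult_le_reg_l (Cmod s)); [exact Hs|].
  rewrite <- Series_scal_l.
  assert (E : Cmod s * Cmod s = Re (CSeries (fun n => Cconj s * u n)%C)).
  { rewrite CSeries_scal by exact Hu. fold s.
    rewrite Cmult_comm, <- Cmod2_conj. simpl; ring. }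
  rewrite E. eapply Rle_trans; [apply Rle_abs|].
  apply Series_le_Rabs.
  - intros n. eapply Rle_trans; [apply re_le_Cmod|].
    rewrite Cmod_mult, Cmod_conj; lra.
  - exact (@ex_series_scal R_AbsRing R_NormedModule (Cmod s) _ Hu).
Qed.

Definition cps (a : nat -> R) (z : C) : C := CSeries (fun n => RtoC (a n) * z ^ n)%C.

Lemma cps_summable (a : nat -> R) (z : C) :
  Rbar_lt (Cmod z) (CV_radius a) -> csummable (fun n => RtoC (a n) * z ^ n)%C.
Proof.
  intros H. rewrite <- (Rabs_pos_eq (Cmod z)) in H by apply Cmod_ge_0.
  apply CV_disk_inside in H. revert H. apply ex_series_ext. intros n.
  rewrite Cmod_mult, Cmod_R, Cmod_pow, Rabs_mult, <- (RPow_abs (Cmod z)).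
  rewrite (Rabs_pos_eq (Cmod z)) by apply Cmod_ge_0. reflexivity.
Qed.

Lemma cps_ext (a b : nat -> R) (z : C) : (forall n, a n = b n) -> cps a z = cps b z.
Proof. intros H; apply CSeries_ext; intros n; rewrite H; reflexivity. Qed.

Lemma cps_RtoC (a : nat -> R) (x : R) : cps a (RtoC x) = RtoC (PSeries a x).
Proof.
  unfold cps, PSeries. apply injective_projections; simpl.
  - apply Series_ext; intros n. rewrite <- RtoC_pow. simpl; ring.
  - etransitivity; [|exact Series_zero].
    apply Series_ext; intros n. rewrite <- RtoC_pow. simpl; ring.
Qed.

Lemma cps_0 (a : nat -> R) : cps a 0 = RtoC (a O).
Proof. rewrite cps_RtoC, PSeries_0. reflexivity. Qed.

Lemma cps_plus (a b : nat -> R) (z : C) :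
  Rbar_lt (Cmod z) (CV_radius a) -> Rbar_lt (Cmod z) (CV_radius b) ->
  cps (PS_plus a b) z = (cps a z + cps b z)%C.
Proof.
  intros Ha Hb. unfold cps. rewrite <- CSeries_plus by (apply cps_summable; assumption).
  apply CSeries_ext; intros n. unfold PS_plus; change plus with Rplus.
  rewrite RtoC_plus; ring.
Qed.

Lemma cps_scal (k : R) (a : nat -> R) (z : C) :
  Rbar_lt (Cmod z) (CV_radius a) ->
  cps (PS_scal k a) z = (RtoC k * cps a z)%C.
Proof.
  intros Ha. unfold cps. rewrite <- CSeries_scal by (apply cps_summable; assumption).
  apply CSeries_ext; intros n. unfold PS_scal; change (scal k (a n)) with (k * a n).
  rewrite RtoC_mult; ring.
Qed.

Lemma cps_incr (a : nat -> R) (z : C) :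
  Rbar_lt (Cmod z) (CV_radius a) ->
  cps (PS_incr_1 a) z = (z * cps a z)%C.
Proof.
  intros Ha. unfold cps at 1. rewrite CSeries_incr.
  - unfold cps. rewrite <- CSeries_scal by (apply cps_summable; assumption).
    simpl PS_incr_1. change (@zero R_AbsRing) with 0. change zero with 0.
    rewrite Cmult_0_l, Cplus_0_l. apply CSeries_ext; intros n.
    rewrite Cpow_S; ring.
  - apply cps_summable. rewrite CV_radius_incr_1; exact Ha.
Qed.

Lemma Cmod_cps_le (a : nat -> R) (z : C) :
  Rbar_lt (Cmod z) (CV_radius a) ->
  (forall n, 0 <= a n) -> Cmod (cps a z) <= PSeries a (Cmod z).
Proof.
  intros Hz Ha. eapply Rle_trans; [apply Cmod_CSeries, cps_summable, Hz|].
  right. apply Series_ext; intros n.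
  rewrite Cmod_mult, Cmod_R, Cmod_pow, Rabs_pos_eq by apply Ha. reflexivity.
Qed.

(** The real part is a difference of two real Cauchy products. The imaginary part follows in
    [cps_mult] by multiplying the first factor by -i, since Im w = Re (- i w). *)
Lemma Cauchy_Re (u v : nat -> C) :
  csummable u -> csummable v ->
  is_series (fun n => sum_f_R0 (fun k => Re (u k * v (n - k)%nat)%C) n)
            (Re (CSeries u * CSeries v)%C).
Proof.
  intros Hu Hv.
  assert (Hur := csummable_Re _ Hu). assert (Hui := csummable_Im _ Hu).
  assert (Hvr := csummable_Re _ Hv). assert (Hvi := csummable_Im _ Hv).
  assert (Aur : ex_series (fun n => Rabs (Re (u n)))).
  { revert Hu; apply ex_series_dom; intros n; rewrite Rabs_Rabsolu; apply re_le_Cmod. }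
  assert (Avr : ex_series (fun n => Rabs (Re (v n)))).
  { revert Hv; apply ex_series_dom; intros n; rewrite Rabs_Rabsolu; apply re_le_Cmod. }
  assert (Aui : ex_series (fun n => Rabs (Im (u n)))).
  { revert Hu; apply ex_series_dom; intros n; rewrite Rabs_Rabsolu; apply im_le_Cmod. }
  assert (Avi : ex_series (fun n => Rabs (Im (v n)))).
  { revert Hv; apply ex_series_dom; intros n; rewrite Rabs_Rabsolu; apply im_le_Cmod. }
  assert (H1 := is_series_mult _ _ _ _ (Series_correct _ Hur) (Series_correct _ Hvr) Aur Avr).
  assert (H2 := is_series_mult _ _ _ _ (Series_correct _ Hui) (Series_correct _ Hvi) Aui Avi).
  eapply is_series_ext; [|exact (is_series_minus _ _ _ _ H1 H2)].
  intros n. cbv beta. symmetry; exact (minus_sum _ _ n).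
Qed.

Lemma cps_mult (a b : nat -> R) (z : C) :
  Rbar_lt (Cmod z) (CV_radius a) -> Rbar_lt (Cmod z) (CV_radius b) ->
  cps (PS_mult a b) z = (cps a z * cps b z)%C.
Proof.
  intros Ha Hb.
  assert (Hu := cps_summable a z Ha). assert (Hv := cps_summable b z Hb).
  set (u := fun n => (RtoC (a n) * z ^ n)%C) in *.
  set (v := fun n => (RtoC (b n) * z ^ n)%C) in *.
  assert (E : forall (k : C) (n : nat),
    sum_f_R0 (fun i => Re (k * u i * v (n - i)%nat)%C) n
    = Re (k * (RtoC (PS_mult a b n) * z ^ n))%C).
  { intros k n.
    transitivity (sum_f_R0 (fun i => a i * b (n - i)%nat * Re (k * z ^ n)%C) n).
    - apply sum_eq; intros i Hi. unfold u, v.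
      assert (Hz : (z ^ n)%C = (z ^ i * z ^ (n - i))%C)
        by (rewrite <- Cpow_add_r; f_equal; lia).
      rewrite Hz.
      replace (k * (RtoC (a i) * z ^ i) * (RtoC (b (n - i)%nat) * z ^ (n - i)))%C
        with (RtoC (a i * b (n - i)%nat) * (k * (z ^ i * z ^ (n - i))))%C
        by (rewrite RtoC_mult; ring).
      set (w := (k * _)%C). simpl; ring.
    - rewrite <- scal_sum. unfold PS_mult.
      rewrite Rmult_comm.
      set (t := sum_f_R0 _ n).
      replace (k * (RtoC t * z ^ n))%C with (RtoC t * (k * z ^ n))%C by ring.
      set (w := (k * _)%C). simpl; ring. }
  change (cps a z) with (CSeries u). change (cps b z) with (CSeries v).
  apply injective_projections.
  - change (Series (fun n => Re (RtoC (PS_mult a b n) * z ^ n)%C)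
            = Re (CSeries u * CSeries v)%C).
    apply is_series_unique.
    eapply is_series_ext; [|exact (Cauchy_Re u v Hu Hv)].
    intros n; cbv beta. rewrite <- (Cmult_1_l (RtoC (PS_mult a b n) * z ^ n)%C), <- E.
    apply sum_eq; intros i _. rewrite Cmult_1_l; reflexivity.
  - assert (HI : forall w : C, Im w = Re (- Ci * w)%C) by (intros [p q]; simpl; ring).
    change (Series (fun n => Im (RtoC (PS_mult a b n) * z ^ n)%C)
            = Im (CSeries u * CSeries v)%C).
    apply is_series_unique.
    rewrite HI, Cmult_assoc, <- (CSeries_scal (- Ci)%C u Hu).
    eapply is_series_ext; [|exact (Cauchy_Re _ v (csummable_scal (- Ci)%C u Hu) Hv)].
    intros n; cbv beta. rewrite HI, <- E. reflexivity.
Qed.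

(** The remainder for exponent n + 3 is y times the one for n + 2 plus (n + 2) z^(n+1) (y - z)^2.
    The bound is twice the usual Taylor one, and its factor is exactly the one that differentiating
    a power series twice produces. *)
Lemma Cpow_taylor2 (y z : C) (r : R) (n : nat) :
  Cmod y <= r -> Cmod z <= r ->
  Cmod (y ^ S (S n) - z ^ S (S n) - RtoC (INR (S (S n))) * z ^ S n * (y - z))
  <= INR (S (S n)) * INR (S n) * r ^ n * Cmod (y - z) ^ 2.
Proof.
  intros Hy Hz. assert (Hr : 0 <= r) by (generalize (Cmod_ge_0 y); lra).
  assert (Hh := Cmod_ge_0 (y - z)%C).
  induction n as [|n IH].
  - replace (y ^ 2 - z ^ 2 - RtoC (INR 2) * z ^ 1 * (y - z))%C with ((y - z) ^ 2)%C.
    + rewrite Cmod_pow. simpl INR. simpl (r ^ 0). nra.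
    + simpl (INR 2). rewrite RtoC_plus. simpl. ring.
  - replace (y ^ S (S (S n)) - z ^ S (S (S n)) - RtoC (INR (S (S (S n)))) * z ^ S (S n) * (y - z))%C
      with (y * (y ^ S (S n) - z ^ S (S n) - RtoC (INR (S (S n))) * z ^ S n * (y - z))
            + RtoC (INR (S (S n))) * z ^ S n * (y - z) ^ 2)%C.
    2:{ rewrite (S_INR (S (S n))), RtoC_plus.
        rewrite (Cpow_S y (S (S n))), (Cpow_S z (S (S n))), (Cpow_S z (S n)).
        simpl (_ ^ 2)%C. ring. }
    eapply Rle_trans; [apply Cmod_triangle|].
    rewrite !Cmod_mult, !Cmod_pow, Cmod_R.
    set (Q := Cmod (y ^ S (S n) - _ - _)) in *.
    assert (HQ : 0 <= Q) by apply Cmod_ge_0.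
    assert (Hz1 : Cmod z ^ S n <= r ^ S n) by (apply pow_incr; split; [apply Cmod_ge_0|exact Hz]).
    assert (P := pos_INR (S (S n))). rewrite (Rabs_pos_eq (INR (S (S n)))) by exact P.
    set (h2 := Cmod (y - z) ^ 2) in *. assert (0 <= h2) by (unfold h2; nra).
    apply Rle_trans with (r * (INR (S (S n)) * INR (S n) * r ^ n * h2) + INR (S (S n)) * r ^ S n * h2).
    + apply Rplus_le_compat.
      * apply Rmult_le_compat; auto. apply Cmod_ge_0.
      * apply Rmult_le_compat_r; auto. apply Rmult_le_compat_l; auto.
    + assert (0 <= r ^ S n) by (apply pow_le; exact Hr).
      replace (r * (INR (S (S n)) * INR (S n) * r ^ n * h2) + INR (S (S n)) * r ^ S n * h2)
        with ((INR (S (S n)) * (r ^ S n * h2)) * (INR (S n) + 1)) by (simpl (r ^ S n); ring).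
      rewrite !(S_INR (S (S n))).
      replace ((INR (S (S n)) + 1) * INR (S (S n)) * r ^ S n * h2)
        with ((INR (S (S n)) * (r ^ S n * h2)) * (INR (S (S n)) + 1)) by ring.
      apply Rmult_le_compat_l; [apply Rmult_le_pos; [exact P|apply Rmult_le_pos; assumption]|].
      rewrite (S_INR (S n)); lra.
Qed.

Lemma Rbar_lt_between (x : R) (l : Rbar) :
  Rbar_lt x l -> exists r : R, x < r /\ Rbar_lt r l.
Proof.
  destruct l as [l| |]; simpl; intros H.
  - exists ((x + l) / 2); split; simpl; lra.
  - exists (x + 1); split; [lra|exact I].
  - contradiction.
Qed.

Lemma cderiv_cps (a : nat -> R) (z : C) :
  Rbar_lt (Cmod z) (CV_radius a) -> cderiv (cps a) z (cps (PS_derive a) z).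
Proof.
  intros Hz. destruct (Rbar_lt_between _ _ Hz) as [r [Hr Hra]].
  assert (Hr0 : 0 <= r) by (generalize (Cmod_ge_0 z); lra).
  set (b := PS_derive (PS_derive a)).
  set (K := Series (fun n => Rabs (b n * r ^ n))).
  assert (HK : ex_series (fun n => Rabs (b n * r ^ n))).
  { apply CV_disk_inside. unfold b. rewrite !CV_radius_derive.
    rewrite Rabs_pos_eq by exact Hr0. exact Hra. }
  assert (HK0 : 0 <= K).
  { rewrite <- Rabs_R0. unfold K. rewrite <- Series_zero.
    apply Series_le_Rabs; [|exact HK]. intros n; rewrite Rabs_R0; apply Rabs_pos. }
  assert (Main : forall y, Cmod y <= r -> Rbar_lt (Cmod y) (CV_radius a) ->
    Cmod (cps a y - cps a z - cps (PS_derive a) z * (y - z)) <= K * Cmod (y - z) ^ 2).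
  { intros y Hy Hya.
    assert (Sy := cps_summable _ _ Hya). assert (Sz := cps_summable _ _ Hz).
    assert (Sd : csummable (fun n => RtoC (PS_derive a n) * z ^ n)%C).
    { apply cps_summable. rewrite CV_radius_derive; exact Hz. }
    assert (Sy2 := csummable_incr _ (csummable_incr _ Sy)).
    assert (Sz2 := csummable_incr _ (csummable_incr _ Sz)).
    assert (Sd1 := csummable_scal (- (y - z))%C _ (csummable_incr _ Sd)).
    assert (Sz2' := csummable_scal (- (1))%C _ Sz2).
    cbv beta in *.
    assert (S3 := csummable_plus _ _ (csummable_plus _ _ Sy2 Sz2') Sd1).
    (* The terms of degree 0 and 1 cancel, so the remainder is a series from degree 2 on; summing
       [Cpow_taylor2] over it gives the constant [K], the absolute series of the second derivative
       at a radius [r] strictly between |z| and the radius of convergence. *)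
    replace (cps a y - cps a z - cps (PS_derive a) z * (y - z))%C with
      (CSeries (fun n => (RtoC (a (S (S n))) * y ^ S (S n)
          + - (1) * (RtoC (a (S (S n))) * z ^ S (S n)))
          + - (y - z) * (RtoC (PS_derive a (S n)) * z ^ S n))%C).
    2:{ rewrite CSeries_plus; [|apply csummable_plus; assumption|assumption].
        rewrite CSeries_plus by assumption.
        rewrite !CSeries_scal; [|exact (csummable_incr _ Sd)|assumption].
        unfold cps. rewrite (CSeries_incr _ Sy), (CSeries_incr _ (csummable_incr _ Sy)).
        rewrite (CSeries_incr _ Sz), (CSeries_incr _ (csummable_incr _ Sz)).
        rewrite (CSeries_incr _ Sd).
        change (PS_derive a 0) with (1 * a 1%nat). rewrite Rmult_1_l.
        simpl (_ ^ 0)%C. simpl (_ ^ 1)%C. ring. }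
    eapply Rle_trans; [apply Cmod_CSeries; exact S3|].
    unfold K. rewrite Rmult_comm, <- Series_scal_l.
    apply Series_le.
    2:{ exact (@ex_series_scal R_AbsRing R_NormedModule (Cmod (y - z) ^ 2) _ HK). }
    intros n; split; [apply Cmod_ge_0|].
    replace (RtoC (a (S (S n))) * y ^ S (S n)
          + - (1) * (RtoC (a (S (S n))) * z ^ S (S n))
          + - (y - z) * (RtoC (PS_derive a (S n)) * z ^ S n))%C
      with (RtoC (a (S (S n))) * (y ^ S (S n) - z ^ S (S n)
            - RtoC (INR (S (S n))) * z ^ S n * (y - z)))%C
      by (unfold PS_derive; rewrite RtoC_mult; ring).
    rewrite Cmod_mult, Cmod_R.
    apply Rle_trans with (Rabs (a (S (S n))) *
       (INR (S (S n)) * INR (S n) * r ^ n * Cmod (y - z) ^ 2)).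
    - apply Rmult_le_compat_l; [apply Rabs_pos|]. apply Cpow_taylor2; lra.
    - right. unfold b, PS_derive. rewrite !Rabs_mult.
      rewrite (Rabs_pos_eq (r ^ n)) by (apply pow_le; exact Hr0).
      rewrite !(Rabs_pos_eq (INR _)) by apply pos_INR. ring. }
  apply cderiv_eps. intros eps Heps.
  exists (Rmin (r - Cmod z) (eps / (K + 1))); split.
  { apply Rmin_pos; [lra|apply Rdiv_lt_0_compat; lra]. }
  intros y Hy.
  assert (Hy1 := Rlt_le_trans _ _ _ Hy (Rmin_l _ _)).
  assert (Hy2 := Rlt_le_trans _ _ _ Hy (Rmin_r _ _)).
  assert (Hyr : Cmod y < r).
  { replace y with (z + (y - z))%C by ring.
    eapply Rle_lt_trans; [apply Cmod_triangle|]. lra. }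
  eapply Rle_trans.
  - apply Main; [lra|]. apply (Rbar_lt_trans _ r); [exact Hyr|exact Hra].
  - assert (Hh := Cmod_ge_0 (y - z)%C).
    apply (Rmult_lt_compat_l (K + 1)) in Hy2; [|lra].
    replace ((K + 1) * (eps / (K + 1))) with eps in Hy2 by (field; lra).
    nra.
Qed.

(** * The Bessel and Riccati coefficients *)
Lemma CV_radius_geom (a : nat -> R) (A q r : R) :
  0 < q -> r < / q -> (forall n, Rabs (a n) <= A * q ^ n) -> Rbar_lt r (CV_radius a).
Proof.
  intros Hq Hr Ha. apply (Rbar_lt_le_trans _ (/ q)); [exact Hr|].
  destruct (CV_radius_bounded a) as [H _]. apply H. exists A. intros n.
  rewrite Rabs_mult, (Rabs_pos_eq ((/ q) ^ n)).
  - rewrite pow_inv. apply (Rmult_le_reg_r (q ^ n)); [apply pow_lt; exact Hq|].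
    rewrite Rmult_assoc, Rinv_l, Rmult_1_r; [apply Ha|].
    apply pow_nonzero; lra.
  - left; apply pow_lt, Rinv_0_lt_compat, Hq.
Qed.

Lemma CV_radius_quarter (a : nat -> R) (A r : R) :
  r < 4 -> (forall n, Rabs (a n) <= A * (1 / 4) ^ n) -> Rbar_lt r (CV_radius a).
Proof. intros Hr; apply CV_radius_geom; lra. Qed.

Lemma CV_radius_plus_lt (a b : nat -> R) (r : R) :
  Rbar_lt r (CV_radius a) -> Rbar_lt r (CV_radius b) ->
  Rbar_lt r (CV_radius (PS_plus a b)).
Proof.
  intros Ha Hb. eapply Rbar_lt_le_trans; [|apply CV_radius_plus].
  destruct (CV_radius a), (CV_radius b); simpl in *; auto. apply Rmin_case; assumption.
Qed.

(** The numbers (-1)^n / (4^n n! (nu+1)(nu+2)...(nu+n)), the coefficients of the normalized Bessel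
    function in x = z^2. The recursion keeps Gamma out of the analysis; [bessel_coef_c] makes the
    link. *)
Fixpoint bessel_c (nu : R) (n : nat) : R :=
  match n with
  | O => 1
  | S m => - bessel_c nu m / (4 * INR (S m) * (INR (S m) + nu))
  end.

(** From index 2 on the denominator 4 n (n + nu) is at least 8. Only the first one, 4 (1 + nu), can
    be small, so it is kept as a separate factor. *)
Lemma bessel_c_bound (nu : R) (n : nat) :
  -1 < nu -> Rabs (bessel_c nu (S n)) <= / (4 * (1 + nu)) * (1 / 8) ^ n.
Proof.
  intros Hnu. induction n as [|n IH].
  - simpl. replace (- (1) / (4 * 1 * (1 + nu))) with (- (/ (4 * (1 + nu)))) by (field; lra).
    rewrite Rabs_Ropp, Rabs_pos_eq; [lra|left; apply Rinv_0_lt_compat; lra].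
  - change (bessel_c nu (S (S n))) with
      (- bessel_c nu (S n) / (4 * INR (S (S n)) * (INR (S (S n)) + nu))).
    assert (H2 : 2 <= INR (S (S n))) by (rewrite !S_INR; generalize (pos_INR n); lra).
    set (x := INR (S (S n))) in *.
    unfold Rdiv at 1. rewrite Rabs_mult, Rabs_Ropp, Rabs_inv.
    rewrite (Rabs_pos_eq (4 * x * (x + nu))) by nra.
    assert (H8 : / (4 * x * (x + nu)) <= 1 / 8).
    { unfold Rdiv; rewrite Rmult_1_l. apply Rinv_le_contravar; nra. }
    assert (0 < / (4 * x * (x + nu))) by (apply Rinv_0_lt_compat; nra).
    simpl ((1 / 8) ^ S n).
    replace (/ (4 * (1 + nu)) * (1 / 8 * (1 / 8) ^ n))
      with ((/ (4 * (1 + nu)) * (1 / 8) ^ n) * (1 / 8)) by ring.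
    apply Rmult_le_compat; try lra. apply Rabs_pos.
Qed.

Lemma bessel_c_radius (nu r : R) : -1 < nu -> r < 4 -> Rbar_lt r (CV_radius (bessel_c nu)).
Proof.
  intros Hnu Hr. apply (CV_radius_quarter _ (1 + / (1 + nu)) r Hr).
  assert (0 < / (1 + nu)) by (apply Rinv_0_lt_compat; lra).
  intros [|n].
  - simpl. rewrite Rabs_R1; lra.
  - eapply Rle_trans; [apply bessel_c_bound, Hnu|].
    rewrite Rinv_mult.
    assert (E : (1 / 8) ^ n <= (1 / 4) ^ n) by (apply pow_incr; lra).
    assert (0 < (1 / 4) ^ n) by (apply pow_lt; lra).
    simpl ((1 / 4) ^ S n). nra.
Qed.

(* The coefficients of B = P/x, where P(x) = nu - z J_nu'(z)/J_nu(z) at x = z^2;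
   the recursion is the Riccati equation of B. The table makes the
   course-of-values recursion structural. *)
Fixpoint riccati_table (nu : R) (n : nat) : nat -> R :=
  match n with
  | O => fun _ => / (2 * (1 + nu))
  | S m => fun k =>
      if Nat.leb k m then riccati_table nu m k
      else PS_mult (riccati_table nu m) (riccati_table nu m) m / (2 * (INR m + 2 + nu))
  end.

Definition riccati (nu : R) (n : nat) : R := riccati_table nu n n.

Lemma riccati_table_stable (nu : R) (n k : nat) :
  (k <= n)%nat -> riccati_table nu n k = riccati nu k.
Proof.
  induction n as [|n IH]; intros Hk.
  - replace k with O by lia; reflexivity.
  - destruct (Nat.eq_dec k (S n)) as [->|Hne]; [reflexivity|].
    simpl. rewrite (proj2 (Nat.leb_le k n)) by lia. apply IH; lia.
Qed.

Lemma riccati_0 (nu : R) : riccati nu 0 = / (2 * (1 + nu)).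
Proof. reflexivity. Qed.

Lemma riccati_S (nu : R) (n : nat) :
  riccati nu (S n) = PS_mult (riccati nu) (riccati nu) n / (2 * (INR n + 2 + nu)).
Proof.
  unfold riccati at 1.
  change (riccati_table nu (S n) (S n)) with
    (if Nat.leb (S n) n then riccati_table nu n (S n)
     else PS_mult (riccati_table nu n) (riccati_table nu n) n / (2 * (INR n + 2 + nu))).
  rewrite (proj2 (Nat.leb_gt (S n) n)) by lia. f_equal.
  apply sum_eq; intros i Hi. rewrite !riccati_table_stable by lia. reflexivity.
Qed.

Lemma PS_mult_nonneg (a : nat -> R) (n : nat) :
  (forall k, (k <= n)%nat -> 0 <= a k) -> 0 <= PS_mult a a n.
Proof.
  intros Ha.
  unfold PS_mult.
  replace 0 with (sum_f_R0 (fun _ => 0) n) by (rewrite sum_cte; ring).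
  apply sum_Rle; intros k Hk. apply Rmult_le_pos; apply Ha; lia.
Qed.

Lemma riccati_pos (nu : R) (n : nat) : -1 < nu -> 0 <= riccati nu n.
Proof.
  intros Hnu. induction n as [n IH] using Wf_nat.lt_wf_ind. destruct n as [|n].
  - rewrite riccati_0. left; apply Rinv_0_lt_compat; lra.
  - rewrite riccati_S. apply Rle_mult_inv_pos.
    + apply PS_mult_nonneg; intros k Hk; apply IH; lia.
    + generalize (pos_INR n); lra.
Qed.

(** The convolution of nonnegative sequences is monotone and the denominator grows with nu, so the
    recursion transmits the comparison without any derivative in nu. *)
Lemma riccati_decr (mu nu : R) (n : nat) :
  -1 < mu -> mu <= nu -> riccati nu n <= riccati mu n.
Proof.
  intros Hmu Hle. induction n as [n IH] using Wf_nat.lt_wf_ind. destruct n as [|n].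
  - rewrite !riccati_0. apply Rinv_le_contravar; lra.
  - rewrite !riccati_S. assert (Hn := pos_INR n).
    unfold Rdiv. apply Rmult_le_compat.
    + apply PS_mult_nonneg; intros; apply riccati_pos; lra.
    + left; apply Rinv_0_lt_compat; lra.
    + apply sum_Rle; intros k Hk.
      apply Rmult_le_compat; try (apply riccati_pos; lra); apply IH; lia.
    + apply Rinv_le_contravar; lra.
Qed.

(** These coefficients are twice the Rayleigh sums of j^(-2(n+1)) over the positive zeros j of J_nu,
    and [/ (4 * (1 + nu))] is the first such sum. In the induction the n + 1 products are each at
    most 4 q^(n+2), and the divisor 2 (n + 2 + nu) exceeds 2 (n + 1). *)
Lemma riccati_bound (nu q : R) (n : nat) :
  -1 < nu -> / (4 * (1 + nu)) <= q -> riccati nu n <= 2 * q ^ S n.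
Proof.
  intros Hnu Hq.
  assert (Hq0 : 0 < q).
  { eapply Rlt_le_trans; [|exact Hq]. apply Rinv_0_lt_compat; lra. }
  induction n as [n IH] using Wf_nat.lt_wf_ind. destruct n as [|n].
  - rewrite riccati_0. replace (/ (2 * (1 + nu))) with (2 * / (4 * (1 + nu))) by (field; lra).
    simpl; lra.
  - rewrite riccati_S. assert (Hn := pos_INR n).
    assert (H : PS_mult (riccati nu) (riccati nu) n <= 4 * q ^ S (S n) * INR (S n)).
    { unfold PS_mult. rewrite <- sum_cte. apply sum_Rle; intros k Hk.
      replace (4 * q ^ S (S n)) with ((2 * q ^ S k) * (2 * q ^ S (n - k))).
      - apply Rmult_le_compat; try (apply riccati_pos; lra); apply IH; lia.
      - replace (S (S n)) with (S k + S (n - k))%nat by lia. rewrite pow_add; ring. }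
    apply (Rmult_le_reg_r (2 * (INR n + 2 + nu))); [lra|].
    unfold Rdiv; rewrite Rmult_assoc, Rinv_l, Rmult_1_r by lra.
    rewrite S_INR in H.
    assert (0 < q ^ S (S n)) by (apply pow_lt; exact Hq0). nra.
Qed.

(** The origin of the radius 4 used throughout: for nu >= 0 the first Rayleigh sum is at most
    1/4. *)
Lemma riccati_quarter (nu : R) (n : nat) :
  0 <= nu -> riccati nu n <= 1 / 2 * (1 / 4) ^ n.
Proof.
  intros Hnu. replace (1 / 2 * (1 / 4) ^ n) with (2 * (1 / 4) ^ S n) by (simpl; field).
  apply riccati_bound; [lra|].
  unfold Rdiv; rewrite Rmult_1_l. apply Rinv_le_contravar; lra.
Qed.

Lemma riccati_radius (nu r : R) : 0 <= nu -> r < 4 -> Rbar_lt r (CV_radius (riccati nu)).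
Proof.
  intros Hnu Hr. apply (CV_radius_quarter _ (1 / 2) r Hr). intros n.
  rewrite Rabs_pos_eq by (apply riccati_pos; lra). apply riccati_quarter, Hnu.
Qed.

Definition PS_one (n : nat) : R := match n with O => 1 | S _ => 0 end.

Lemma PS_one_radius (r : R) : r < 4 -> Rbar_lt r (CV_radius PS_one).
Proof.
  intros Hr. apply (CV_radius_quarter _ 1 r Hr). intros [|n].
  - simpl. rewrite Rabs_R1; lra.
  - change (PS_one (S n)) with 0. rewrite Rabs_R0. generalize (pow_lt (1/4) (S n)); lra.
Qed.

Lemma cps_one (z : C) : Cmod z < 4 -> cps PS_one z = 1.
Proof.
  intros Hz. unfold cps. rewrite CSeries_incr by (apply cps_summable, PS_one_radius, Hz).
  rewrite (CSeries_ext _ (fun _ => RtoC 0)) by (intros n; simpl PS_one; ring).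
  replace (CSeries (fun _ => RtoC 0)) with (RtoC 0).
  - simpl PS_one. simpl (z ^ 0)%C. ring.
  - unfold CSeries. simpl. rewrite Series_zero. reflexivity.
Qed.

Lemma PS_mult_incr (a b : nat -> R) (n : nat) :
  PS_mult (PS_incr_1 a) b (S n) = PS_mult a b n.
Proof.
  unfold PS_mult. rewrite decomp_sum by lia. simpl PS_incr_1. simpl Nat.pred.
  change (zero : R) with 0. rewrite Rmult_0_l, Rplus_0_l.
  apply sum_eq; intros i Hi. f_equal.
Qed.

(** The Riccati equation of P = x B divided by x; [PS_derive (PS_incr_1 _)] is the series of P'.
    Comparing coefficients gives back the recursion. *)
Lemma riccati_equation (nu : R) (x : C) :
  0 < nu -> Cmod x < 4 ->
  (RtoC 2 * cps (PS_derive (PS_incr_1 (riccati nu))) x + RtoC (2 * nu) * cps (riccati nu) x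
   = 1 + x * (cps (riccati nu) x * cps (riccati nu) x))%C.
Proof.
  intros Hnu Hx.
  assert (Hb : Rbar_lt (Cmod x) (CV_radius (riccati nu))) by (apply riccati_radius; lra).
  set (b := riccati nu) in *.
  assert (Hd : Rbar_lt (Cmod x) (CV_radius (PS_derive (PS_incr_1 b))))
    by (rewrite CV_radius_derive, CV_radius_incr_1; exact Hb).
  assert (H1 := PS_one_radius (Cmod x) Hx).
  assert (Hd2 : Rbar_lt (Cmod x) (CV_radius (PS_scal 2 (PS_derive (PS_incr_1 b)))))
    by (rewrite CV_radius_scal by lra; exact Hd).
  assert (Hb2 : Rbar_lt (Cmod x) (CV_radius (PS_scal (2 * nu) b)))
    by (rewrite CV_radius_scal by lra; exact Hb).
  assert (H1' : Rbar_lt (Cmod x) (CV_radius (PS_scal (-1) PS_one)))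
    by (rewrite CV_radius_scal by lra; exact H1).
  assert (E : cps (PS_mult (PS_incr_1 b) b) x
    = cps (PS_plus (PS_plus (PS_scal 2 (PS_derive (PS_incr_1 b))) (PS_scal (2 * nu) b))
                   (PS_scal (-1) PS_one)) x).
  { apply cps_ext; intros n.
    unfold PS_plus, PS_scal, PS_derive; cbn [PS_incr_1].
    change plus with Rplus. change scal with Rmult.
    destruct n as [|n].
    - change (PS_mult (PS_incr_1 b) b 0) with (0 * b O).
      assert (B0 : b O = / (2 * (1 + nu))) by apply riccati_0.
      rewrite B0. change (PS_one 0) with 1. change (INR 1) with 1. field; lra.
    - rewrite PS_mult_incr.
      assert (BS : b (S n) = PS_mult b b n / (2 * (INR n + 2 + nu))) by apply riccati_S.
      rewrite BS.
      rewrite (S_INR (S n)), (S_INR n). change (PS_one (S n)) with 0. generalize (pos_INR n); intros.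
      field; lra. }
  rewrite cps_mult in E; [|rewrite CV_radius_incr_1; exact Hb|exact Hb].
  rewrite cps_incr in E by exact Hb.
  rewrite cps_plus in E; [|apply CV_radius_plus_lt; assumption|exact H1'].
  rewrite cps_plus in E by assumption.
  rewrite !cps_scal in E by assumption. rewrite cps_one in E by exact Hx.
  rewrite Cmult_assoc, E. ring.
Qed.

(** Bessel's differential equation for z^(-nu) J_nu(z), rewritten in the variable x = z^2. *)
Lemma bessel_c_equation (nu : R) (x : C) :
  -1 < nu -> Cmod x < 4 ->
  (RtoC 4 * (x * cps (PS_derive (PS_derive (bessel_c nu))) x
     + RtoC (1 + nu) * cps (PS_derive (bessel_c nu)) x) = - cps (bessel_c nu) x)%C.
Proof.
  intros Hnu Hx. assert (Hc := bessel_c_radius nu (Cmod x) Hnu Hx).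
  set (c := bessel_c nu) in *.
  assert (Hd : Rbar_lt (Cmod x) (CV_radius (PS_derive c)))
    by (rewrite CV_radius_derive; exact Hc).
  assert (Hdd : Rbar_lt (Cmod x) (CV_radius (PS_derive (PS_derive c))))
    by (rewrite CV_radius_derive; exact Hd).
  assert (Hi : Rbar_lt (Cmod x) (CV_radius (PS_incr_1 (PS_derive (PS_derive c)))))
    by (rewrite CV_radius_incr_1; exact Hdd).
  assert (Hs : Rbar_lt (Cmod x) (CV_radius (PS_scal (1 + nu) (PS_derive c))))
    by (rewrite CV_radius_scal by lra; exact Hd).
  assert (E : cps (PS_scal (- / 4) c) x = cps (PS_plus (PS_incr_1 (PS_derive (PS_derive c)))
     (PS_scal (1 + nu) (PS_derive c))) x).
  { apply cps_ext; intros n. unfold PS_plus, PS_scal, PS_derive.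
    change plus with Rplus. change scal with Rmult.
    assert (Hn := pos_INR n).
    assert (CS : c (S n) = - c n / (4 * INR (S n) * (INR (S n) + nu))) by reflexivity.
    destruct n as [|n].
    - rewrite CS. cbn [PS_incr_1]. change (zero : R) with 0. change (INR 1) with 1.
      change (c O) with 1. field; lra.
    - cbn [PS_incr_1]. rewrite CS. rewrite (S_INR (S n)) in *. field; lra. }
  rewrite cps_plus, !cps_scal, cps_incr in E by assumption.
  rewrite <- E. rewrite Cmult_assoc, <- RtoC_mult.
  replace (4 * - / 4) with (Ropp 1) by field. rewrite RtoC_opp. ring.
Qed.

(** * The logarithm of the normalized Bessel function *)
Lemma Cmod_scal_le (t : R) (x : C) : 0 <= t <= 1 -> Cmod (RtoC t * x) <= Cmod x.
Proof.
  intros Ht. rewrite Cmod_mult, Cmod_R, Rabs_pos_eq by lra.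
  generalize (Cmod_ge_0 x); nra.
Qed.

Lemma C_eq_by_forms (z w : C) : (forall k : C, Re (k * z)%C = Re (k * w)%C) -> z = w.
Proof.
  intros H. apply injective_projections.
  - generalize (H 1). rewrite !Cmult_1_l. auto.
  - generalize (H (- Ci)%C). destruct z, w; simpl. lra.
Qed.

Lemma is_derive_continuity (f : R -> R) (x l : R) : is_derive f x l -> continuity_pt f x.
Proof.
  intros H. apply derivable_continuous_pt, ex_derive_Reals_0. exists l; exact H.
Qed.

Lemma cderiv_ray (f : C -> C) (x l k : C) (t : R) :
  cderiv f (RtoC t * x)%C l ->
  is_derive (fun s : R => Re (k * f (RtoC s * x))%C) t (Re (k * (l * x))%C).
Proof.
  intros H. apply (is_derive_ext (fun s : R => Re (k * f (0 + RtoC s * x))%C)).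
  - intros s; rewrite Cplus_0_l; reflexivity.
  - apply cderiv_line. rewrite Cplus_0_l; exact H.
Qed.

Lemma cderiv_zero_const (f : C -> C) (x : C) :
  (forall t : R, 0 <= t <= 1 -> cderiv f (RtoC t * x)%C 0) -> f x = f 0.
Proof.
  intros H. apply C_eq_by_forms; intros k.
  destruct (MVT_gen (fun s : R => Re (k * f (RtoC s * x))%C) 0 1 (fun _ => 0))
    as [c [_ E]].
  - intros t Ht. rewrite Rmin_left, Rmax_right in Ht by lra.
    replace 0 with (Re (k * (0 * x))%C) by (rewrite Cmult_0_l, Cmult_0_r; reflexivity).
    apply cderiv_ray, H; lra.
  - intros t Ht. rewrite Rmin_left, Rmax_right in Ht by lra.
    eapply is_derive_continuity, cderiv_ray, H; lra.
  - rewrite Cmult_1_l, Cmult_0_l in E. lra.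
Qed.

(* Along the ray [t |-> t x] the square of any real form of [f] has a
   nonpositive derivative. *)
Lemma cderiv_euler_zero (f df : C -> C) (m : R) (x : C) :
  0 < m ->
  (forall t : R, 0 <= t <= 1 -> cderiv f (RtoC t * x)%C (df (RtoC t * x)%C)) ->
  (forall t : R, 0 <= t <= 1 ->
     (RtoC t * x * df (RtoC t * x) = - RtoC m * f (RtoC t * x))%C) ->
  f x = 0.
Proof.
  intros Hm Hd He. apply C_eq_by_forms; intros k. rewrite Cmult_0_r.
  set (g := fun s : R => Re (k * f (RtoC s * x))%C).
  set (g' := fun s : R => Re (k * (df (RtoC s * x) * x))%C).
  assert (Hg : forall t, 0 <= t <= 1 -> is_derive g t (g' t)).
  { intros t Ht. apply cderiv_ray, Hd, Ht. }
  assert (Heq : forall t, 0 <= t <= 1 -> t * g' t = - m * g t).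
  { intros t Ht. unfold g', g.
    transitivity (Re (k * (RtoC t * x * df (RtoC t * x)))%C).
    - replace (k * (RtoC t * x * df (RtoC t * x)))%C
        with (RtoC t * (k * (df (RtoC t * x) * x)))%C by ring.
      set (w := (k * _)%C). simpl; ring.
    - rewrite He by exact Ht.
      replace (k * (- RtoC m * f (RtoC t * x)))%C
        with (RtoC (- m) * (k * f (RtoC t * x)))%C by (rewrite RtoC_opp; ring).
      set (w := (k * _)%C). simpl; ring. }
  assert (G0 : g 0 = 0) by (generalize (Heq 0 ltac:(lra)); nra).
  destruct (MVT_gen (fun s => g s * g s) 0 1 (fun s => 2 * (g' s * g s))) as [c [Hc E]].
  - intros t Ht. rewrite Rmin_left, Rmax_right in Ht by lra.
    replace (2 * (g' t * g t)) with (g' t * g t + g t * g' t) by ring.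
    apply (is_derive_mult g g t (g' t) (g' t)); [| |intros; apply Rmult_comm]; apply Hg; lra.
  - intros t Ht. rewrite Rmin_left, Rmax_right in Ht by lra.
    apply continuity_pt_mult; apply (is_derive_continuity _ _ (g' t)), Hg; lra.
  - rewrite Rmin_left, Rmax_right in Hc by lra.
    assert (Hle : g' c * g c <= 0).
    { destruct (Req_dec c 0) as [->|Hc0]; [rewrite G0; lra|].
      assert (Hcc := Heq c Hc).
      apply (Rmult_le_reg_l c); [lra|]. rewrite <- Rmult_assoc, Hcc. nra. }
    assert (G1 : g 1 = 0) by (rewrite G0 in E; nra).
    unfold g in G1. rewrite Cmult_1_l in G1. rewrite G1; reflexivity.
Qed.

(** The series of -1/2 times the integral of B from 0: since phi'/phi should be -B/2, this is the
    candidate for log phi. *)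
Definition log_coef (nu : R) : nat -> R := PS_scal (- / 2) (PS_Int (riccati nu)).

Lemma log_coef_radius (nu r : R) : 0 <= nu -> r < 4 -> Rbar_lt r (CV_radius (log_coef nu)).
Proof.
  intros Hnu Hr. unfold log_coef. rewrite CV_radius_scal by lra.
  rewrite CV_radius_Int. apply riccati_radius; assumption.
Qed.

Lemma cderiv_log (nu : R) (x : C) :
  0 <= nu -> Cmod x < 4 ->
  cderiv (cps (log_coef nu)) x (RtoC (- / 2) * cps (riccati nu) x)%C.
Proof.
  intros Hnu Hx. rewrite <- cps_scal by (apply riccati_radius; assumption).
  rewrite (cps_ext (PS_scal (- / 2) (riccati nu)) (PS_derive (log_coef nu))).
  - apply cderiv_cps, log_coef_radius; assumption.
  - intros n. unfold log_coef, PS_derive, PS_scal. change scal with Rmult.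
    unfold PS_Int. field. apply not_0_INR; lia.
Qed.

Lemma log_coef_0 (nu : R) : cps (log_coef nu) 0 = 0.
Proof.
  rewrite cps_0. unfold log_coef, PS_scal, PS_Int. f_equal. change scal with Rmult. simpl; ring.
Qed.

Lemma half_half (z : C) : (RtoC 2 * (RtoC (- / 2) * z) = - z)%C.
Proof.
  rewrite Cmult_assoc, <- RtoC_mult. replace (2 * - / 2) with (Ropp 1) by field.
  rewrite RtoC_opp; ring.
Qed.

Lemma cps_derive_incr (a : nat -> R) (x : C) :
  Rbar_lt (Cmod x) (CV_radius a) ->
  cps (PS_derive (PS_incr_1 a)) x = (cps a x + x * cps (PS_derive a) x)%C.
Proof.
  intros Ha. rewrite <- cps_incr by (rewrite CV_radius_derive; exact Ha).
  rewrite <- cps_plus.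
  - apply cps_ext; intros n. unfold PS_plus, PS_derive. change plus with Rplus.
    destruct n as [|n]; cbn [PS_incr_1].
    + change (zero : R) with 0. change (INR 1) with 1. ring.
    + rewrite (S_INR (S n)); ring.
  - exact Ha.
  - rewrite CV_radius_incr_1, CV_radius_derive; exact Ha.
Qed.

(** The defect E = 2 phi' + B phi is multiplied by the integrating factor exp L, where L' = -B/2.
    The Bessel and Riccati equations then give x W' = - (1 + nu) W for W = exp(L) E; such a W would
    behave like x^(-(1+nu)), so regularity at 0 forces W = 0. No division by phi occurs, whose zeros
    are not yet excluded. *)
Lemma bessel_log_derivative (nu : R) (x : C) :
  0 < nu -> Cmod x < 4 ->
  (RtoC 2 * cps (PS_derive (bessel_c nu)) x = - (cps (riccati nu) x * cps (bessel_c nu) x))%C.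
Proof.
  intros Hnu Hx.
  set (phi := cps (bessel_c nu)). set (phi1 := cps (PS_derive (bessel_c nu))).
  set (phi2 := cps (PS_derive (PS_derive (bessel_c nu)))).
  set (B := cps (riccati nu)). set (B1 := cps (PS_derive (riccati nu))).
  set (L := cps (log_coef nu)).
  set (E := fun y => (RtoC 2 * phi1 y + B y * phi y)%C).
  set (W := fun y => (Cexp (L y) * E y)%C).
  set (W1 := fun y => (RtoC (- / 2) * B y * Cexp (L y) * E y +
     Cexp (L y) * (RtoC 2 * phi2 y + (B1 y * phi y + B y * phi1 y)))%C).
  assert (HW : W x = 0).
  { apply (cderiv_euler_zero W W1 (1 + nu)); [lra| |].
    - intros t Ht. set (y := (RtoC t * x)%C).
      assert (Hy : Cmod y < 4) by (eapply Rle_lt_trans; [apply Cmod_scal_le|]; assumption).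
      unfold W, W1. apply (cderiv_mult (fun u => Cexp (L u)) E).
      + exact (cderiv_comp Cexp L y _ _ (cderiv_Cexp (L y)) (cderiv_log nu y ltac:(lra) Hy)).
      + unfold E. apply (cderiv_plus (fun u => RtoC 2 * phi1 u)%C (fun u => B u * phi u)%C).
        * apply (cderiv_scal (RtoC 2) phi1), cderiv_cps. rewrite CV_radius_derive. apply bessel_c_radius; lra.
        * apply (cderiv_mult B phi); apply cderiv_cps; [apply riccati_radius|apply bessel_c_radius]; lra.
    - intros t Ht. set (y := (RtoC t * x)%C).
      assert (Hy : Cmod y < 4) by (eapply Rle_lt_trans; [apply Cmod_scal_le|]; assumption).
      assert (R1 := riccati_equation nu y Hnu Hy).
      rewrite cps_derive_incr in R1 by (apply riccati_radius; lra).
      assert (R2 := bessel_c_equation nu y ltac:(lra) Hy).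
      fold B B1 in R1. fold phi phi1 phi2 in R2.
      assert (R1' : (RtoC 2 * (y * B1 y) = 1 + y * (B y * B y) - RtoC 2 * B y - RtoC (2 * nu) * B y)%C)
        by (rewrite <- R1; ring).
      assert (R2' : (RtoC 4 * (y * phi2 y) = - phi y - RtoC 4 * RtoC (1 + nu) * phi1 y)%C)
        by (rewrite <- R2; ring).
      unfold W, W1, E.
      assert (N2 : RtoC 2 <> 0) by (intros K; apply RtoC_inj in K; lra).
      assert (K : forall u v : C, (RtoC 2 * u = RtoC 2 * v)%C -> u = v).
      { intros u v Huv. replace u with (/ RtoC 2 * (RtoC 2 * u))%C by (field; exact N2).
        rewrite Huv. field; exact N2. }
      apply K.
      transitivity (Cexp (L y) * ((RtoC 2 * (RtoC (- / 2) * (y * B y))) * (RtoC 2 * phi1 y + B y * phi y)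
        + (RtoC 4 * (y * phi2 y) + (RtoC 2 * (y * B1 y)) * phi y + RtoC 2 * (y * B y * phi1 y))))%C.
      { replace (RtoC 4) with (RtoC 2 * RtoC 2)%C by (rewrite <- RtoC_mult; f_equal; lra). ring. }
      rewrite half_half, R1', R2'.
      rewrite RtoC_mult, RtoC_plus.
      replace (RtoC 4) with (RtoC 2 * RtoC 2)%C by (rewrite <- RtoC_mult; f_equal; lra).
      ring. }
  unfold W in HW.
  assert (HE : E x = 0).
  { replace (E x) with (Cexp (- L x) * (Cexp (L x) * E x))%C.
    - rewrite HW; ring.
    - rewrite Cmult_assoc, (Cmult_comm (Cexp (- L x))), Cexp_opp_r; ring. }
  unfold E in HE.
  replace (RtoC 2 * phi1 x)%C with ((RtoC 2 * phi1 x + B x * phi x) - B x * phi x)%C by ring.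
  rewrite HE; ring.
Qed.

(** The product phi exp(-L) has derivative 0 along rays and value 1 at 0. In particular phi has no
    zero in |x| < 4, so for nu > 0 the branch domain is the whole disk. *)
Lemma bessel_exp_log (nu : R) (x : C) :
  0 < nu -> Cmod x < 4 -> Cexp (cps (log_coef nu) x) = cps (bessel_c nu) x.
Proof.
  intros Hnu Hx.
  set (phi := cps (bessel_c nu)). set (L := cps (log_coef nu)).
  set (H := fun y => (phi y * Cexp (RtoC (-1) * L y))%C).
  assert (E : H x = H 0).
  { apply cderiv_zero_const. intros t Ht. set (y := (RtoC t * x)%C).
    assert (Hy : Cmod y < 4) by (eapply Rle_lt_trans; [apply Cmod_scal_le|]; assumption).
    unfold H.
    assert (HL := cderiv_log nu y ltac:(lra) Hy).
    replace (RtoC 0) with (cps (PS_derive (bessel_c nu)) y * Cexp (RtoC (-1) * L y)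
      + phi y * (RtoC (-1) * (RtoC (- / 2) * cps (riccati nu) y) * Cexp (RtoC (-1) * L y)))%C.
    - apply (cderiv_mult phi (fun u => Cexp (RtoC (-1) * L u))).
      + apply cderiv_cps, bessel_c_radius; lra.
      + exact (cderiv_comp Cexp (fun u => RtoC (-1) * L u)%C y _ _ (cderiv_Cexp _)
          (cderiv_scal (RtoC (-1)) L y _ HL)).
    - assert (B := bessel_log_derivative nu y Hnu Hy). fold phi in B.
      set (p := cps (PS_derive (bessel_c nu)) y) in *. set (b := cps (riccati nu) y) in *.
      replace (RtoC (-1) * (RtoC (- / 2) * b))%C with (RtoC (/ 2) * b)%C.
      2:{ rewrite Cmult_assoc, <- RtoC_mult. do 2 f_equal; lra. }
      replace p with (RtoC (/ 2) * (RtoC 2 * p))%C.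
      2:{ rewrite Cmult_assoc, <- RtoC_mult. replace (/ 2 * 2) with 1 by lra. ring. }
      rewrite B; ring. }
  unfold H in E. unfold L at 2 in E. rewrite log_coef_0 in E. unfold phi at 2 in E.
  rewrite cps_0 in E. rewrite Cmult_0_r, Cexp_0 in E. change (bessel_c nu 0) with 1 in E.
  fold L. fold phi.
  replace (Cexp (L x)) with (Cexp (L x) * (1 * 1))%C by ring.
  rewrite <- E.
  replace (RtoC (-1) * L x)%C with (- L x)%C.
  2:{ replace (RtoC (-1)) with (- (1))%C; [ring|]. rewrite <- RtoC_opp. f_equal; lra. }
  replace (Cexp (L x) * (phi x * Cexp (- L x)))%C
    with (phi x * (Cexp (L x) * Cexp (- L x)))%C by ring.
  rewrite Cexp_opp_r; ring.
Qed.

(** * The Gamma function *)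
Definition gamma_integrand (x t : R) : R := Rpower t (x - 1) * exp (- t).

Lemma exp_le_1 (t : R) : t <= 0 -> exp t <= 1.
Proof.
  intros Ht. rewrite <- exp_0.
  destruct Ht as [Ht| ->]; [left; apply exp_increasing, Ht|right; reflexivity].
Qed.

Lemma is_derive_Rpower (x t : R) :
  0 < t -> is_derive (fun s => Rpower s x) t (x * Rpower t (x - 1)).
Proof.
  intros Ht. apply is_derive_Reals. apply derivable_pt_lim_power; exact Ht.
Qed.

Lemma continuous_Rpower (x t : R) : 0 < t -> continuous (fun s => Rpower s x) t.
Proof.
  intros Ht. apply (@ex_derive_continuous R_AbsRing R_NormedModule).
  eexists; apply is_derive_Rpower, Ht.
Qed.

Lemma continuous_exp_opp (t : R) : continuous (fun s => exp (- s)) t.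
Proof.
  apply (@ex_derive_continuous R_AbsRing R_NormedModule). auto_derive; exact I.
Qed.

Lemma continuous_gamma_integrand (x t : R) : 0 < t -> continuous (gamma_integrand x) t.
Proof.
  intros Ht. unfold gamma_integrand.
  apply (continuous_mult (fun s => Rpower s (x - 1)) (fun s => exp (- s)));
    [apply continuous_Rpower, Ht|apply continuous_exp_opp].
Qed.

Lemma gamma_integrand_pos (x t : R) : 0 < gamma_integrand x t.
Proof. apply Rmult_lt_0_compat; apply exp_pos. Qed.

Lemma ex_RInt_gamma (x a b : R) : 0 < a -> a <= b -> ex_RInt (gamma_integrand x) a b.
Proof.
  intros Ha Hab. apply (@ex_RInt_continuous R_CompleteNormedModule).
  intros t Ht. rewrite Rmin_left, Rmax_right in Ht by lra.
  apply continuous_gamma_integrand; lra.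
Qed.

(** An improper integral of a positive integrand converges once it is bounded. Stated over a filter,
    one argument serves both ends, 0 and infinity. *)
Lemma monotone_filterlim (F : (R -> Prop) -> Prop) (FF : Filter F)
  (D : R -> Prop) (G : R -> R) (M a0 : R) :
  D a0 -> (forall a, D a -> G a <= M) ->
  (forall a, D a -> F (fun b => D b /\ G a <= G b)) ->
  exists l, filterlim G F (locally l) /\ forall a, D a -> G a <= l.
Proof.
  intros H0 HM Hmono.
  destruct (completeness (fun y => exists a, D a /\ y = G a)) as [l [Hub Hlub]].
  - exists M; intros y [a [Ha ->]]; auto.
  - exists (G a0), a0; auto.
  - exists l; split.
    + intros P [eps HP]. unfold filtermap.
      assert (Hex : exists a, D a /\ l - eps < G a).
      { apply Classical_Prop.NNPP; intros Hn.
        assert (l <= l - eps).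
        { apply Hlub. intros y [a [Ha ->]].
          destruct (Rle_dec (G a) (l - eps)) as [h|h]; [exact h|].
          exfalso; apply Hn; exists a; split; [exact Ha|lra]. }
        generalize (cond_pos eps); lra. }
      destruct Hex as [a [Ha Hla]].
      generalize (Hmono a Ha). apply filter_imp. intros b [Hb Hab].
      apply HP. assert (G b <= l) by (apply Hub; exists b; auto).
      change (Rabs (G b - l) < eps). apply Rabs_lt_between. generalize (cond_pos eps); lra.
    + intros a Ha. apply Hub; exists a; auto.
Qed.

Lemma RInt_gamma_nonneg (x a b : R) : 0 < a -> a <= b -> 0 <= RInt (gamma_integrand x) a b.
Proof.
  intros Ha Hab. apply RInt_ge_0; [exact Hab|apply ex_RInt_gamma; assumption|].
  intros; left; apply gamma_integrand_pos.
Qed.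

Lemma RInt_gamma_Chasles (x a b c : R) :
  0 < a -> a <= b -> b <= c ->
  RInt (gamma_integrand x) a c = RInt (gamma_integrand x) a b + RInt (gamma_integrand x) b c.
Proof.
  intros Ha Hab Hbc. symmetry.
  apply (RInt_Chasles (gamma_integrand x) a b c); apply ex_RInt_gamma; lra.
Qed.

(** On (0, 1] the integrand is at most t^(x-1), whose integral from a to 1 is (1 - a^x)/x, hence the
    bound [/ x]. *)
Lemma gamma_left (x : R) :
  0 < x -> exists l, is_RInt_gen (gamma_integrand x) (at_right 0) (at_point 1) l /\ 0 <= l.
Proof.
  intros Hx.
  destruct (monotone_filterlim (at_right 0) _ (fun a => 0 < a <= 1)
     (fun a => RInt (gamma_integrand x) a 1) (/ x) 1) as [l [Hl Hle]].
  - lra.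
  - intros a Ha.
    assert (HI : is_RInt (fun t => Rpower t (x - 1)) a 1 (Rpower 1 x / x - Rpower a x / x)).
    { apply (is_RInt_derive (fun t => Rpower t x / x) (fun t => Rpower t (x - 1))).
      - intros t Ht. rewrite Rmin_left, Rmax_right in Ht by lra.
        apply (is_derive_ext (fun s => / x * Rpower s x)); [intros; unfold Rdiv; apply Rmult_comm|].
        assert (E : / x * (x * Rpower t (x - 1)) = Rpower t (x - 1)) by (field; lra).
        rewrite <- E.
        apply (is_derive_scal (fun s => Rpower s x)). apply is_derive_Rpower; lra.
      - intros t Ht. rewrite Rmin_left, Rmax_right in Ht by lra.
        apply continuous_Rpower; lra. }
    apply Rle_trans with (RInt (fun t => Rpower t (x - 1)) a 1).
    + apply RInt_le; [lra|apply ex_RInt_gamma; lra|eexists; exact HI|].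
      intros t Ht. unfold gamma_integrand.
      assert (exp (- t) <= 1) by (apply exp_le_1; lra).
      generalize (exp_pos ((x - 1) * ln t)) (exp_pos (- t)). unfold Rpower. nra.
    + rewrite (is_RInt_unique _ _ _ _ HI).
      assert (0 < Rpower a x) by apply exp_pos.
      replace (Rpower 1 x) with 1 by (unfold Rpower; rewrite ln_1, Rmult_0_r, exp_0; reflexivity).
      assert (0 < / x) by (apply Rinv_0_lt_compat; lra).
      unfold Rdiv; nra.
  - intros a Ha. exists (mkposreal a (proj1 Ha)). intros b Hb Hb0.
    change (Rabs (b - 0) < a) in Hb. rewrite Rminus_0_r, Rabs_pos_eq in Hb by lra.
    split; [lra|]. rewrite (RInt_gamma_Chasles x b a 1) by lra.
    generalize (RInt_gamma_nonneg x b a); lra.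
  - exists l; split.
    + intros P HP. specialize (Hl P HP).
      apply (Filter_prod _ _ _ (fun a => 0 < a <= 1 /\ P (RInt (gamma_integrand x) a 1))
        (fun b => b = 1)).
      * apply filter_and; [|exact Hl]. exists (mkposreal 1 Rlt_0_1). intros b Hb Hb0.
        change (Rabs (b - 0) < 1) in Hb. rewrite Rminus_0_r, Rabs_pos_eq in Hb by lra. lra.
      * reflexivity.
      * intros a b [Ha HPa] ->. eexists; split; [|exact HPa].
        apply (RInt_correct (gamma_integrand x)), ex_RInt_gamma; simpl; lra.
    + eapply Rle_trans; [|apply (Hle 1); lra]. apply RInt_gamma_nonneg; lra.
Qed.

Lemma Rpower_le_exp_half (y : R) :
  exists K, 0 < K /\ forall t, 1 <= t -> Rpower t y <= K * exp (t / 2).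
Proof.
  (* From ln u <= u - 1 at u = t/m one gets ln t <= t/m + ln m; this [m] makes |y| t/m at most
     t/2. *)
  set (m := 2 * (Rabs y + 1)). assert (Hm : 0 < m) by (unfold m; generalize (Rabs_pos y); lra).
  exists (exp (Rabs y * Rabs (ln m))); split; [apply exp_pos|].
  intros t Ht. unfold Rpower. rewrite <- exp_plus.
  assert (Hln : ln t <= t / m + Rabs (ln m)).
  { replace t with (t / m * m) at 1 by (field; lra).
    assert (Htm : 0 < t / m) by (apply Rdiv_lt_0_compat; lra).
    rewrite ln_mult by assumption.
    generalize (exp_ineq1_le (ln (t / m))). rewrite exp_ln by exact Htm.
    generalize (Rle_abs (ln m)). lra. }
  assert (Hl0 : 0 <= ln t).
  { rewrite <- ln_1. destruct Ht as [Ht| <-]; [left; apply ln_increasing; lra|lra]. }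
  assert (H : y * ln t <= Rabs y * Rabs (ln m) + t / 2).
  { apply Rle_trans with (Rabs y * ln t).
    - apply Rmult_le_compat_r; [exact Hl0|apply Rle_abs].
    - apply Rle_trans with (Rabs y * (t / m + Rabs (ln m))).
      + apply Rmult_le_compat_l; [apply Rabs_pos|exact Hln].
      + assert (Rabs y * (t / m) <= t / 2); [|lra].
        apply (Rmult_le_reg_r m); [exact Hm|].
        replace (Rabs y * (t / m) * m) with (Rabs y * t) by (field; lra).
        unfold m. generalize (Rabs_pos y). nra. }
  destruct H as [H|H]; [left; apply exp_increasing, H|rewrite H; right; reflexivity].
Qed.

Lemma gamma_integrand_decay (y : R) :
  exists K, 0 < K /\ forall t, 1 <= t -> Rpower t y * exp (- t) <= K * exp (- (t / 2)).
Proof.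
  destruct (Rpower_le_exp_half y) as [K [HK H]]. exists K; split; [exact HK|].
  intros t Ht. replace (exp (- (t / 2))) with (exp (t / 2) * exp (- t))
    by (rewrite <- exp_plus; f_equal; lra).
  rewrite <- Rmult_assoc. apply Rmult_le_compat_r; [left; apply exp_pos|auto].
Qed.

Lemma gamma_right (x : R) :
  exists l, is_RInt_gen (gamma_integrand x) (at_point 1) (Rbar_locally p_infty) l /\ 0 < l.
Proof.
  destruct (gamma_integrand_decay (x - 1)) as [K [HK Hdec]].
  destruct (monotone_filterlim (Rbar_locally p_infty) _ (fun b => 1 <= b)
     (fun b => RInt (gamma_integrand x) 1 b) (2 * K) 1) as [l [Hl Hle]].
  - lra.
  - intros b Hb.
    assert (HI : is_RInt (fun t => K * exp (- (t / 2))) 1 b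
       (- 2 * K * exp (- (b / 2)) - - 2 * K * exp (- (1 / 2)))).
    { apply (is_RInt_derive (fun t => - 2 * K * exp (- (t / 2)))
        (fun t => K * exp (- (t / 2)))).
      - intros t _. auto_derive; [exact I|]. change (t * / 2) with (t / 2). field.
      - intros t _. apply (@ex_derive_continuous R_AbsRing R_NormedModule).
        auto_derive; exact I. }
    apply Rle_trans with (RInt (fun t => K * exp (- (t / 2))) 1 b).
    + apply RInt_le; [lra|apply ex_RInt_gamma; lra|eexists; exact HI|].
      intros t Ht. apply Hdec; lra.
    + rewrite (is_RInt_unique _ _ _ _ HI).
      assert (0 < exp (- (b / 2))) by apply exp_pos.
      assert (E1 : exp (- (1 / 2)) <= 1) by (apply exp_le_1; lra).
      set (u := exp (- (b / 2))) in *. set (v := exp (- (1 / 2))) in *.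
      assert (0 <= K * (1 - v)) by (apply Rmult_le_pos; lra).
      assert (0 <= K * u) by (apply Rmult_le_pos; lra).
      lra.
  - intros a Ha. exists a. intros b Hb. split; [lra|].
    rewrite (RInt_gamma_Chasles x 1 a b) by lra.
    generalize (RInt_gamma_nonneg x a b); lra.
  - exists l; split.
    + intros P HP. specialize (Hl P HP).
      apply (Filter_prod _ _ _ (fun a => a = 1)
        (fun b => 1 <= b /\ P (RInt (gamma_integrand x) 1 b))).
      * reflexivity.
      * apply (@filter_and _ (Rbar_locally p_infty) _); [|exact Hl]. exists 1; intros; lra.
      * intros a b -> [Hb HPb]. eexists; split; [|exact HPb].
        apply (RInt_correct (gamma_integrand x)), ex_RInt_gamma; simpl; lra.
    + eapply Rlt_le_trans; [|apply (Hle 2); lra].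
      apply RInt_gt_0; [lra|intros; apply gamma_integrand_pos|].
      intros t Ht. apply continuous_gamma_integrand; lra.
Qed.

Lemma is_RInt_gen_gamma (x : R) :
  0 < x -> exists l,
    is_RInt_gen (gamma_integrand x) (at_right 0) (Rbar_locally p_infty) l /\ 0 < l.
Proof.
  intros Hx. destruct (gamma_left x Hx) as [l1 [H1 P1]]. destruct (gamma_right x) as [l2 [H2 P2]].
  exists (l1 + l2); split; [|lra].
  exact (is_RInt_gen_Chasles (gamma_integrand x) 1 l1 l2 H1 H2).
Qed.

Lemma Gamma_unique (x l : R) :
  is_RInt_gen (gamma_integrand x) (at_right 0) (Rbar_locally p_infty) l -> Gamma x = l.
Proof. intros H. apply is_RInt_gen_unique; exact H. Qed.

Lemma Gamma_pos (x : R) : 0 < x -> 0 < Gamma x.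
Proof.
  intros Hx. destruct (is_RInt_gen_gamma x Hx) as [l [H P]].
  rewrite (Gamma_unique x l H); exact P.
Qed.

Lemma filter_prod_pos :
  filter_prod (at_right 0) (Rbar_locally p_infty)
    (fun ab : R * R => 0 < Rmin (fst ab) (snd ab)).
Proof.
  apply (Filter_prod _ _ _ (fun a => 0 < a) (fun b => 0 < b)).
  - exists (mkposreal 1 Rlt_0_1); auto.
  - exists 0; auto.
  - intros a b Ha Hb. apply Rmin_pos; assumption.
Qed.

(** Integration by parts: [g] is a primitive of the difference of the two integrands and tends to 0
    at both ends. *)
Lemma Gamma_succ (x : R) : 0 < x -> Gamma (x + 1) = x * Gamma x.
Proof.
  intros Hx. destruct (is_RInt_gen_gamma x Hx) as [l [H _]].
  rewrite (Gamma_unique x l H). apply Gamma_unique.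
  set (g := fun t => - (Rpower t x * exp (- t))).
  assert (Hg : forall t, 0 < t ->
    is_derive g t (gamma_integrand (x + 1) t - x * gamma_integrand x t)).
  { intros t Ht. unfold gamma_integrand, g.
    replace (x + 1 - 1) with x by ring.
    assert (E : - ((x * Rpower t (x - 1)) * exp (- t) + Rpower t x * (- exp (- t)))
      = Rpower t x * exp (- t) - x * (Rpower t (x - 1) * exp (- t))) by ring.
    rewrite <- E.
    apply (@is_derive_opp R_AbsRing R_NormedModule).
    apply (is_derive_mult (fun t => Rpower t x) (fun t => exp (- t)));
      [apply is_derive_Rpower, Ht| |intros; apply Rmult_comm].
    auto_derive; [exact I|ring]. }
  assert (HD : is_RInt_gen (Derive g) (at_right 0) (Rbar_locally p_infty) (0 - 0)).
  { apply is_RInt_gen_Derive.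
    - generalize filter_prod_pos. apply filter_imp. intros ab Hab t Ht.
      eexists; apply Hg; lra.
    - generalize filter_prod_pos. apply filter_imp. intros ab Hab t Ht.
      assert (Ht0 : 0 < t) by lra.
      apply (continuous_ext_loc _ (fun t => gamma_integrand (x + 1) t - x * gamma_integrand x t)).
      + exists (mkposreal t Ht0). intros s Hs. change (Rabs (s - t) < t) in Hs.
        apply Rabs_lt_between in Hs. symmetry; apply is_derive_unique, Hg; lra.
      + apply (@continuous_minus R_UniformSpace R_AbsRing R_NormedModule).
        * apply continuous_gamma_integrand, Ht0.
        * apply (@continuous_scal_r R_UniformSpace R_AbsRing R_NormedModule x).
          apply continuous_gamma_integrand, Ht0.
    - assert (HR : filterlim (fun t => Rpower t x) (at_right 0) (locally 0)).
      { unfold Rpower. apply (filterlim_comp _ _ _ (fun t => x * ln t) exp _ (Rbar_locally m_infty)).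
        - apply (filterlim_comp _ _ _ ln (Rmult x) _ (Rbar_locally m_infty)); [apply is_lim_ln_0|].
          assert (K := filterlim_Rbar_mult_l x m_infty).
          simpl in K. destruct (Rle_dec 0 x) as [r|r]; [|lra].
          destruct (Rle_lt_or_eq_dec 0 x r) as [r0|r0]; [exact K|lra].
        - apply is_lim_exp_m. }
      intros P [eps HP]. specialize (HR (ball 0 eps) (locally_ball _ _)).
      unfold filtermap in *. destruct HR as [d Hd]. exists d. intros t Ht Ht0.
      apply HP. specialize (Hd t Ht Ht0).
      change (Rabs (Rpower t x - 0) < eps) in Hd. change (Rabs (g t - 0) < eps).
      rewrite Rminus_0_r in *. unfold g. rewrite Rabs_Ropp, Rabs_mult.
      rewrite (Rabs_pos_eq (exp (- t))) by (left; apply exp_pos).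
      assert (exp (- t) <= 1) by (apply exp_le_1; lra).
      generalize (Rabs_pos (Rpower t x)) (exp_pos (- t)). nra.
    - destruct (gamma_integrand_decay x) as [K [HK Hdec]].
      intros P [eps HP].
      exists (Rmax 1 (2 * (K / eps))). intros t Ht. apply HP.
      assert (Ht1 := Rle_lt_trans _ _ _ (Rmax_l _ _) Ht).
      assert (Ht2 := Rle_lt_trans _ _ _ (Rmax_r _ _) Ht).
      change (Rabs (g t - 0) < eps). rewrite Rminus_0_r. unfold g. rewrite Rabs_Ropp.
      rewrite Rabs_pos_eq by (left; apply Rmult_lt_0_compat; apply exp_pos).
      eapply Rle_lt_trans; [apply Hdec; lra|].
      assert (He : t / 2 < exp (t / 2)) by (generalize (exp_ineq1_le (t / 2)); lra).
      assert (Hm : exp (t / 2) * exp (- (t / 2)) = 1).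
      { rewrite <- exp_plus, Rplus_opp_r; apply exp_0. }
      assert (Heps := cond_pos eps).
      assert (HKe : K < eps * exp (t / 2)).
      { replace K with (eps * (K / eps)) by (field; lra).
        apply Rmult_lt_compat_l; lra. }
      generalize (exp_pos (- (t / 2))). nra. }
  replace (x * l) with ((0 - 0) + x * l) by ring.
  apply (is_RInt_gen_ext (fun t => plus (Derive g t) (scal x (gamma_integrand x t)))).
  - generalize filter_prod_pos. apply filter_imp. intros ab Hab t Ht.
    rewrite (is_derive_unique _ _ _ (Hg t ltac:(lra))).
    change plus with Rplus. change scal with Rmult. match goal with |- ?a = ?b => change (@eq R a b) end. ring.
  - apply (is_RInt_gen_plus (Derive g) (fun t => scal x (gamma_integrand x t))); [exact HD|].
    apply (is_RInt_gen_scal (gamma_integrand x) x l), H.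
Qed.

(** * Bessel values at 1 and monotonicity *)
Lemma bessel_coef_c (nu : R) (n : nat) :
  -1 < nu -> Gamma (nu + 1) * bessel_coef nu n = 4 ^ n * bessel_c nu n.
Proof.
  intros Hnu.
  assert (E : forall m, Gamma (nu + 1) * bessel_coef nu m = 4 ^ m * bessel_c nu m /\
    0 < Gamma (INR m + nu + 1)).
  { intros m. split; [|apply Gamma_pos; generalize (pos_INR m); lra].
    induction m as [|m IH].
    - unfold bessel_coef. simpl. rewrite Rplus_0_l.
      assert (H := Gamma_pos (nu + 1) ltac:(lra)). field; lra.
    - assert (Hm := pos_INR m).
      assert (G1 := Gamma_pos (INR m + nu + 1) ltac:(lra)).
      assert (F1 := INR_fact_neq_0 m).
      change (bessel_c nu (S m)) with (- bessel_c nu m / (4 * INR (S m) * (INR (S m) + nu))).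
      unfold bessel_coef in *.
      replace (INR (S m) + nu + 1) with (INR m + nu + 1 + 1) by (rewrite S_INR; ring).
      rewrite (Gamma_succ (INR m + nu + 1)) by lra. rewrite fact_simpl, mult_INR, !S_INR.
      transitivity (- 1 * (4 ^ m * bessel_c nu m) / ((INR m + 1) * (INR m + nu + 1))).
      + rewrite <- IH. simpl ((-1) ^ S m). field. repeat split; try lra; try exact F1.
      + simpl (4 ^ S m). field. split; lra. }
  apply E.
Qed.

Lemma bessel_normalized_cps (nu : R) (z : C) :
  -1 < nu -> bessel_normalized nu z = cps (bessel_c nu) (z * z)%C.
Proof.
  intros Hnu. unfold bessel_normalized, cps. apply CSeries_ext; intros n.
  rewrite bessel_coef_c by exact Hnu.
  rewrite Cpow_mult_r.
  replace (z * z)%C with (RtoC 4 * (z / RtoC 2) ^ 2)%C.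
  - rewrite Cpow_mult_l, RtoC_mult, RtoC_pow. ring.
  - replace (RtoC 4) with (RtoC 2 * RtoC 2)%C by (rewrite <- RtoC_mult; f_equal; lra).
    simpl (_ ^ 2)%C. field.
Qed.

Lemma besselJ_PSeries (nu x : R) :
  -1 < nu -> 0 < x ->
  besselJ nu x = / Gamma (nu + 1) * Rpower (x / 2) nu * PSeries (bessel_c nu) (x ^ 2).
Proof.
  intros Hnu Hx. assert (G1 := Gamma_pos (nu + 1) ltac:(lra)).
  unfold besselJ, PSeries. rewrite <- Series_scal_l. apply Series_ext; intros n.
  rewrite Rpower_plus.
  replace (2 * INR n) with (INR (2 * n)) by (rewrite mult_INR; reflexivity).
  rewrite Rpower_pow by lra. rewrite pow_mult.
  replace ((x / 2) ^ 2) with (x ^ 2 * / 4) by field. rewrite Rpow_mult_distr, pow_inv.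
  replace (bessel_coef nu n) with (/ Gamma (nu + 1) * (Gamma (nu + 1) * bessel_coef nu n))
    by (field; lra).
  rewrite bessel_coef_c by exact Hnu. field. split; [lra|apply pow_nonzero; lra].
Qed.

Definition bessel_scale (nu : R) : R := / Gamma (nu + 1) * Rpower (1 / 2) nu.

Lemma bessel_scale_pos (nu : R) : -1 < nu -> 0 < bessel_scale nu.
Proof.
  intros Hnu. apply Rmult_lt_0_compat; [|apply exp_pos].
  apply Rinv_0_lt_compat, Gamma_pos; lra.
Qed.

Lemma besselJ_1 (nu : R) :
  -1 < nu -> besselJ nu 1 = bessel_scale nu * PSeries (bessel_c nu) 1.
Proof.
  intros Hnu. rewrite besselJ_PSeries by lra. rewrite pow1. reflexivity.
Qed.

Lemma Derive_besselJ_1 (nu : R) :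
  -1 < nu ->
  Derive (besselJ nu) 1 = bessel_scale nu *
    (nu * PSeries (bessel_c nu) 1 + 2 * PSeries (PS_derive (bessel_c nu)) 1).
Proof.
  intros Hnu.
  assert (Hc : Rbar_lt (Rabs 1) (CV_radius (bessel_c nu)))
    by (apply bessel_c_radius; [exact Hnu|rewrite Rabs_R1; lra]).
  apply is_derive_unique.
  apply (is_derive_ext_loc (fun x => (/ Gamma (nu + 1) * Rpower (x / 2) nu) * PSeries (bessel_c nu) (x ^ 2))).
  { exists (mkposreal 1 Rlt_0_1). intros y Hy. change (Rabs (y - 1) < 1) in Hy.
    apply Rabs_lt_between in Hy. symmetry; apply besselJ_PSeries; lra. }
  assert (E : (/ Gamma (nu + 1) * ((1 * / 2) * (nu * Rpower (1 / 2) (nu - 1)))) * PSeries (bessel_c nu) (1 ^ 2)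
      + (/ Gamma (nu + 1) * Rpower (1 / 2) nu) * ((INR 2 * 1 * 1 ^ Nat.pred 2) * PSeries (PS_derive (bessel_c nu)) (1 ^ 2))
    = bessel_scale nu *
    (nu * PSeries (bessel_c nu) 1 + 2 * PSeries (PS_derive (bessel_c nu)) 1)).
  { unfold bessel_scale. rewrite !pow1.
    replace (Rpower (1 / 2) nu) with (Rpower (1 / 2) (nu - 1) * (1 / 2)).
    - simpl (INR 2). field. assert (G1 := Gamma_pos (nu + 1) ltac:(lra)); lra.
    - rewrite <- (Rpower_1 (1 / 2)) at 2 by lra. rewrite <- Rpower_plus. f_equal; ring. }
  rewrite <- E.
  apply (is_derive_mult (fun x => / Gamma (nu + 1) * Rpower (x / 2) nu)
    (fun x => PSeries (bessel_c nu) (x ^ 2))); [| |intros; apply Rmult_comm].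
  - apply (is_derive_scal (fun x => Rpower (x / 2) nu)).
    apply (is_derive_comp (fun u => Rpower u nu) (fun x => x / 2)).
    + apply is_derive_Reals, derivable_pt_lim_power; lra.
    + auto_derive; [exact I|reflexivity].
  - apply (is_derive_comp (PSeries (bessel_c nu)) (fun x => x ^ 2)).
    + apply is_derive_PSeries. rewrite pow1; exact Hc.
    + apply (is_derive_pow (fun x => x) 2 1 1). apply (@is_derive_id R_AbsRing).
Qed.

Lemma bessel_log_derivative_R (nu x : R) :
  0 < nu -> Rabs x < 4 ->
  2 * PSeries (PS_derive (bessel_c nu)) x = - (PSeries (riccati nu) x * PSeries (bessel_c nu) x).
Proof.
  intros Hnu Hx. apply RtoC_inj.
  rewrite RtoC_opp, !RtoC_mult, <- !cps_RtoC.
  apply bessel_log_derivative; [exact Hnu|rewrite Cmod_R; exact Hx].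
Qed.

(** On the real axis the logarithm series takes real values, so phi is the exponential of a real
    number. *)
Lemma bessel_pos_R (nu x : R) : 0 < nu -> Rabs x < 4 -> 0 < PSeries (bessel_c nu) x.
Proof.
  intros Hnu Hx.
  assert (E := bessel_exp_log nu (RtoC x) Hnu ltac:(rewrite Cmod_R; exact Hx)).
  rewrite !cps_RtoC in E. apply (f_equal Re) in E.
  unfold Cexp in E. simpl in E. rewrite cos_0, Rmult_1_r in E. rewrite <- E. apply exp_pos.
Qed.

(* nu - z J_nu'(z)/J_nu(z) at z^2 = x, and its z-derivative times z. *)
Definition bessel_P (nu x : R) : R := x * PSeries (riccati nu) x.
Definition bessel_DP (nu x : R) : R := 2 * x * PSeries (PS_derive (PS_incr_1 (riccati nu))) x.

Lemma riccati_equation_R (nu x : R) :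
  0 < nu -> Rabs x < 4 -> bessel_DP nu x + 2 * nu * bessel_P nu x = x + bessel_P nu x ^ 2.
Proof.
  intros Hnu Hx.
  assert (E := riccati_equation nu (RtoC x) Hnu ltac:(rewrite Cmod_R; exact Hx)).
  rewrite !cps_RtoC, <- !RtoC_mult, <- !RtoC_plus in E. apply RtoC_inj in E.
  unfold bessel_DP, bessel_P. set (b := PSeries (riccati nu) x) in *.
  set (d := PSeries (PS_derive _) x) in *.
  replace (2 * x * d + 2 * nu * (x * b)) with (x * (2 * d + 2 * nu * b)) by ring.
  rewrite E; ring.
Qed.

(** Strictness is asked at index 0 only, because there the Riccati coefficient is explicit in nu. *)
Lemma Series_lt (u v : nat -> R) :
  (forall n, 0 <= u n <= v n) -> u O < v O -> ex_series v -> Series u < Series v.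
Proof.
  intros H H0 Hv.
  assert (Hu : ex_series u).
  { apply (ex_series_dom u v); [|exact Hv]. intros n; rewrite Rabs_pos_eq; apply H. }
  rewrite (Series_incr_1 u Hu), (Series_incr_1 v Hv).
  apply Rplus_lt_le_compat; [exact H0|].
  apply Series_le; [intros n; apply H|]. apply (ex_series_incr_1 v); exact Hv.
Qed.

Lemma PSeries_term_mono (a b : nat -> R) (x y : R) (n : nat) :
  (forall n, 0 <= a n <= b n) -> 0 <= x -> x <= y -> 0 <= a n * x ^ n <= b n * y ^ n.
Proof.
  intros H Hx Hxy. assert (0 <= x ^ n) by (apply pow_le, Hx).
  assert (x ^ n <= y ^ n) by (apply pow_incr; lra).
  destruct (H n). split; [apply Rmult_le_pos|apply Rmult_le_compat]; assumption.
Qed.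

Lemma ex_series_PSeries (a : nat -> R) (x : R) :
  0 <= x -> Rbar_lt x (CV_radius a) -> ex_series (fun n => a n * x ^ n).
Proof.
  intros Hx H. apply ex_series_Rabs, CV_disk_inside. rewrite Rabs_pos_eq; assumption.
Qed.

Lemma PSeries_le (a b : nat -> R) (x y : R) :
  (forall n, 0 <= a n <= b n) -> 0 <= x -> x <= y -> Rbar_lt y (CV_radius b) ->
  PSeries a x <= PSeries b y.
Proof.
  intros H Hx Hxy Hy. apply Series_le.
  - intros n; apply PSeries_term_mono; assumption.
  - apply ex_series_PSeries; [lra|exact Hy].
Qed.

Lemma PSeries_lt_coef (a b : nat -> R) (x : R) :
  (forall n, 0 <= a n <= b n) -> a O < b O -> 0 <= x -> Rbar_lt x (CV_radius b) ->
  PSeries a x < PSeries b x.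
Proof.
  intros H H0 Hx Hr. apply Series_lt.
  - intros n; apply PSeries_term_mono; [assumption|assumption|lra].
  - simpl; lra.
  - apply ex_series_PSeries; assumption.
Qed.

Lemma PSeries_pos (a : nat -> R) (x : R) :
  (forall n, 0 <= a n) -> 0 < a O -> 0 <= x -> Rbar_lt x (CV_radius a) -> 0 < PSeries a x.
Proof.
  intros H H0 Hx Hr. apply Rle_lt_trans with (PSeries (fun _ => 0) x).
  - right. symmetry. etransitivity; [|exact Series_zero]. apply Series_ext; intros; ring.
  - apply PSeries_lt_coef; auto. intros n; split; [lra|apply H].
Qed.

Lemma riccati_0_pos (nu : R) : -1 < nu -> 0 < riccati nu 0.
Proof. intros; rewrite riccati_0; apply Rinv_0_lt_compat; lra. Qed.

Lemma riccati_0_lt (mu nu : R) : -1 < mu -> mu < nu -> riccati nu 0 < riccati mu 0.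
Proof. intros; rewrite !riccati_0; apply Rinv_lt_contravar; nra. Qed.

Lemma PS_derive_incr_coef (a : nat -> R) (n : nat) :
  PS_derive (PS_incr_1 a) n = INR (S n) * a n.
Proof. reflexivity. Qed.

Lemma PS_derive_incr_radius (nu r : R) :
  0 <= nu -> r < 4 -> Rbar_lt r (CV_radius (PS_derive (PS_incr_1 (riccati nu)))).
Proof.
  intros; rewrite CV_radius_derive, CV_radius_incr_1. apply riccati_radius; assumption.
Qed.

Lemma PS_derive_incr_nonneg (nu : R) (n : nat) :
  -1 < nu -> 0 <= PS_derive (PS_incr_1 (riccati nu)) n.
Proof.
  intros. rewrite PS_derive_incr_coef. apply Rmult_le_pos; [apply pos_INR|apply riccati_pos; lra].
Qed.

Lemma riccati_sum_pos (nu x : R) : 0 <= nu -> 0 <= x < 4 -> 0 < PSeries (riccati nu) x.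
Proof.
  intros Hnu Hx. apply PSeries_pos; [intros; apply riccati_pos; lra|apply riccati_0_pos; lra|lra|].
  apply riccati_radius; lra.
Qed.

Lemma riccati_derive_sum_pos (nu x : R) :
  0 <= nu -> 0 <= x < 4 -> 0 < PSeries (PS_derive (PS_incr_1 (riccati nu))) x.
Proof.
  intros Hnu Hx. apply PSeries_pos; [intros; apply PS_derive_incr_nonneg; lra| |lra|].
  - rewrite PS_derive_incr_coef. simpl INR. rewrite Rmult_1_l. apply riccati_0_pos; lra.
  - apply PS_derive_incr_radius; lra.
Qed.

Lemma bessel_P_lt (nu x y : R) : 0 <= nu -> 0 <= x -> x < y -> y < 4 -> bessel_P nu x < bessel_P nu y.
Proof.
  intros Hnu Hx Hxy Hy. unfold bessel_P.
  assert (PSeries (riccati nu) x <= PSeries (riccati nu) y).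
  { apply PSeries_le; [intros n; split; [apply riccati_pos|]; lra|lra|lra|].
    apply riccati_radius; lra. }
  assert (0 < PSeries (riccati nu) x) by (apply riccati_sum_pos; lra). nra.
Qed.

Lemma bessel_DP_lt (nu x y : R) : 0 <= nu -> 0 <= x -> x < y -> y < 4 -> bessel_DP nu x < bessel_DP nu y.
Proof.
  intros Hnu Hx Hxy Hy. unfold bessel_DP.
  assert (PSeries (PS_derive (PS_incr_1 (riccati nu))) x
       <= PSeries (PS_derive (PS_incr_1 (riccati nu))) y).
  { apply PSeries_le; [intros n; split; [apply PS_derive_incr_nonneg; lra|lra]|lra|lra|].
    apply PS_derive_incr_radius; lra. }
  assert (0 < PSeries (PS_derive (PS_incr_1 (riccati nu))) x)
    by (apply riccati_derive_sum_pos; lra). nra.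
Qed.

Lemma bessel_P_0 (nu : R) : bessel_P nu 0 = 0.
Proof. unfold bessel_P; ring. Qed.

Lemma bessel_P_nonneg (nu x : R) : 0 <= nu -> 0 <= x < 4 -> 0 <= bessel_P nu x.
Proof.
  intros Hnu Hx. unfold bessel_P. apply Rmult_le_pos; [lra|left; apply riccati_sum_pos; lra].
Qed.

Lemma bessel_DP_nonneg (nu x : R) : 0 <= nu -> 0 <= x < 4 -> 0 <= bessel_DP nu x.
Proof.
  intros Hnu Hx. unfold bessel_DP. apply Rmult_le_pos; [lra|left; apply riccati_derive_sum_pos; lra].
Qed.

Lemma bessel_P_decr_nu (mu nu x : R) : 0 <= mu -> mu < nu -> 0 < x < 4 -> bessel_P nu x < bessel_P mu x.
Proof.
  intros Hmu Hlt Hx. unfold bessel_P. apply Rmult_lt_compat_l; [lra|].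
  apply PSeries_lt_coef; [|apply riccati_0_lt; lra|lra|apply riccati_radius; lra].
  intros n; split; [apply riccati_pos|apply riccati_decr]; lra.
Qed.

Lemma bessel_DP_decr_nu (mu nu x : R) : 0 <= mu -> mu <= nu -> 0 <= x < 4 -> bessel_DP nu x <= bessel_DP mu x.
Proof.
  intros Hmu Hlt Hx. unfold bessel_DP. apply Rmult_le_compat_l; [lra|].
  apply PSeries_le; [|lra|lra|apply PS_derive_incr_radius; lra].
  intros n. rewrite !PS_derive_incr_coef. split.
  - apply Rmult_le_pos; [apply pos_INR|apply riccati_pos; lra].
  - apply Rmult_le_compat_l; [apply pos_INR|apply riccati_decr; lra].
Qed.

(** * Dependence on the order *)
Lemma ex_series_tail (M : nat -> R) (eps : R) :
  0 < eps -> ex_series M ->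
  exists N, Rabs (Series (fun k => M (S N + k)%nat)) < eps.
Proof.
  intros Heps HM. assert (HL := Series_correct M HM).
  destruct (proj1 (filterlim_locally _ _) HL (mkposreal eps Heps)) as [N HN].
  exists N. specialize (HN N (le_n N)).
  rewrite (Series_incr_n M (S N)) in HN by (lia || exact HM). simpl Nat.pred in HN.
  rewrite sum_n_Reals in HN.
  change (Rabs (sum_f_R0 M N - (sum_f_R0 M N + Series (fun k => M (S N + k)%nat))) < eps) in HN.
  rewrite <- Rabs_Ropp. eapply Rle_lt_trans; [right|exact HN]. f_equal; ring.
Qed.

Lemma continuity_pt_sum (f : nat -> R -> R) (x : R) (n : nat) :
  (forall k, (k <= n)%nat -> continuity_pt (f k) x) ->
  continuity_pt (fun y => sum_f_R0 (fun k => f k y) n) x.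
Proof.
  induction n as [|n IH]; intros H; simpl.
  - apply (H O); lia.
  - apply (continuity_pt_plus (fun y => sum_f_R0 (fun k => f k y) n) (f (S n))).
    + apply IH; intros k Hk; apply H; lia.
    + apply H; lia.
Qed.

Lemma continuity_pt_eps (f : R -> R) (x : R) :
  continuity_pt f x <->
  forall eps, 0 < eps -> exists d, 0 < d /\ forall y, Rabs (y - x) < d -> Rabs (f y - f x) < eps.
Proof.
  split; intros H eps Heps; destruct (H eps Heps) as [d [Hd Hy]]; exists d; split; auto.
  - intros y Hyx. destruct (Req_dec x y) as [->|Hne].
    + rewrite Rminus_diag, Rabs_R0; exact Heps.
    + apply Hy. split; [split; [exact I|exact Hne]|exact Hyx].
  - intros y [_ Hyx]. apply Hy; exact Hyx.
Qed.

(** The Weierstrass test with a majorant valid near x only. For the Riccati series the majorant 1/2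
    (1/4)^n is uniform in nu >= 0, which yields continuity in the order. *)
Lemma continuity_pt_Series (f : nat -> R -> R) (M : nat -> R) (x d : R) :
  0 < d -> (forall n y, Rabs (y - x) < d -> Rabs (f n y) <= M n) -> ex_series M ->
  (forall n, continuity_pt (f n) x) ->
  continuity_pt (fun y => Series (fun n => f n y)) x.
Proof.
  intros Hd HM Hex Hc. apply continuity_pt_eps. intros eps Heps.
  destruct (ex_series_tail M (eps / 3) ltac:(lra) Hex) as [N HN].
  destruct (proj1 (continuity_pt_eps _ _)
    (continuity_pt_sum f x N (fun k _ => Hc k)) (eps / 3) ltac:(lra)) as [d1 [Hd1 H1]].
  exists (Rmin d d1); split; [apply Rmin_pos; assumption|].
  intros y Hy.
  assert (Hyd := Rlt_le_trans _ _ _ Hy (Rmin_l _ _)).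
  assert (Hyd1 := Rlt_le_trans _ _ _ Hy (Rmin_r _ _)).
  assert (Hx : Rabs (x - x) < d) by (rewrite Rminus_diag, Rabs_R0; exact Hd).
  assert (T : forall z, Rabs (z - x) < d -> Series (fun n => f n z) =
     sum_f_R0 (fun n => f n z) N + Series (fun k => f (S N + k)%nat z) /\
     Rabs (Series (fun k => f (S N + k)%nat z)) < eps / 3).
  { intros z Hz. split.
    - apply (Series_incr_n (fun n => f n z) (S N)); [lia|].
      apply (ex_series_dom _ M); [intros n; apply HM, Hz|exact Hex].
    - eapply Rle_lt_trans; [|exact HN]. eapply Rle_trans; [|apply Rle_abs].
      apply Series_le_Rabs; [intros n; apply HM, Hz|].
      apply (ex_series_incr_n M (S N)); exact Hex. }
  destruct (T y Hyd) as [E1 B1]. destruct (T x Hx) as [E2 B2]. rewrite E1, E2.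
  specialize (H1 y Hyd1). cbv beta in H1.
  apply Rabs_lt_between in H1. apply Rabs_lt_between in B1. apply Rabs_lt_between in B2.
  apply Rabs_lt_between; lra.
Qed.

Lemma continuity_pt_riccati (nu : R) (n : nat) :
  -1 < nu -> continuity_pt (fun mu => riccati mu n) nu.
Proof.
  intros Hnu. induction n as [n IH] using Wf_nat.lt_wf_ind. destruct n as [|n].
  - apply derivable_continuous_pt, ex_derive_Reals_0.
    apply (ex_derive_ext (fun mu => / (2 * (1 + mu)))); [intros; symmetry; apply riccati_0|].
    auto_derive; lra.
  - apply (continuity_pt_ext (fun mu => PS_mult (riccati mu) (riccati mu) n * / (2 * (INR n + 2 + mu)))).
    { intros mu; rewrite riccati_S; reflexivity. }
    apply (continuity_pt_mult (fun mu => PS_mult (riccati mu) (riccati mu) n)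
      (fun mu => / (2 * (INR n + 2 + mu)))).
    + unfold PS_mult. apply (continuity_pt_sum (fun k mu => riccati mu k * riccati mu (n - k)%nat)).
      intros k Hk. apply (continuity_pt_mult (fun mu => riccati mu k) (fun mu => riccati mu (n - k)%nat));
        apply IH; lia.
    + apply derivable_continuous_pt, ex_derive_Reals_0. auto_derive.
      generalize (pos_INR n); lra.
Qed.

(* J_nu'(1)/J_nu(1) *)
Definition bessel_ratio (nu : R) : R := nu - bessel_P nu 1.

Lemma continuity_pt_bessel_ratio (nu : R) : 0 < nu -> continuity_pt bessel_ratio nu.
Proof.
  intros Hnu. apply (continuity_pt_minus (fun mu => mu) (fun mu => bessel_P mu 1)).
  - apply continuity_pt_id.
  - apply (continuity_pt_ext (fun mu => Series (fun n => riccati mu n))).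
    { intros mu. unfold bessel_P. rewrite PSeries_1, Rmult_1_l; reflexivity. }
    apply (continuity_pt_Series (fun n mu => riccati mu n) (fun n => 1 / 2 * (1 / 4) ^ n) nu nu Hnu).
    + intros n y Hy. apply Rabs_lt_between in Hy.
      rewrite Rabs_pos_eq by (apply riccati_pos; lra). apply riccati_quarter; lra.
    + apply (@ex_series_scal R_AbsRing R_NormedModule (1 / 2)), ex_series_geom.
      rewrite Rabs_pos_eq; lra.
    + intros n; apply continuity_pt_riccati; lra.
Qed.

Lemma bessel_ratio_lt (mu nu : R) : 0 <= mu -> mu < nu -> bessel_ratio mu < bessel_ratio nu.
Proof. intros H1 H2. unfold bessel_ratio. generalize (bessel_P_decr_nu mu nu 1 H1 H2). lra. Qed.

Lemma bessel_ratio_inj (mu nu : R) : 0 <= mu -> 0 <= nu -> bessel_ratio mu = bessel_ratio nu -> mu = nu.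
Proof.
  intros H1 H2 E. destruct (Rtotal_order mu nu) as [h|[h|h]]; [|exact h|].
  - generalize (bessel_ratio_lt mu nu H1 h); lra.
  - generalize (bessel_ratio_lt nu mu H2 h); lra.
Qed.

(* J_nu'(1) up to the positive factor [bessel_scale nu]. *)
Definition jprime (nu : R) : R :=
  nu * PSeries (bessel_c nu) 1 + 2 * PSeries (PS_derive (bessel_c nu)) 1.

Definition jprime_term (nu : R) (n : nat) : R := (nu + 2 * INR n) * bessel_c nu n.

Lemma jprime_ratio_eq (nu : R) : 0 < nu -> jprime nu = bessel_ratio nu * PSeries (bessel_c nu) 1.
Proof.
  intros Hnu. unfold jprime. rewrite bessel_log_derivative_R by (rewrite ?Rabs_R1; lra).
  unfold bessel_ratio, bessel_P. ring.
Qed.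

Lemma ex_series_jprime (nu : R) : -1 < nu -> ex_series (jprime_term nu).
Proof.
  intros Hnu.
  assert (H0 := ex_series_PSeries (bessel_c nu) 1 ltac:(lra) (bessel_c_radius nu 1 Hnu ltac:(lra))).
  assert (H1 := ex_series_PSeries (PS_derive (bessel_c nu)) 1 ltac:(lra)
    ltac:(rewrite CV_radius_derive; apply bessel_c_radius; lra)).
  apply ex_series_incr_1.
  apply (ex_series_ext (fun n => plus (scal nu (bessel_c nu (S n) * 1 ^ S n))
     (scal 2 (PS_derive (bessel_c nu) n * 1 ^ n)))).
  - intros n. change plus with Rplus. change scal with Rmult.
    unfold PS_derive, jprime_term. rewrite !pow1.
    match goal with |- ?a = ?b => change (@eq R a b) end. ring.
  - apply (@ex_series_plus R_AbsRing R_NormedModule);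
      apply (@ex_series_scal R_AbsRing R_NormedModule); [|exact H1].
    apply (ex_series_incr_1 (fun n => bessel_c nu n * 1 ^ n)); exact H0.
Qed.

Lemma jprime_Series (nu : R) : -1 < nu -> jprime nu = Series (jprime_term nu).
Proof.
  intros Hnu.
  assert (H0 := ex_series_PSeries (bessel_c nu) 1 ltac:(lra) (bessel_c_radius nu 1 Hnu ltac:(lra))).
  assert (H1 := ex_series_PSeries (PS_derive (bessel_c nu)) 1 ltac:(lra)
    ltac:(rewrite CV_radius_derive; apply bessel_c_radius; lra)).
  rewrite (Series_incr_1 _ (ex_series_jprime nu Hnu)).
  unfold jprime, PSeries. rewrite (Series_incr_1 _ H0).
  rewrite Rmult_plus_distr_l, Rplus_assoc. f_equal.
  - unfold jprime_term. simpl; ring.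
  - rewrite <- !Series_scal_l. rewrite <- Series_plus.
    + apply Series_ext; intros n. unfold jprime_term, PS_derive. rewrite !pow1; ring.
    + apply (@ex_series_scal R_AbsRing R_NormedModule nu).
      apply (ex_series_incr_1 (fun n => bessel_c nu n * 1 ^ n)); exact H0.
    + apply (@ex_series_scal R_AbsRing R_NormedModule 2); exact H1.
Qed.

(** With x = n + 1 >= 1 the numerator satisfies nu + 2(x + 1) <= 3 (nu + 2x) and the denominator 4
    (x + 1)(x + 1 + nu) is at least 8, uniformly in nu > -1. The index starts at 1 because the term
    of index 0 is nu itself, which may be arbitrarily small. *)
Lemma jprime_term_ratio (nu : R) (n : nat) :
  -1 < nu -> Rabs (jprime_term nu (S (S n))) <= 3 / 8 * Rabs (jprime_term nu (S n)).
Proof.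
  intros Hnu. unfold jprime_term.
  change (bessel_c nu (S (S n))) with
      (- bessel_c nu (S n) / (4 * INR (S (S n)) * (INR (S (S n)) + nu))).
  rewrite (S_INR (S n)). set (x := INR (S n)).
  assert (Hx : 1 <= x) by (unfold x; rewrite S_INR; generalize (pos_INR n); lra).
  assert (Hden : 0 < 4 * (x + 1) * (x + 1 + nu)) by nra.
  replace ((nu + 2 * (x + 1)) * (- bessel_c nu (S n) / (4 * (x + 1) * (x + 1 + nu))))
    with (- ((nu + 2 * (x + 1)) / (4 * (x + 1) * (x + 1 + nu))) * bessel_c nu (S n))
    by (field; split; lra).
  rewrite !Rabs_mult, Rabs_Ropp, <- Rmult_assoc.
  apply Rmult_le_compat_r; [apply Rabs_pos|].
  rewrite !Rabs_pos_eq; [|lra|].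
  2:{ left; apply Rdiv_lt_0_compat; lra. }
  apply (Rmult_le_reg_r (4 * (x + 1) * (x + 1 + nu))); [exact Hden|].
  unfold Rdiv at 1; rewrite Rmult_assoc, Rinv_l, Rmult_1_r by lra.
  assert (nu + 2 * (x + 1) <= 3 * (nu + 2 * x)) by lra.
  assert (8 <= 4 * (x + 1) * (x + 1 + nu)) by nra.
  nra.
Qed.

(** The constant 8/5 is the geometric sum 1 / (1 - 3/8). *)
Lemma jprime_tail (nu : R) (m : nat) :
  -1 < nu -> Rabs (Series (fun k => jprime_term nu (S m + k)%nat))
             <= 8 / 5 * Rabs (jprime_term nu (S m)).
Proof.
  intros Hnu.
  assert (Hg : is_series (fun k => (3 / 8) ^ k) (/ (1 - 3 / 8)))
    by (apply is_series_geom; rewrite Rabs_pos_eq; lra).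
  replace (8 / 5 * Rabs (jprime_term nu (S m)))
    with (Series (fun k => Rabs (jprime_term nu (S m)) * (3 / 8) ^ k)).
  2:{ rewrite Series_scal_l.
      transitivity (Rabs (jprime_term nu (S m)) * / (1 - 3 / 8)); [|field].
      f_equal. exact (is_series_unique _ _ Hg). }
  apply Series_le_Rabs.
  - intros k. induction k as [|k IH].
    + rewrite Nat.add_0_r. simpl; lra.
    + replace (S m + S k)%nat with (S (S (m + k))) by lia.
      eapply Rle_trans; [apply jprime_term_ratio, Hnu|].
      replace (S m + k)%nat with (S (m + k)) in IH by lia. simpl ((3 / 8) ^ S k). lra.
  - apply (@ex_series_scal R_AbsRing R_NormedModule (Rabs (jprime_term nu (S m)))).
    eexists; exact Hg.
Qed.

Lemma jprime_partial (nu : R) (m : nat) :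
  -1 < nu -> Rabs (jprime nu - sum_f_R0 (jprime_term nu) m)
             <= 8 / 5 * Rabs (jprime_term nu (S m)).
Proof.
  intros Hnu. rewrite jprime_Series by exact Hnu.
  rewrite (Series_incr_n (jprime_term nu) (S m)) by (lia || apply ex_series_jprime, Hnu).
  simpl Nat.pred. eapply Rle_trans; [|apply jprime_tail, Hnu].
  right; f_equal; ring.
Qed.

Lemma jprime_neg (nu : R) : -1 < nu < 0 -> jprime nu < 0.
Proof.
  intros Hnu. assert (H := jprime_partial nu 1 ltac:(lra)).
  assert (H2 := jprime_term_ratio nu 0 ltac:(lra)).
  assert (E : jprime_term nu 1 < 0).
  { unfold jprime_term. simpl.
    assert (0 < (nu + 2 * 1) * / (4 * 1 * (1 + nu))).
    { apply Rmult_lt_0_compat; [lra|apply Rinv_0_lt_compat; lra]. }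
    unfold Rdiv; lra. }
  rewrite (Rabs_left (jprime_term nu 1)) in H2 by exact E.
  simpl sum_f_R0 in H. unfold jprime_term at 1 in H. simpl INR in H. simpl bessel_c in H.
  apply Rabs_le_between in H. lra.
Qed.

(** The orders 0.39 and 0.3902 are the ends of the interval of radius 1/10000 about 0.3901. Five
    exact rational terms with the tail bound decide the sign at each of them. *)
Lemma jprime_39 : jprime (39 / 100) < 0.
Proof.
  set (nu := 39 / 100).
  assert (H := jprime_partial nu 4 ltac:(unfold nu; lra)).
  assert (E : forall n, bessel_c nu (S n) = - bessel_c nu n / (4 * INR (S n) * (INR (S n) + nu)))
    by reflexivity.
  assert (C1 : bessel_c nu 1 = - 25 / 139) by (rewrite E; change (bessel_c nu 0) with 1; unfold nu; simpl; field).
  assert (C2 : bessel_c nu 2 = 625 / 66442) by (rewrite E, C1; unfold nu; simpl; field).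
  assert (C3 : bessel_c nu 3 = - 15625 / 67571514) by (rewrite E, C2; unfold nu; simpl; field).
  assert (C4 : bessel_c nu 4 = 390625 / 118655578584) by (rewrite E, C3; unfold nu; simpl; field).
  assert (C5 : bessel_c nu 5 = - 1953125 / 63955356856776) by (rewrite E, C4; unfold nu; simpl; field).
  simpl sum_f_R0 in H. unfold jprime_term in H. rewrite C1, C2, C3, C4, C5 in H.
  change (bessel_c nu 0) with 1 in H. simpl INR in H. unfold nu in H at 2 3 4 5 6 7.
  rewrite (Rabs_left (_ * _)) in H by lra. apply Rabs_le_between in H. fold nu. lra.
Qed.

Lemma jprime_3902 : 0 < jprime (3902 / 10000).
Proof.
  set (nu := 3902 / 10000).
  assert (H := jprime_partial nu 4 ltac:(unfold nu; lra)).
  assert (E : forall n, bessel_c nu (S n) = - bessel_c nu n / (4 * INR (S n) * (INR (S n) + nu)))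
    by reflexivity.
  assert (C1 : bessel_c nu 1 = - 1250 / 6951) by (rewrite E; change (bessel_c nu 0) with 1; unfold nu; simpl; field).
  assert (C2 : bessel_c nu 2 = 781250 / 83071401) by (rewrite E, C1; unfold nu; simpl; field).
  assert (C3 : bessel_c nu 3 = - 976562500 / 4224429955053) by (rewrite E, C2; unfold nu; simpl; field).
  assert (C4 : bessel_c nu 4 = 305175781250 / 92730461943368403) by (rewrite E, C3; unfold nu; simpl; field).
  assert (C5 : bessel_c nu 5 = - 76293945312500 / 2499178679835721829253) by (rewrite E, C4; unfold nu; simpl; field).
  simpl sum_f_R0 in H. unfold jprime_term in H. rewrite C1, C2, C3, C4, C5 in H.
  change (bessel_c nu 0) with 1 in H. simpl INR in H. unfold nu in H at 2 3 4 5 6 7.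
  rewrite (Rabs_left (_ * _)) in H by lra. apply Rabs_le_between in H. fold nu. lra.
Qed.


(** * The boundary value G(nu) and its level sets *)

Definition boundary_quotient (nu : R) : R := 1 - bessel_P nu 1 / nu - bessel_DP nu 1 / bessel_ratio nu.

Lemma boundary_quotient_closed (nu : R) :
  0 < nu -> bessel_ratio nu <> 0 -> boundary_quotient nu = (1 - nu) * bessel_ratio nu / nu + (nu ^ 2 - 1) / bessel_ratio nu.
Proof.
  intros Hnu Hp. assert (E := riccati_equation_R nu 1 Hnu ltac:(rewrite Rabs_R1; lra)).
  unfold boundary_quotient. replace (bessel_DP nu 1) with (1 + bessel_P nu 1 ^ 2 - 2 * nu * bessel_P nu 1) by lra.
  replace (bessel_P nu 1) with (nu - bessel_ratio nu) by (unfold bessel_ratio; ring). field. lra.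
Qed.

Lemma bessel_ratio_bound (nu : R) : 0 < nu -> bessel_ratio nu < nu.
Proof. intros. unfold bessel_ratio. generalize (bessel_P_lt nu 0 1). rewrite bessel_P_0. intros K. specialize (K ltac:(lra) ltac:(lra) ltac:(lra) ltac:(lra)). lra. Qed.

Lemma boundary_quotient_lt (mu nu : R) : 0 < mu -> mu < nu -> 0 < bessel_ratio mu -> boundary_quotient mu < boundary_quotient nu.
Proof.
  intros Hmu Hlt Hp. assert (Hpr := bessel_ratio_lt mu nu ltac:(lra) Hlt).
  assert (HP := bessel_P_decr_nu mu nu 1 ltac:(lra) Hlt ltac:(lra)).
  assert (HD := bessel_DP_decr_nu mu nu 1 ltac:(lra) ltac:(lra) ltac:(lra)).
  assert (P0 := bessel_P_nonneg nu 1 ltac:(lra) ltac:(lra)).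
  assert (D0 := bessel_DP_nonneg nu 1 ltac:(lra) ltac:(lra)).
  unfold boundary_quotient.
  assert (bessel_P nu 1 / nu < bessel_P mu 1 / mu).
  { apply Rle_lt_trans with (bessel_P nu 1 / mu).
    - apply Rmult_le_compat_l; [exact P0|apply Rinv_le_contravar; lra].
    - apply Rmult_lt_compat_r; [apply Rinv_0_lt_compat; lra|exact HP]. }
  assert (bessel_DP nu 1 / bessel_ratio nu <= bessel_DP mu 1 / bessel_ratio mu).
  { apply Rmult_le_compat; [exact D0|left; apply Rinv_0_lt_compat; lra|exact HD|].
    apply Rinv_le_contravar; lra. }
  lra.
Qed.

(** Both terms of the closed form contain the factor nu - 1; this is where the threshold 1 for plain
    convexity comes from. *)
Lemma boundary_quotient_1 : bessel_ratio 1 <> 0 -> boundary_quotient 1 = 0.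
Proof. intros H. rewrite boundary_quotient_closed by (exact H || lra). field; exact H. Qed.

(** After multiplication by nu p the claim is (nu - 1) p <= (nu - 1)(nu (nu + 1) - p^2), which
    follows from p < nu. It shows that G exceeds every alpha < 1 eventually. *)
Lemma boundary_quotient_lower (nu : R) : 1 <= nu -> 0 < bessel_ratio nu -> 1 - / nu <= boundary_quotient nu.
Proof.
  intros Hnu Hp. rewrite boundary_quotient_closed by lra. assert (Hb := bessel_ratio_bound nu ltac:(lra)).
  apply (Rmult_le_reg_r (nu * bessel_ratio nu)); [nra|].
  replace ((1 - / nu) * (nu * bessel_ratio nu)) with ((nu - 1) * bessel_ratio nu) by (field; lra).
  replace (((1 - nu) * bessel_ratio nu / nu + (nu ^ 2 - 1) / bessel_ratio nu) * (nu * bessel_ratio nu))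
    with ((nu - 1) * (nu * (nu + 1) - bessel_ratio nu * bessel_ratio nu)) by (field; lra).
  apply Rmult_le_compat_l; nra.
Qed.

Lemma continuity_pt_boundary_quotient (nu : R) : 0 < nu -> 0 < bessel_ratio nu -> continuity_pt boundary_quotient nu.
Proof.
  intros Hnu Hp.
  destruct (proj1 (continuity_pt_eps _ _) (continuity_pt_bessel_ratio nu Hnu) (bessel_ratio nu) Hp) as [d [Hd Hy]].
  apply (continuity_pt_locally_ext (fun mu => (1 - mu) * bessel_ratio mu * / mu + (mu ^ 2 - 1) * / bessel_ratio mu)
     boundary_quotient (Rmin d nu) nu); [apply Rmin_pos; assumption| |].
  - intros y Hyd.
    assert (H1 := Rlt_le_trans _ _ _ Hyd (Rmin_l _ _)).
    assert (H2 := Rlt_le_trans _ _ _ Hyd (Rmin_r _ _)).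
    specialize (Hy y H1). apply Rabs_lt_between in Hy. apply Rabs_lt_between in H2.
    symmetry; apply boundary_quotient_closed; lra.
  - assert (Cp := continuity_pt_bessel_ratio nu Hnu).
    assert (Ci : continuity_pt (fun mu => mu) nu) by apply continuity_pt_id.
    apply (continuity_pt_plus (fun mu => (1 - mu) * bessel_ratio mu * / mu) (fun mu => (mu ^ 2 - 1) * / bessel_ratio mu)).
    + apply (continuity_pt_mult (fun mu => (1 - mu) * bessel_ratio mu) (fun mu => / mu)).
      * apply (continuity_pt_mult (fun mu => 1 - mu) bessel_ratio); [|exact Cp].
        apply (continuity_pt_minus (fun _ => 1) (fun mu => mu)); [|exact Ci].
        apply continuity_pt_const; intros u v; reflexivity.
      * apply (continuity_pt_inv (fun mu => mu)); [exact Ci|lra].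
    + apply (continuity_pt_mult (fun mu => mu ^ 2 - 1) (fun mu => / bessel_ratio mu)).
      * apply derivable_continuous_pt, ex_derive_Reals_0. auto_derive; exact I.
      * apply (continuity_pt_inv bessel_ratio); [exact Cp|lra].
Qed.

Lemma nustar_exists :
  exists nustar, 39 / 100 < nustar < 3902 / 10000 /\ bessel_ratio nustar = 0.
Proof.
  assert (H1 := jprime_39). assert (H2 := jprime_3902).
  rewrite jprime_ratio_eq in H1, H2 by lra.
  assert (Q1 := bessel_pos_R (39 / 100) 1 ltac:(lra) ltac:(rewrite Rabs_R1; lra)).
  assert (Q2 := bessel_pos_R (3902 / 10000) 1 ltac:(lra) ltac:(rewrite Rabs_R1; lra)).
  assert (N1 : bessel_ratio (39 / 100) < 0) by nra.
  assert (N2 : 0 < bessel_ratio (3902 / 10000)) by nra.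
  destruct (Ranalysis5.IVT_interv bessel_ratio (39 / 100) (3902 / 10000)) as [z [Hz Ez]].
  - intros a Ha. apply continuity_pt_bessel_ratio; lra.
  - lra.
  - exact N1.
  - exact N2.
  - exists z; split; [|exact Ez].
    split.
    + destruct (proj1 Hz) as [h|h]; [exact h|rewrite <- h in Ez; lra].
    + destruct (proj2 Hz) as [h|h]; [exact h|rewrite h in Ez; lra].
Qed.

Lemma bessel_ratio_1_pos : 0 < bessel_ratio 1.
Proof.
  destruct nustar_exists as [z [Hz Ez]]. rewrite <- Ez. apply bessel_ratio_lt; lra.
Qed.

Lemma boundary_quotient_root (alpha : R) :
  0 < alpha < 1 -> exists nu, 1 < nu /\ boundary_quotient nu = alpha.
Proof.
  (* Chosen so that 1 - 1/b > alpha; then G(b) > alpha by [boundary_quotient_lower], while G(1) =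
     0. *)
  intros Ha. set (b := / (1 - alpha) + 1).
  assert (Hb : 1 < / (1 - alpha)).
  { rewrite <- Rinv_1 at 1. apply Rinv_lt_contravar; lra. }
  assert (Hpr : forall nu, 1 <= nu -> 0 < bessel_ratio nu).
  { intros nu [Hnu| <-]; [|exact bessel_ratio_1_pos].
    generalize bessel_ratio_1_pos (bessel_ratio_lt 1 nu ltac:(lra) Hnu); lra. }
  destruct (Ranalysis5.IVT_interv (fun nu => boundary_quotient nu - alpha) 1 b) as [z [Hz Ez]].
  - intros a Haa. apply (continuity_pt_minus boundary_quotient (fun _ => alpha)).
    + apply continuity_pt_boundary_quotient; [lra|apply Hpr; lra].
    + apply continuity_pt_const; intros u v; reflexivity.
  - unfold b; lra.
  - rewrite boundary_quotient_1 by (generalize bessel_ratio_1_pos; lra). lra.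
  - assert (HG := boundary_quotient_lower b ltac:(unfold b; lra) ltac:(apply Hpr; unfold b; lra)).
    assert (/ b < 1 - alpha).
    { rewrite <- (Rinv_inv (1 - alpha)). apply Rinv_lt_contravar; unfold b; nra. }
    lra.
  - exists z; split; [|lra]. destruct (proj1 Hz) as [h| <-]; [exact h|].
    rewrite boundary_quotient_1 in Ez by (generalize bessel_ratio_1_pos; lra). lra.
Qed.

(** * The convexity quotient *)
Definition is_log_branch (nu : R) (L : C -> C) (y : C) : Prop :=
  Cdifferentiable L y /\ Cexp (L y) = cps (bessel_c nu) (y * y)%C.

Definition log_deriv (nu : R) (L : C -> C) (y : C) : C :=
  (RtoC 2 * y * cps (PS_derive (bessel_c nu)) (y * y) * Cexp (- L y))%C.

Lemma sqr_in_disk (y : C) : in_disk y -> Cmod (y * y) < 1.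
Proof.
  unfold in_disk. intros H. rewrite Cmod_mult. generalize (Cmod_ge_0 y). nra.
Qed.

Lemma cderiv_cps_sqr (a : nat -> R) (y : C) :
  Rbar_lt (Cmod (y * y)) (CV_radius a) ->
  cderiv (fun u => cps a (u * u)%C) y (RtoC 2 * y * cps (PS_derive a) (y * y))%C.
Proof.
  intros H. exact (cderiv_comp (cps a) (fun u => u * u)%C y _ _ (cderiv_cps a _ H) (cderiv_sqr y)).
Qed.

Lemma cderiv_log_branch (nu : R) (L : C -> C) (z y : C) (d : R) :
  -1 < nu ->
  (forall u, Cmod (u - z) < d -> in_disk u /\ is_log_branch nu L u) ->
  Cmod (y - z) < d -> cderiv L y (log_deriv nu L y).
Proof.
  intros Hnu Hb Hy. destruct (Hb y Hy) as [Hdisk [[l Hl] _]].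
  change (cderiv L y l) in Hl.
  replace (log_deriv nu L y) with l; [exact Hl|].
  unfold log_deriv.
  apply (Cexp_log_deriv L y l _ (d - Cmod (y - z)) (fun u => cps (bessel_c nu) (u * u)%C)).
  - lra.
  - intros u Hu. apply Hb. replace (u - z)%C with ((u - y) + (y - z))%C by ring.
    eapply Rle_lt_trans; [apply Cmod_triangle|]. lra.
  - exact Hl.
  - apply cderiv_cps_sqr, bessel_c_radius; [exact Hnu|].
    generalize (sqr_in_disk y Hdisk); lra.
Qed.

Definition f_deriv (nu : R) (L : C -> C) (y : C) : C :=
  (Cexp (/ RtoC nu * L y) * (1 + / RtoC nu * (y * log_deriv nu L y)))%C.

Lemma cderiv_Cexp_scal (k : C) (L : C -> C) (y l : C) :
  cderiv L y l -> cderiv (fun u => Cexp (k * L u)) y (k * l * Cexp (k * L y))%C.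
Proof.
  intros HL. exact (cderiv_comp Cexp (fun u => k * L u)%C y _ _ (cderiv_Cexp _) (cderiv_scal k L y l HL)).
Qed.

Lemma cderiv_f_nu (nu : R) (L : C -> C) (y : C) :
  cderiv L y (log_deriv nu L y) ->
  cderiv (fun u => u * Cexp (L u / RtoC nu))%C y (f_deriv nu L y).
Proof.
  intros HL.
  apply (cderiv_ext (fun u => u * Cexp (/ RtoC nu * L u))%C).
  { intros u. unfold Cdiv. rewrite Cmult_comm with (x := L u). reflexivity. }
  replace (f_deriv nu L y) with (1 * Cexp (/ RtoC nu * L y)
    + y * (/ RtoC nu * log_deriv nu L y * Cexp (/ RtoC nu * L y)))%C
    by (unfold f_deriv; ring).
  apply (cderiv_mult (fun u => u) (fun u => Cexp (/ RtoC nu * L u))).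
  - apply cderiv_id.
  - apply cderiv_Cexp_scal, HL.
Qed.

(* [m] is the value of z phi'/phi, with phi the normalized Bessel function. *)
Definition convexity_quotient (nu : R) (x m : C) : C :=
  let s := (1 + / RtoC nu * m)%C in
  (s + / RtoC nu * (- RtoC (2 * nu) * m - x - m * m) / s)%C.

(** With s = z f'/f = 1 + m/nu one has 1 + z f''/f' = s + z s'/s. The hypotheses are local, on a
    ball around z, so that the formula serves the whole disk when nu > 0 and points of the imaginary
    axis when nu < 0. The number m replaces a quotient by phi. *)
Lemma f_nu_second_order (nu : R) (f L : C -> C) (z : C) (d : R) (m : C) :
  -1 < nu -> nu <> 0 -> 0 < d ->
  (forall u, Cmod (u - z) < d -> in_disk u /\ is_log_branch nu L u /\
     f u = (u * Cexp (L u / RtoC nu))%C) ->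
  (RtoC 2 * (z * z) * cps (PS_derive (bessel_c nu)) (z * z)
   = m * cps (bessel_c nu) (z * z))%C ->
  (1 + / RtoC nu * m)%C <> 0 ->
  (1 + z * C_derive (C_derive f) z / C_derive f z)%C = convexity_quotient nu (z * z) m.
Proof.
  intros Hnu Hnu0 Hd Hb Hm Hs.
  assert (Hz0 : Cmod (z - z) < d) by (replace (z - z)%C with (RtoC 0) by ring; rewrite Cmod_0; exact Hd).
  assert (HL : forall y, Cmod (y - z) < d -> cderiv L y (log_deriv nu L y)).
  { intros y Hy. apply (cderiv_log_branch nu L z y d Hnu); [|exact Hy].
    intros u Hu. destruct (Hb u Hu) as [H1 [H2 _]]; auto. }
  assert (Hf : forall y, Cmod (y - z) < d -> C_derive f y = f_deriv nu L y).
  { intros y Hy. apply cderiv_C_derive.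
    apply (cderiv_ext_ball (fun u => u * Cexp (L u / RtoC nu))%C f y _ (d - Cmod (y - z))).
    - lra.
    - intros u Hu. symmetry. apply Hb. replace (u - z)%C with ((u - y) + (y - z))%C by ring.
      eapply Rle_lt_trans; [apply Cmod_triangle|]. lra.
    - apply cderiv_f_nu, HL, Hy. }
  set (phi := cps (bessel_c nu)) in *. set (phi1 := cps (PS_derive (bessel_c nu))) in *.
  set (phi2 := cps (PS_derive (PS_derive (bessel_c nu)))).
  destruct (Hb z Hz0) as [Hdisk [[_ HeL] _]].
  fold phi in HeL.
  assert (Hx := sqr_in_disk z Hdisk).
  assert (Lz := HL z Hz0).
  assert (Hld : cderiv (log_deriv nu L) z
    ((RtoC 2 * phi1 (z * z) + RtoC 2 * z * (RtoC 2 * z * phi2 (z * z))) * Cexp (- L z)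
     + RtoC 2 * z * phi1 (z * z) * (- log_deriv nu L z * Cexp (- L z)))%C).
  { unfold log_deriv at 1.
    apply (cderiv_mult (fun y => RtoC 2 * y * phi1 (y * y))%C (fun y => Cexp (- L y))).
    - apply (cderiv_mult (fun y => RtoC 2 * y)%C (fun y => phi1 (y * y)%C)).
      + assert (H2 := cderiv_scal (RtoC 2) (fun y => y) z 1 (cderiv_id z)).
        rewrite Cmult_1_r in H2. exact H2.
      + apply cderiv_cps_sqr. rewrite CV_radius_derive. apply bessel_c_radius; lra.
    - replace (- log_deriv nu L z * Cexp (- L z))%C
        with (- (1) * log_deriv nu L z * Cexp (- (1) * L z))%C
        by (replace (- (1) * L z)%C with (- L z)%C by ring; ring).
      apply (cderiv_ext (fun y => Cexp (- (1) * L y))).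
      + intros y. f_equal; ring.
      + apply cderiv_Cexp_scal, Lz. }
  set (ld := log_deriv nu L z) in *.
  set (ld1 := ((RtoC 2 * phi1 (z * z) + RtoC 2 * z * (RtoC 2 * z * phi2 (z * z))) * Cexp (- L z)
     + RtoC 2 * z * phi1 (z * z) * (- ld * Cexp (- L z)))%C) in *.
  set (k := (/ RtoC nu)%C) in *.
  assert (Hf2 : C_derive (C_derive f) z =
     (k * ld * Cexp (k * L z) * (1 + k * (z * ld))
      + Cexp (k * L z) * (0 + k * (1 * ld + z * ld1)))%C).
  { apply cderiv_C_derive.
    apply (cderiv_ext_ball (f_deriv nu L) _ z _ d Hd).
    { intros y Hy; symmetry; apply Hf, Hy. }
    apply (cderiv_mult (fun y => Cexp (k * L y)) (fun y => 1 + k * (y * log_deriv nu L y))%C).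
    - apply cderiv_Cexp_scal, Lz.
    - apply (cderiv_plus (fun _ => RtoC 1) (fun y => k * (y * log_deriv nu L y))%C); [apply cderiv_const|].
      apply (cderiv_scal k (fun y => y * log_deriv nu L y)%C).
      apply (cderiv_mult (fun y => y) (log_deriv nu L)); [apply cderiv_id|exact Hld]. }
  rewrite Hf2, (Hf z Hz0). unfold f_deriv. fold k. fold ld.
  assert (He := Cexp_neq_0 (k * L z)%C). set (e := Cexp (k * L z)) in *.
  assert (Hinv : (phi (z * z)%C * Cexp (- L z) = 1)%C) by (rewrite <- HeL; apply Cexp_opp_r).
  set (q := Cexp (- L z)) in *.
  assert (Hzl : (z * ld = m)%C).
  { unfold ld, log_deriv. fold phi1 q.
    transitivity ((RtoC 2 * (z * z) * phi1 (z * z)) * q)%C; [ring|].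
    rewrite Hm, <- Cmult_assoc, Hinv; ring. }
  (* The left side is z m'(z) for m = z L'. Bessel's equation removes phi'', and the factor [q],
     equal to 1/phi, cancels. *)
  assert (Hzl1 : (z * (1 * ld + z * ld1) = - RtoC (2 * nu) * m - z * z - m * m)%C).
  { assert (O := bessel_c_equation nu (z * z)%C Hnu ltac:(lra)). fold phi phi1 phi2 in O.
    assert (O' : (RtoC 4 * (z * z * phi2 (z * z)) = - phi (z * z) - RtoC 4 * RtoC (1 + nu) * phi1 (z * z))%C)
      by (rewrite <- O; ring).
    unfold ld1.
    replace (RtoC 4) with (RtoC 2 * RtoC 2)%C in O' by (rewrite <- RtoC_mult; f_equal; lra).
    transitivity (z * ld + ((RtoC 2 * (z * z) * phi1 (z * z))%C * q
        + z * z * ((RtoC 2 * RtoC 2 * (z * z * phi2 (z * z))) * q))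
        - (RtoC 2 * (z * z) * phi1 (z * z)) * q * (z * ld))%C; [ring|].
    rewrite O', Hzl.
    transitivity (m + (RtoC 2 * (z * z) * phi1 (z * z)) * q
       - z * z * (phi (z * z) * q) - RtoC 2 * RtoC (1 + nu) * ((RtoC 2 * (z * z) * phi1 (z * z)) * q)
       - (RtoC 2 * (z * z) * phi1 (z * z)) * q * m)%C; [ring|].
    rewrite Hm, <- (Cmult_assoc m), Hinv, RtoC_plus, RtoC_mult.
    replace (RtoC 2) with (1 + 1)%C by (rewrite <- RtoC_plus; f_equal; lra). ring. }
  unfold convexity_quotient. fold k. rewrite <- Hzl1, Hzl.
  set (s := (1 + k * m)%C) in *.
  replace (1 + z * (k * ld * e * s + e * (0 + k * (1 * ld + z * ld1))) / (e * s))%C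
    with (1 + k * (z * ld) + k * (z * (1 * ld + z * ld1)) / s)%C by (field; split; assumption).
  rewrite Hzl. reflexivity.
Qed.

Definition cbessel_P (nu : R) (x : C) : C := (x * cps (riccati nu) x)%C.
Definition cbessel_DP (nu : R) (x : C) : C :=
  (RtoC 2 * x * cps (PS_derive (PS_incr_1 (riccati nu))) x)%C.

Lemma cbessel_P_RtoC (nu x : R) : cbessel_P nu (RtoC x) = RtoC (bessel_P nu x).
Proof. unfold cbessel_P, bessel_P. rewrite cps_RtoC, RtoC_mult. reflexivity. Qed.

Lemma cbessel_DP_RtoC (nu x : R) : cbessel_DP nu (RtoC x) = RtoC (bessel_DP nu x).
Proof. unfold cbessel_DP, bessel_DP. rewrite cps_RtoC, !RtoC_mult. reflexivity. Qed.

Lemma Cmod_cbessel_P (nu : R) (x : C) : 0 <= nu -> Cmod x < 4 -> Cmod (cbessel_P nu x) <= bessel_P nu (Cmod x).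
Proof.
  intros Hnu Hx. unfold cbessel_P, bessel_P. rewrite Cmod_mult.
  apply Rmult_le_compat_l; [apply Cmod_ge_0|].
  apply Cmod_cps_le; [apply riccati_radius; assumption|intros; apply riccati_pos; lra].
Qed.

Lemma Cmod_cbessel_DP (nu : R) (x : C) : 0 <= nu -> Cmod x < 4 -> Cmod (cbessel_DP nu x) <= bessel_DP nu (Cmod x).
Proof.
  intros Hnu Hx. unfold cbessel_DP, bessel_DP. rewrite !Cmod_mult, Cmod_R, Rabs_pos_eq by lra.
  apply Rmult_le_compat_l; [generalize (Cmod_ge_0 x); lra|].
  apply Cmod_cps_le; [apply PS_derive_incr_radius; assumption|].
  intros; apply PS_derive_incr_nonneg; lra.
Qed.

Lemma cbessel_P_log (nu : R) (x : C) :
  0 < nu -> Cmod x < 4 ->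
  (RtoC 2 * x * cps (PS_derive (bessel_c nu)) x = - cbessel_P nu x * cps (bessel_c nu) x)%C.
Proof.
  intros Hnu Hx. unfold cbessel_P.
  replace (RtoC 2 * x * cps (PS_derive (bessel_c nu)) x)%C
    with (x * (RtoC 2 * cps (PS_derive (bessel_c nu)) x))%C by ring.
  rewrite bessel_log_derivative by assumption. ring.
Qed.

Lemma bessel_neq_0 (nu : R) (x : C) : 0 < nu -> Cmod x < 4 -> cps (bessel_c nu) x <> 0.
Proof. intros Hnu Hx. rewrite <- bessel_exp_log by assumption. apply Cexp_neq_0. Qed.

Lemma in_disk_scal (t : R) (z : C) : 0 <= t <= 1 -> in_disk z -> in_disk (RtoC t * z)%C.
Proof. intros Ht Hz. unfold in_disk in *. generalize (Cmod_scal_le t z Ht). lra. Qed.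

Lemma branch_domain_disk (nu : R) (z : C) : 0 < nu -> in_disk z -> branch_domain nu z.
Proof.
  intros Hnu Hz. split; [exact Hz|]. intros t Ht.
  rewrite bessel_normalized_cps by lra. apply bessel_neq_0; [exact Hnu|].
  generalize (sqr_in_disk _ (in_disk_scal t z Ht Hz)); lra.
Qed.

Lemma in_disk_ball (z u : C) : Cmod (u - z) < 1 - Cmod z -> in_disk u.
Proof.
  intros Hu. unfold in_disk. replace u with ((u - z) + z)%C by ring.
  eapply Rle_lt_trans; [apply Cmod_triangle|]. lra.
Qed.

Lemma convexity_quotient_bessel_P (nu : R) (x : C) :
  0 < nu -> Cmod x < 4 ->
  convexity_quotient nu x (- cbessel_P nu x)%C =
  (1 - / RtoC nu * cbessel_P nu x - / RtoC nu * cbessel_DP nu x / (1 - / RtoC nu * cbessel_P nu x))%C.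
Proof.
  intros Hnu Hx. assert (E := riccati_equation nu x Hnu Hx).
  assert (T : (- RtoC (2 * nu) * - cbessel_P nu x - x - - cbessel_P nu x * - cbessel_P nu x = - cbessel_DP nu x)%C).
  { unfold cbessel_P, cbessel_DP. set (b := cps (riccati nu) x) in *. set (d := cps (PS_derive _) x) in *.
    replace (RtoC 2 * x * d)%C with (x * (RtoC 2 * d + RtoC (2 * nu) * b) - x * RtoC (2 * nu) * b)%C by ring.
    rewrite E. ring. }
  unfold convexity_quotient. rewrite T.
  replace (1 + / RtoC nu * - cbessel_P nu x)%C with (1 - / RtoC nu * cbessel_P nu x)%C by ring.
  unfold Cdiv. ring.
Qed.

Lemma f_nu_quotient_disk (nu : R) (f : C -> C) (z : C) :
  0 < nu -> is_f_nu nu f -> in_disk z -> (1 - / RtoC nu * cbessel_P nu (z * z))%C <> 0 ->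
  (1 + z * C_derive (C_derive f) z / C_derive f z)%C =
  (1 - / RtoC nu * cbessel_P nu (z * z)
   - / RtoC nu * cbessel_DP nu (z * z) / (1 - / RtoC nu * cbessel_P nu (z * z)))%C.
Proof.
  intros Hnu [L [_ HL]] Hz Hs. assert (Hx := sqr_in_disk z Hz).
  rewrite <- convexity_quotient_bessel_P by lra.
  apply (f_nu_second_order nu f L z (1 - Cmod z)); [lra|lra|unfold in_disk in Hz; lra| | |].
  - intros u Hu. assert (Hu' := in_disk_ball z u Hu). split; [exact Hu'|].
    destruct (HL u (branch_domain_disk nu u Hnu Hu')) as [H1 [H2 H3]].
    rewrite bessel_normalized_cps in H2 by lra. repeat split; assumption.
  - apply cbessel_P_log; lra.
  - replace (1 + / RtoC nu * - cbessel_P nu (z * z))%C with (1 - / RtoC nu * cbessel_P nu (z * z))%C by ring.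
    exact Hs.
Qed.

(* 1 + z f''/f' at z = sqrt x *)
Definition radial_quotient (nu x : R) : R := 1 - bessel_P nu x / nu - bessel_DP nu x / (nu - bessel_P nu x).

(** Each subtracted term is bounded by its modulus, with |1 - p/nu| >= 1 - a/nu in the denominator.
    Here a and b will be the values of P and 2 x P' at |x|; these dominate on the circle because the
    coefficients are nonnegative, so the extremal point is the positive real one. *)
Lemma Re_quotient_lower (nu : R) (p q : C) (a b : R) :
  0 < nu -> Cmod p <= a -> Cmod q <= b -> a < nu ->
  (1 - / RtoC nu * p)%C <> 0 /\
  1 - a / nu - b / (nu - a) <=
  Re (1 - / RtoC nu * p - / RtoC nu * q / (1 - / RtoC nu * p))%C.
Proof.
  intros Hnu Hp Hq Ha. assert (Hp0 := Cmod_ge_0 p). assert (Hq0 := Cmod_ge_0 q).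
  assert (N : RtoC nu <> 0) by (intros K; apply RtoC_inj in K; lra).
  assert (Mk : forall w, Cmod (/ RtoC nu * w)%C = Cmod w / nu).
  { intros w. rewrite Cmod_mult, Cmod_inv by exact N. rewrite Cmod_R, Rabs_pos_eq by lra.
    unfold Rdiv; ring. }
  assert (Hlow : 1 - a / nu <= Cmod (1 - / RtoC nu * p)%C).
  { assert (T := Cmod_triangle (1 - / RtoC nu * p)%C (/ RtoC nu * p)%C).
    replace (1 - / RtoC nu * p + / RtoC nu * p)%C with (RtoC 1) in T by ring.
    rewrite Cmod_1, Mk in T.
    assert (Cmod p / nu <= a / nu) by (apply Rmult_le_compat_r; [left; apply Rinv_0_lt_compat; lra|lra]).
    lra. }
  assert (Hpos : 0 < 1 - a / nu).
  { replace (1 - a / nu) with ((nu - a) / nu) by (field; lra). apply Rdiv_lt_0_compat; lra. }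
  assert (Hs : (1 - / RtoC nu * p)%C <> 0) by (apply Cmod_gt_0; lra).
  split; [exact Hs|].
  set (s := (1 - / RtoC nu * p)%C) in *.
  assert (H1 : 1 - a / nu <= Re s).
  { unfold s. assert (R := re_le_Cmod (/ RtoC nu * p)%C). rewrite Mk in R.
    apply Rabs_le_between in R.
    assert (Cmod p / nu <= a / nu) by (apply Rmult_le_compat_r; [left; apply Rinv_0_lt_compat; lra|lra]).
    change (1 - a / nu <= 1 - Re (/ RtoC nu * p)%C). lra. }
  assert (H2 : Re (/ RtoC nu * q / s)%C <= b / (nu - a)).
  { eapply Rle_trans; [apply Rle_abs|]. eapply Rle_trans; [apply re_le_Cmod|].
    rewrite Cmod_div by exact Hs. rewrite Mk.
    replace (b / (nu - a)) with (b / nu / (1 - a / nu)) by (field; lra).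
    apply Rmult_le_compat.
    - apply Rmult_le_pos; [exact Hq0|left; apply Rinv_0_lt_compat; lra].
    - left; apply Rinv_0_lt_compat; lra.
    - apply Rmult_le_compat_r; [left; apply Rinv_0_lt_compat; lra|exact Hq].
    - apply Rinv_le_contravar; lra. }
  change (1 - a / nu - b / (nu - a) <= Re s - Re (/ RtoC nu * q / s)%C). lra.
Qed.

Lemma radial_quotient_gt_boundary (nu x : R) : 0 < nu -> 0 < bessel_ratio nu -> 0 <= x < 1 -> bessel_P nu x < nu /\ boundary_quotient nu < radial_quotient nu x.
Proof.
  intros Hnu Hp Hx. assert (H1 := bessel_P_lt nu x 1 ltac:(lra) ltac:(lra) ltac:(lra) ltac:(lra)).
  assert (H2 := bessel_DP_lt nu x 1 ltac:(lra) ltac:(lra) ltac:(lra) ltac:(lra)).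
  assert (H3 := bessel_DP_nonneg nu x ltac:(lra) ltac:(lra)).
  unfold bessel_ratio in Hp. split; [lra|]. unfold radial_quotient, boundary_quotient, bessel_ratio.
  assert (bessel_P nu x / nu < bessel_P nu 1 / nu) by (apply Rmult_lt_compat_r; [apply Rinv_0_lt_compat|]; lra).
  assert (bessel_DP nu x / (nu - bessel_P nu x) <= bessel_DP nu 1 / (nu - bessel_P nu 1)).
  { apply Rmult_le_compat; [lra|left; apply Rinv_0_lt_compat; lra|lra|].
    apply Rinv_le_contravar; lra. }
  lra.
Qed.

Lemma f_nu_Re_quotient (nu : R) (f : C -> C) (z : C) :
  0 < nu -> 0 < bessel_ratio nu -> is_f_nu nu f -> in_disk z ->
  boundary_quotient nu < Re (1 + z * C_derive (C_derive f) z / C_derive f z)%C.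
Proof.
  intros Hnu Hp Hf Hz. assert (Hx := sqr_in_disk z Hz).
  assert (Hx0 := Cmod_ge_0 (z * z)%C).
  destruct (radial_quotient_gt_boundary nu (Cmod (z * z)%C) Hnu Hp ltac:(lra)) as [H1 H2].
  destruct (Re_quotient_lower nu (cbessel_P nu (z * z)) (cbessel_DP nu (z * z)) (bessel_P nu (Cmod (z * z)%C))
    (bessel_DP nu (Cmod (z * z)%C)) Hnu) as [Hs Hle].
  - apply Cmod_cbessel_P; lra.
  - apply Cmod_cbessel_DP; lra.
  - exact H1.
  - rewrite (f_nu_quotient_disk nu f z Hnu Hf Hz Hs). unfold radial_quotient in H2. lra.
Qed.

Lemma f_nu_real_quotient (nu : R) (f : C -> C) (r : R) :
  0 < nu -> is_f_nu nu f -> 0 <= r < 1 -> bessel_P nu (r * r) < nu ->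
  Re (1 + RtoC r * C_derive (C_derive f) (RtoC r) / C_derive f (RtoC r))%C = radial_quotient nu (r * r).
Proof.
  intros Hnu Hf Hr HP.
  assert (N : RtoC nu <> 0) by (intros K; apply RtoC_inj in K; lra).
  assert (Hz : in_disk (RtoC r)) by (unfold in_disk; rewrite Cmod_R, Rabs_pos_eq; lra).
  assert (E : (1 - / RtoC nu * cbessel_P nu (RtoC r * RtoC r))%C = RtoC (1 - bessel_P nu (r * r) / nu)).
  { rewrite <- RtoC_mult, cbessel_P_RtoC. unfold Rdiv. rewrite RtoC_minus, RtoC_mult, RtoC_inv by lra. ring. }
  assert (Hpos : 0 < 1 - bessel_P nu (r * r) / nu).
  { replace (1 - bessel_P nu (r * r) / nu) with ((nu - bessel_P nu (r * r)) / nu) by (field; lra).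
    apply Rdiv_lt_0_compat; lra. }
  rewrite (f_nu_quotient_disk nu f (RtoC r) Hnu Hf Hz).
  - rewrite E, <- RtoC_mult, cbessel_DP_RtoC.
    rewrite <- RtoC_inv by lra. rewrite <- RtoC_mult, <- RtoC_div by lra.
    rewrite <- RtoC_minus. simpl. unfold radial_quotient. field. lra.
  - rewrite E. intros K; apply RtoC_inj in K; lra.
Qed.

(** * Explicit bounds and univalence for nu at least 1 *)

Lemma cps_decr (a : nat -> R) (z : C) :
  Rbar_lt (Cmod z) (CV_radius a) ->
  cps a z = (RtoC (a O) + z * cps (fun n => a (S n)) z)%C.
Proof.
  intros H. rewrite <- (cps_incr (fun n => a (S n))).
  - unfold cps. rewrite (CSeries_incr _ (cps_summable a z H)).
    assert (Hd : Rbar_lt (Cmod z) (CV_radius (PS_incr_1 (fun n => a (S n))))).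
    { rewrite CV_radius_incr_1. change (fun n => a (S n)) with (PS_decr_1 a).
      rewrite CV_radius_decr_1; exact H. }
    rewrite (CSeries_incr _ (cps_summable _ z Hd)). simpl PS_incr_1.
    change (zero : R) with 0. simpl (z ^ 0)%C. ring.
  - change (fun n => a (S n)) with (PS_decr_1 a). rewrite CV_radius_decr_1; exact H.
Qed.

Lemma Cmod_cps_geom (a : nat -> R) (A q : R) (z : C) :
  0 < q < 1 -> Cmod z <= 1 -> (forall n, Rabs (a n) <= A * q ^ n) ->
  Cmod (cps a z) <= A / (1 - q).
Proof.
  intros Hq Hz Ha.
  assert (Hr : Rbar_lt (Cmod z) (CV_radius a)).
  { apply (CV_radius_geom a A q); [lra| |exact Ha].
    apply Rle_lt_trans with (/ 1); [rewrite Rinv_1; exact Hz|apply Rinv_lt_contravar; lra]. }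
  assert (Hg : is_series (fun k => q ^ k) (/ (1 - q)))
    by (apply is_series_geom; rewrite Rabs_pos_eq; lra).
  eapply Rle_trans; [apply Cmod_CSeries, cps_summable, Hr|].
  eapply Rle_trans; [apply Rle_abs|].
  replace (A / (1 - q)) with (Series (fun k => A * q ^ k)).
  - apply Series_le_Rabs.
    + intros n. rewrite Rabs_pos_eq by apply Cmod_ge_0.
      rewrite Cmod_mult, Cmod_R, Cmod_pow.
      assert (0 <= Cmod z ^ n <= 1).
      { split; [apply pow_le, Cmod_ge_0|]. rewrite <- (pow1 n). apply pow_incr.
        split; [apply Cmod_ge_0|exact Hz]. }
      generalize (Ha n) (Rabs_pos (a n)). nra.
    + apply (@ex_series_scal R_AbsRing R_NormedModule A). eexists; exact Hg.
  - rewrite Series_scal_l. unfold Rdiv. f_equal. exact (is_series_unique _ _ Hg).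
Qed.

(** For nu >= 1 the first Rayleigh sum is at most 1/8. Summing over |x| <= 1 gives 2/7 = (1/4) / (1
    - 1/8) for P and half of that, 1/7, for the logarithm. *)
Lemma riccati_eighth (nu : R) (n : nat) : 1 <= nu -> riccati nu n <= 1 / 4 * (1 / 8) ^ n.
Proof.
  intros Hnu. replace (1 / 4 * (1 / 8) ^ n) with (2 * (1 / 8) ^ S n) by (simpl; field).
  apply riccati_bound; [lra|].
  unfold Rdiv; rewrite Rmult_1_l. apply Rinv_le_contravar; lra.
Qed.

Lemma Cmod_cbessel_P_small (nu : R) (x : C) : 1 <= nu -> Cmod x <= 1 -> Cmod (cbessel_P nu x) <= 2 / 7.
Proof.
  intros Hnu Hx. unfold cbessel_P. rewrite Cmod_mult.
  assert (H : Cmod (cps (riccati nu) x) <= 1 / 4 / (1 - 1 / 8)).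
  { apply Cmod_cps_geom; [lra|exact Hx|]. intros n.
    rewrite Rabs_pos_eq by (apply riccati_pos; lra). apply riccati_eighth, Hnu. }
  generalize (Cmod_ge_0 x) (Cmod_ge_0 (cps (riccati nu) x)). nra.
Qed.

Lemma Cmod_log_small (nu : R) (x : C) :
  1 <= nu -> Cmod x <= 1 -> Cmod (cps (log_coef nu) x) <= 1 / 7.
Proof.
  intros Hnu Hx. rewrite cps_decr by (apply log_coef_radius; lra).
  replace (log_coef nu 0) with 0.
  2:{ unfold log_coef, PS_scal, PS_Int. change scal with Rmult. ring. }
  rewrite Cplus_0_l, Cmod_mult.
  assert (H : Cmod (cps (fun n => log_coef nu (S n)) x) <= 1 / 8 / (1 - 1 / 8)).
  { apply Cmod_cps_geom; [lra|exact Hx|]. intros n.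
    unfold log_coef, PS_scal, PS_Int. change scal with Rmult.
    assert (Hn : 1 <= INR (S n)) by (rewrite S_INR; generalize (pos_INR n); lra).
    assert (Hr0 := riccati_pos nu n ltac:(lra)). assert (Hr := riccati_eighth nu n Hnu).
    replace (- / 2 * (riccati nu n / INR (S n))) with (- (/ 2 * (riccati nu n / INR (S n)))) by ring.
    assert (0 <= riccati nu n / INR (S n) <= riccati nu n).
    { split; [apply Rle_mult_inv_pos; lra|].
      apply (Rmult_le_reg_r (INR (S n))); [lra|].
      unfold Rdiv; rewrite Rmult_assoc, Rinv_l by lra. nra. }
    rewrite Rabs_Ropp, Rabs_pos_eq by lra. lra. }
  generalize (Cmod_ge_0 x) (Cmod_ge_0 (cps (fun n => log_coef nu (S n)) x)). nra.
Qed.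

(** The derivative f' is the exponential of a number of modulus at most 1/7 times 1 - u with |u| <=
    2/7. The total argument is therefore far below a right angle: cos b (1 - c) is at least 49/50
    times 5/7, against an error of at most 2/49. *)
Lemma Re_Cexp_mult_pos (w u : C) :
  Cmod w <= 1 / 7 -> Cmod u <= 2 / 7 -> 0 < Re (Cexp w * (1 - u))%C.
Proof.
  intros Hw Hu. assert (Hw2 := im_le_Cmod w).
  assert (Hu1 := re_le_Cmod u). assert (Hu2 := im_le_Cmod u).
  destruct w as [a b], u as [c d]. simpl in Hw2, Hu1, Hu2.
  assert (Hc := cos_quadratic_bound b). assert (Hs := Rabs_sin_le b).
  set (mw := Cmod (a, b)) in *. set (mu := Cmod (c, d)) in *.
  apply Rabs_le_between in Hu1. apply Rabs_le_between in Hu2.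
  assert (Hb1 : Rabs b <= 1 / 7) by lra.
  assert (Hs1 : Rabs (sin b) <= 1 / 7) by lra.
  apply Rabs_le_between in Hb1. apply Rabs_le_between in Hs1.
  unfold Cexp, Cmult, Cminus, Cplus, Copp, RtoC, Re, Im; simpl fst; simpl snd.
  replace (exp a * cos b * (1 + - c) - exp a * sin b * (0 + - d))
    with (exp a * (cos b * (1 - c) + sin b * d)) by ring.
  apply Rmult_lt_0_compat; [apply exp_pos|].
  assert (49 / 50 <= cos b) by nra.
  assert (- (2 / 49) <= sin b * d) by nra.
  nra.
Qed.

(** An explicit witness for [is_f_nu] when nu > 0: the logarithm series in z^2 converges on the
    whole disk. *)
Definition f_nu (nu : R) (z : C) : C :=
  (z * Cexp (cps (log_coef nu) (z * z) / RtoC nu))%C.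

Lemma log_branch_series (nu : R) (z : C) :
  0 < nu -> in_disk z -> is_log_branch nu (fun u => cps (log_coef nu) (u * u)%C) z.
Proof.
  intros Hnu Hz. assert (Hx := sqr_in_disk z Hz). split.
  - eexists. apply cderiv_cps_sqr, log_coef_radius; lra.
  - apply bessel_exp_log; lra.
Qed.

Lemma is_f_nu_f_nu (nu : R) : 0 < nu -> is_f_nu nu (f_nu nu).
Proof.
  intros Hnu. exists (fun u => cps (log_coef nu) (u * u)%C). split.
  - rewrite Cmult_0_l. apply log_coef_0.
  - intros z [Hz _]. destruct (log_branch_series nu z Hnu Hz) as [H1 H2].
    split; [exact H1|]. split; [|reflexivity].
    rewrite H2, bessel_normalized_cps by lra. reflexivity.
Qed.

Lemma cderiv_f_nu_disk (nu : R) (z : C) :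
  0 < nu -> in_disk z ->
  cderiv (f_nu nu) z (Cexp (/ RtoC nu * cps (log_coef nu) (z * z))
                      * (1 - / RtoC nu * cbessel_P nu (z * z)))%C.
Proof.
  intros Hnu Hz. set (L := fun u => cps (log_coef nu) (u * u)%C).
  assert (HL : cderiv L z (log_deriv nu L z)).
  { apply (cderiv_log_branch nu L z z (1 - Cmod z)); [lra| |].
    - intros u Hu. assert (Hu' := in_disk_ball z u Hu). split; [exact Hu'|].
      apply log_branch_series; assumption.
    - replace (z - z)%C with (RtoC 0) by ring. rewrite Cmod_0. unfold in_disk in Hz; lra. }
  assert (H := cderiv_f_nu nu L z HL).
  replace (Cexp (/ RtoC nu * cps (log_coef nu) (z * z)) * (1 - / RtoC nu * cbessel_P nu (z * z)))%C
    with (f_deriv nu L z); [exact H|].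
  unfold f_deriv. fold (L z). f_equal.
  assert (E : (z * log_deriv nu L z = - cbessel_P nu (z * z))%C).
  { assert (Hx := sqr_in_disk z Hz). unfold log_deriv.
    transitivity ((RtoC 2 * (z * z) * cps (PS_derive (bessel_c nu)) (z * z)) * Cexp (- L z))%C; [ring|].
    rewrite cbessel_P_log by lra. rewrite <- bessel_exp_log by lra. fold (L z).
    rewrite <- Cmult_assoc, Cexp_opp_r; ring. }
  rewrite E. ring.
Qed.

Lemma Re_f_nu_deriv_pos (nu : R) (z : C) :
  1 <= nu -> in_disk z ->
  0 < Re (Cexp (/ RtoC nu * cps (log_coef nu) (z * z))
                      * (1 - / RtoC nu * cbessel_P nu (z * z)))%C.
Proof.
  intros Hnu Hz. assert (Hx := sqr_in_disk z Hz).
  assert (N : RtoC nu <> 0) by (intros K; apply RtoC_inj in K; lra).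
  assert (Mk : forall w, Cmod (/ RtoC nu * w)%C <= Cmod w).
  { intros w. rewrite Cmod_mult, Cmod_inv by exact N. rewrite Cmod_R, Rabs_pos_eq by lra.
    assert (/ nu <= 1) by (rewrite <- Rinv_1; apply Rinv_le_contravar; lra).
    generalize (Cmod_ge_0 w). nra. }
  apply Re_Cexp_mult_pos; (eapply Rle_trans; [apply Mk|]).
  - apply Cmod_log_small; lra.
  - apply Cmod_cbessel_P_small; lra.
Qed.

(* Noshiro-Warschawski on the unit disk. *)
Lemma univalent_of_Re_deriv_pos (f f' : C -> C) :
  (forall z, in_disk z -> cderiv f z (f' z)) ->
  (forall z, in_disk z -> 0 < Re (f' z)) -> univalent_in_disk f.
Proof.
  intros Hd Hpos z w Hz Hw E. apply Classical_Prop.NNPP; intros Hne.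
  set (v := (z - w)%C).
  assert (Hv : v <> 0).
  { intros K. apply Hne. replace z with (v + w)%C by (unfold v; ring). rewrite K; ring. }
  assert (Hseg : forall t, 0 <= t <= 1 -> in_disk (w + RtoC t * v)%C).
  { intros t Ht. unfold in_disk in *.
    replace (w + RtoC t * v)%C with (RtoC (1 - t) * w + RtoC t * z)%C
      by (unfold v; rewrite RtoC_minus; ring).
    eapply Rle_lt_trans; [apply Cmod_triangle|].
    rewrite !Cmod_mult, !Cmod_R, !Rabs_pos_eq by lra.
    destruct (Req_dec t 0) as [->|Ht0]; [lra|]. nra. }
  (* The factor conj v turns the derivative along the segment into |v|^2 Re f', which is positive,
     whereas the end values agree. *)
  destruct (MVT_gen (fun t => Re (Cconj v * f (w + RtoC t * v))%C) 0 1
     (fun t => Re (Cconj v * (f' (w + RtoC t * v) * v))%C)) as [c [Hc Ec]].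
  - intros t Ht. rewrite Rmin_left, Rmax_right in Ht by lra.
    apply cderiv_line, Hd, Hseg; lra.
  - intros t Ht. rewrite Rmin_left, Rmax_right in Ht by lra.
    eapply is_derive_continuity, cderiv_line, Hd, Hseg; lra.
  - rewrite Rmin_left, Rmax_right in Hc by lra.
    assert (E1 : (w + 1 * v)%C = z) by (unfold v; ring).
    assert (E0 : (w + 0 * v)%C = w) by ring.
    rewrite E1, E0, E in Ec.
    replace (Cconj v * (f' (w + RtoC c * v) * v))%C
      with ((v * Cconj v) * f' (w + RtoC c * v))%C in Ec by ring.
    rewrite <- Cmod2_conj in Ec.
    assert (Hvp : 0 < Cmod v) by (apply Cmod_gt_0; exact Hv).
    assert (Hf := Hpos _ (Hseg c Hc)).
    assert (Er : forall (k : R) (y : C), Re (RtoC k * y)%C = k * Re y)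
      by (intros k [p q]; simpl; ring).
    rewrite Er in Ec. assert (0 < Cmod v ^ 2) by nra. nra.
Qed.

Lemma convex_sufficient (nu alpha : R) :
  1 <= nu -> alpha <= boundary_quotient nu -> f_nu_convex_of_order nu alpha.
Proof.
  intros Hnu HG. exists (f_nu nu). split; [apply is_f_nu_f_nu; lra|].
  assert (Hp : 0 < bessel_ratio nu).
  { destruct Hnu as [Hnu| <-]; [|exact bessel_ratio_1_pos].
    generalize bessel_ratio_1_pos (bessel_ratio_lt 1 nu ltac:(lra) Hnu); lra. }
  assert (Hd := fun z => cderiv_f_nu_disk nu z ltac:(lra)).
  repeat split.
  - unfold f_nu. apply Cmult_0_l.
  - rewrite (cderiv_C_derive _ _ _ (Hd 0 ltac:(unfold in_disk; rewrite Cmod_0; lra))).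
    rewrite Cmult_0_l, log_coef_0. unfold cbessel_P. rewrite Cmult_0_l, !Cmult_0_r, Cexp_0. ring.
  - intros z Hz. eexists. apply Hd, Hz.
  - apply (univalent_of_Re_deriv_pos _ _ Hd). intros z Hz. apply Re_f_nu_deriv_pos; assumption.
  - intros z Hz. eapply Rle_lt_trans; [exact HG|].
    apply f_nu_Re_quotient; [lra|exact Hp|apply is_f_nu_f_nu; lra|exact Hz].
Qed.

(** * Necessity *)
Lemma continuity_pt_bessel_P (nu x : R) : 0 <= nu -> Rabs x < 4 -> continuity_pt (bessel_P nu) x.
Proof.
  intros Hnu Hx. apply (continuity_pt_mult (fun y => y) (PSeries (riccati nu))).
  - apply continuity_pt_id.
  - apply PSeries_continuity, riccati_radius; assumption.
Qed.

Lemma continuity_pt_bessel_DP (nu x : R) : 0 <= nu -> Rabs x < 4 -> continuity_pt (bessel_DP nu) x.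
Proof.
  intros Hnu Hx.
  apply (continuity_pt_mult (fun y => 2 * y) (PSeries (PS_derive (PS_incr_1 (riccati nu))))).
  - apply (continuity_pt_mult (fun _ => 2) (fun y => y)).
    + apply continuity_pt_const; intros u v; reflexivity.
    + apply continuity_pt_id.
  - apply PSeries_continuity, PS_derive_incr_radius; assumption.
Qed.

(** The coefficients are 2 (n + 1) b_n against 2 b_n. This makes the radial quotient negative
    already where P = nu/2, so that no limit at the zero of f' has to be taken. *)
Lemma bessel_DP_ge_2P (nu x : R) : 0 <= nu -> 0 <= x < 4 -> 2 * bessel_P nu x <= bessel_DP nu x.
Proof.
  intros Hnu Hx. unfold bessel_P, bessel_DP. rewrite <- Rmult_assoc. apply Rmult_le_compat_l; [lra|].
  apply PSeries_le; [|lra|lra|apply PS_derive_incr_radius; lra].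
  intros n. rewrite PS_derive_incr_coef, S_INR.
  assert (H := riccati_pos nu n ltac:(lra)). assert (Hn := pos_INR n).
  split; [exact H|]. nra.
Qed.

Lemma convex_order_radial_quotient (nu alpha x : R) :
  0 < nu -> f_nu_convex_of_order nu alpha -> 0 <= x < 1 -> bessel_P nu x < nu -> alpha < radial_quotient nu x.
Proof.
  intros Hnu [f [Hf [_ [_ [_ [_ H]]]]]] Hx HP.
  assert (Hs : sqrt x * sqrt x = x) by (apply sqrt_sqrt; lra).
  assert (Hr : 0 <= sqrt x < 1).
  { split; [apply sqrt_pos|]. rewrite <- sqrt_1. apply sqrt_lt_1; lra. }
  rewrite <- Hs, <- (f_nu_real_quotient nu f (sqrt x) Hnu Hf Hr) by (rewrite Hs; exact HP).
  apply H. unfold in_disk. rewrite Cmod_R, Rabs_pos_eq; lra.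
Qed.

Lemma convex_bessel_ratio_pos (nu alpha : R) :
  0 < nu -> 0 <= alpha -> f_nu_convex_of_order nu alpha -> 0 < bessel_ratio nu.
Proof.
  intros Hnu Ha Hc. apply Rnot_le_lt; intros Hp. unfold bessel_ratio in Hp.
  (* At a point where [bessel_P = nu / 2] the quotient is at most [1 / 2 - 2]. *)
  destruct (Ranalysis5.IVT_interv (fun x => bessel_P nu x - nu / 2) 0 1) as [x [Hx Ex]].
  - intros a Haa. apply (continuity_pt_minus (bessel_P nu) (fun _ => nu / 2)).
    + apply continuity_pt_bessel_P; [lra|rewrite Rabs_pos_eq; lra].
    + apply continuity_pt_const; intros u v; reflexivity.
  - lra.
  - rewrite bessel_P_0; lra.
  - lra.
  - assert (Hx1 : x < 1).
    { destruct (proj2 Hx) as [h|h]; [exact h|rewrite h in Ex; lra]. }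
    assert (Hlt := convex_order_radial_quotient nu alpha x Hnu Hc ltac:(lra) ltac:(lra)).
    assert (HD := bessel_DP_ge_2P nu x ltac:(lra) ltac:(lra)).
    unfold radial_quotient in Hlt. replace (bessel_P nu x) with (nu / 2) in * by lra.
    assert (2 <= bessel_DP nu x / (nu - nu / 2)).
    { apply (Rmult_le_reg_r (nu - nu / 2)); [lra|].
      unfold Rdiv at 2; rewrite Rmult_assoc, Rinv_l, Rmult_1_r by lra. lra. }
    replace (nu / 2 / nu) with (1 / 2) in Hlt by (field; lra). lra.
Qed.

(** The radial quotient is continuous at x = 1, which lies inside the domain of the series. The
    limit only gives a weak inequality, and that is sharp: inside the disk the real part strictly
    exceeds G(nu), so [convex_sufficient] admits equality. *)
Lemma convex_boundary_quotient_ge (nu alpha : R) :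
  0 < nu -> 0 <= alpha -> f_nu_convex_of_order nu alpha -> alpha <= boundary_quotient nu.
Proof.
  intros Hnu Ha Hc. assert (Hp := convex_bessel_ratio_pos nu alpha Hnu Ha Hc).
  apply Rnot_lt_le; intros HG.
  assert (Hcont : continuity_pt (radial_quotient nu) 1).
  { assert (R1 : Rabs 1 < 4) by (rewrite Rabs_R1; lra).
    assert (CP := continuity_pt_bessel_P nu 1 ltac:(lra) R1).
    assert (CD := continuity_pt_bessel_DP nu 1 ltac:(lra) R1).
    assert (Ck : forall k, continuity_pt (fun _ => k) 1)
      by (intros k; apply continuity_pt_const; intros u v; reflexivity).
    apply (continuity_pt_minus (fun x => 1 - bessel_P nu x * / nu) (fun x => bessel_DP nu x * / (nu - bessel_P nu x))).
    - apply (continuity_pt_minus (fun _ => 1) (fun x => bessel_P nu x * / nu)); [apply Ck|].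
      apply (continuity_pt_mult (bessel_P nu) (fun _ => / nu)); [exact CP|apply Ck].
    - apply (continuity_pt_mult (bessel_DP nu) (fun x => / (nu - bessel_P nu x))); [exact CD|].
      apply (continuity_pt_inv (fun x => nu - bessel_P nu x)).
      + apply (continuity_pt_minus (fun _ => nu) (bessel_P nu)); [apply Ck|exact CP].
      + unfold bessel_ratio in Hp; lra. }
  destruct (proj1 (continuity_pt_eps _ _) Hcont (alpha - boundary_quotient nu) ltac:(lra)) as [d [Hd H]].
  set (x := 1 - Rmin (d / 2) (1 / 2)).
  assert (Hm1 := Rmin_l (d / 2) (1 / 2)). assert (Hm2 := Rmin_r (d / 2) (1 / 2)).
  assert (Hm3 : 0 < Rmin (d / 2) (1 / 2)) by (apply Rmin_pos; lra).
  assert (Hx : 0 <= x < 1) by (unfold x; lra).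
  specialize (H x). assert (Hxd : Rabs (x - 1) < d) by (apply Rabs_lt_between; unfold x; lra).
  specialize (H Hxd).
  destruct (radial_quotient_gt_boundary nu x Hnu Hp Hx) as [HP _].
  assert (Hlt := convex_order_radial_quotient nu alpha x Hnu Hc Hx HP).
  apply Rabs_lt_between in H.
  assert (E : radial_quotient nu 1 = boundary_quotient nu) by reflexivity. rewrite E in H. lra.
Qed.

(** * Orders between -1 and 0 *)

Lemma bessel_c_1 (nu : R) : -1 < nu -> bessel_c nu 1 = - / (4 * (1 + nu)).
Proof. intros. simpl. field; lra. Qed.

(** Here phi = 1 - K x + x^2 r with |r| <= K/7. On the cone the linear term contributes at least K
    |x| / 2, which outweighs K |x| / 7. A full cone, and not only the negative axis, is needed to
    exhibit an open part of the branch domain: phi may have zeros elsewhere in the disk. *)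
Lemma Re_bessel_cone (nu : R) (x : C) :
  -1 < nu < 0 -> Cmod x < 1 -> Re x <= - (Cmod x / 2) -> 1 <= Re (cps (bessel_c nu) x).
Proof.
  intros Hnu Hx Hcone.
  set (K := / (4 * (1 + nu))).
  assert (HK : 0 < K) by (apply Rinv_0_lt_compat; lra).
  assert (Hr := bessel_c_radius nu (Cmod x) ltac:(lra) ltac:(lra)).
  rewrite cps_decr by exact Hr.
  rewrite (cps_decr (fun n => bessel_c nu (S n))).
  2:{ change (fun n => bessel_c nu (S n)) with (PS_decr_1 (bessel_c nu)).
      rewrite CV_radius_decr_1; exact Hr. }
  rewrite bessel_c_1 by lra. fold K. change (bessel_c nu 0) with 1.
  set (r := cps (fun n => bessel_c nu (S (S n))) x).
  assert (Hrb : Cmod r <= K * (1 / 8) / (1 - 1 / 8)).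
  { apply Cmod_cps_geom; [lra|lra|]. intros n.
    eapply Rle_trans; [apply bessel_c_bound; lra|]. fold K. simpl; lra. }
  assert (H1 : Rabs (Re (x * (x * r))%C) <= Cmod x * (K / 7)).
  { eapply Rle_trans; [apply re_le_Cmod|]. rewrite !Cmod_mult.
    generalize (Cmod_ge_0 x) (Cmod_ge_0 r). intros.
    apply Rmult_le_compat_l; [assumption|]. nra. }
  apply Rabs_le_between in H1.
  replace (1 + x * (RtoC (- K) + x * r))%C with (1 + (x * (x * r) - RtoC K * x))%C
    by (rewrite RtoC_opp; ring).
  set (y := (x * (x * r))%C) in *.
  assert (E : Re (1 + (y - RtoC K * x))%C = 1 + (Re y - K * Re x)).
  { destruct x, y; simpl; ring. }
  rewrite E. generalize (Cmod_ge_0 x). intros. nra.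
Qed.

Lemma bessel_axis_ge_1 (nu y : R) :
  -1 < nu < 0 -> 0 <= y < 1 -> 1 <= PSeries (bessel_c nu) (- y).
Proof.
  intros Hnu Hy. assert (H := Re_bessel_cone nu (RtoC (- y)) Hnu).
  rewrite Cmod_R, Rabs_Ropp, Rabs_pos_eq, cps_RtoC in H by lra. apply H; simpl; lra.
Qed.

(** The constant coefficient of phi' is -K, and the rest is at most K/2, since (n + 2) (1/8)^(n+1)
    <= 1/4 (1/2)^n. *)
Lemma bessel_axis_deriv_neg (nu y : R) :
  -1 < nu < 0 -> 0 <= y < 1 -> PSeries (PS_derive (bessel_c nu)) (- y) < 0.
Proof.
  intros Hnu Hy.
  set (K := / (4 * (1 + nu))).
  assert (HK : 0 < K) by (apply Rinv_0_lt_compat; lra).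
  assert (Hr : Rbar_lt (Cmod (RtoC (- y))) (CV_radius (PS_derive (bessel_c nu)))).
  { rewrite CV_radius_derive. apply bessel_c_radius; [lra|].
    rewrite Cmod_R, Rabs_Ropp, Rabs_pos_eq; lra. }
  assert (E := cps_decr _ _ Hr). rewrite !cps_RtoC, <- RtoC_mult, <- RtoC_plus in E.
  apply RtoC_inj in E. rewrite E.
  assert (B : Cmod (cps (fun n => PS_derive (bessel_c nu) (S n)) (RtoC (- y))) <= K * (1 / 4) / (1 - 1 / 2)).
  { apply Cmod_cps_geom; [lra|rewrite Cmod_R, Rabs_Ropp, Rabs_pos_eq; lra|].
    intros n. unfold PS_derive. rewrite Rabs_mult, (Rabs_pos_eq (INR _)) by apply pos_INR.
    apply Rle_trans with (INR (S (S n)) * (K * (1 / 8) ^ S n)).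
    - apply Rmult_le_compat_l; [apply pos_INR|]. apply bessel_c_bound; lra.
    - assert (Hn : INR (S (S n)) * (1 / 8) ^ S n <= 1 / 4 * (1 / 2) ^ n).
      { induction n as [|n IH]; [simpl; lra|].
        rewrite (S_INR (S (S n))).
        assert (2 <= INR (S (S n))) by (rewrite !S_INR; generalize (pos_INR n); lra).
        assert (0 < (1 / 8) ^ S n) by (apply pow_lt; lra).
        simpl ((1 / 8) ^ S (S n)). simpl ((1 / 2) ^ S n). simpl ((1 / 8) ^ S n) in *. nra. }
      nra. }
  rewrite cps_RtoC, Cmod_R in B. apply Rabs_le_between in B.
  change (PS_derive (bessel_c nu) 0) with (1 * bessel_c nu 1). rewrite bessel_c_1 by lra. fold K.
  nra.
Qed.

(* The value of z f'/f at z = i sqrt y. *)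
Definition axis_ratio (nu y : R) : R :=
  1 + / nu * (2 * - y * PSeries (PS_derive (bessel_c nu)) (- y)
              / PSeries (bessel_c nu) (- y)).

Lemma axis_ratio_0 (nu : R) : axis_ratio nu 0 = 1.
Proof. unfold axis_ratio. rewrite Ropp_0. unfold Rdiv. ring. Qed.

Lemma axis_ratio_le_1 (nu y : R) :
  -1 < nu < 0 -> 0 <= y < 1 -> axis_ratio nu y <= 1.
Proof.
  intros Hnu Hy. unfold axis_ratio. assert (H1 := bessel_axis_ge_1 nu y Hnu Hy). assert (H2 := bessel_axis_deriv_neg nu y Hnu Hy).
  assert (Hi : / nu < 0) by (apply Rinv_lt_0_compat; lra).
  assert (0 <= 2 * - y * PSeries (PS_derive (bessel_c nu)) (- y) / PSeries (bessel_c nu) (- y)).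
  { apply Rle_mult_inv_pos; [nra|lra]. }
  nra.
Qed.

Lemma continuity_pt_axis_ratio (nu y : R) :
  -1 < nu < 0 -> 0 <= y < 1 -> continuity_pt (axis_ratio nu) y.
Proof.
  intros Hnu Hy. assert (Ho : continuity_pt (fun t => - t) y).
  { apply (continuity_pt_opp (fun t => t)), continuity_pt_id. }
  assert (Ck : forall k, continuity_pt (fun _ => k) y)
      by (intros k; apply continuity_pt_const; intros u v; reflexivity).
  assert (R1 : Rabs (- y) < 4) by (rewrite Rabs_Ropp, Rabs_pos_eq; lra).
  unfold axis_ratio. apply (continuity_pt_plus (fun _ => 1) (fun y => / nu * (2 * - y * PSeries (PS_derive (bessel_c nu)) (- y) / PSeries (bessel_c nu) (- y)))).
  { apply Ck. }
  apply (continuity_pt_mult (fun _ => / nu) (fun y => 2 * - y * PSeries (PS_derive (bessel_c nu)) (- y) * / PSeries (bessel_c nu) (- y))).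
  { apply Ck. }
  apply (continuity_pt_mult (fun y => 2 * - y * PSeries (PS_derive (bessel_c nu)) (- y)) (fun y => / PSeries (bessel_c nu) (- y))).
  - apply (continuity_pt_mult (fun y => 2 * - y) (fun y => PSeries (PS_derive (bessel_c nu)) (- y))).
    + apply (continuity_pt_mult (fun _ => 2) (fun y => - y)); [apply Ck|exact Ho].
    + apply (continuity_pt_comp (fun y => - y) (PSeries (PS_derive (bessel_c nu)))); [exact Ho|].
      apply PSeries_continuity. rewrite CV_radius_derive. apply bessel_c_radius; lra.
  - apply (continuity_pt_inv (fun y => PSeries (bessel_c nu) (- y))).
    + apply (continuity_pt_comp (fun y => - y) (PSeries (bessel_c nu))); [exact Ho|].
      apply PSeries_continuity, bessel_c_radius; lra.
    + generalize (bessel_axis_ge_1 nu y Hnu Hy); lra.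
Qed.

Lemma Cmod_sqr_components (p q : R) : Cmod (p, q) ^ 2 = p ^ 2 + q ^ 2.
Proof. rewrite Cmod2_alt. reflexivity. Qed.

(** Writing u = p + i q, the radius t/4 gives |p| < t/4 and q > 3t/4, hence 3 p^2 <= q^2, which puts
    u^2 in the cone of [Re_bessel_cone]. The cone is stable under scaling by s^2, so the whole
    segment from 0 avoids the zeros of phi; the bound 1 - t keeps u in the disk. *)
Lemma branch_domain_imaginary (nu t : R) (u : C) :
  -1 < nu < 0 -> 0 < t < 1 -> Cmod (u - RtoC t * Ci) < Rmin (t / 4) (1 - t) -> branch_domain nu u.
Proof.
  intros Hnu Ht Hu. assert (H1 := Rlt_le_trans _ _ _ Hu (Rmin_l _ _)).
  assert (H2 := Rlt_le_trans _ _ _ Hu (Rmin_r _ _)).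
  assert (Hti : Cmod (RtoC t * Ci)%C = t) by (rewrite Cmod_mult, Cmod_Ci, Cmod_R, Rabs_pos_eq; lra).
  assert (Hdisk : in_disk u) by (apply (in_disk_ball (RtoC t * Ci)%C); rewrite Hti; exact H2).
  split; [exact Hdisk|].
  intros s Hs E. rewrite bessel_normalized_cps in E by lra.
  apply (f_equal Re) in E. revert E. apply Rgt_not_eq.
  apply Rlt_gt, Rlt_le_trans with 1; [simpl; lra|].
  assert (Hsu := in_disk_scal s u Hs Hdisk).
  apply Re_bessel_cone; [exact Hnu|apply sqr_in_disk, Hsu|].
  destruct u as [p q].
  assert (B1 := re_le_Cmod ((p, q) - RtoC t * Ci)%C).
  assert (B2 := im_le_Cmod ((p, q) - RtoC t * Ci)%C).
  assert (E1 : Re ((p, q) - RtoC t * Ci)%C = p) by (simpl; ring).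
  assert (E2 : Im ((p, q) - RtoC t * Ci)%C = q - t) by (simpl; ring).
  rewrite E1 in B1. rewrite E2 in B2.
  assert (B1' : Rabs p < t / 4) by lra. assert (B2' : Rabs (q - t) < t / 4) by lra.
  apply Rabs_lt_between in B1'. apply Rabs_lt_between in B2'.
  rewrite Cmod_mult.
  assert (E3 : Re (RtoC s * (p, q) * (RtoC s * (p, q)))%C = s ^ 2 * (p ^ 2 - q ^ 2)) by (simpl; ring).
  rewrite E3.
  assert (E4 : Cmod (RtoC s * (p, q)) * Cmod (RtoC s * (p, q)) = s ^ 2 * (p ^ 2 + q ^ 2)).
  { rewrite Cmod_mult, Cmod_R, Rabs_pos_eq by lra. rewrite <- Cmod_sqr_components. ring. }
  rewrite E4.
  assert (3 * p ^ 2 <= q ^ 2).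
  { assert (p ^ 2 <= (t / 4) ^ 2) by (apply pow_maj_Rabs, Rabs_le; lra).
    assert ((3 * t / 4) ^ 2 <= q ^ 2) by (apply pow_incr; lra). nra. }
  assert (0 <= s ^ 2) by nra. nra.
Qed.

(** Substituting x = - t^2 and m = nu (s - 1) into the convexity quotient leaves an expression in s
    = z f'/f alone. *)
Lemma f_nu_imaginary_quotient (nu : R) (f : C -> C) (t : R) :
  -1 < nu < 0 -> is_f_nu nu f -> 0 < t < 1 -> axis_ratio nu (t ^ 2) <> 0 ->
  let z := (RtoC t * Ci)%C in
  Re (1 + z * C_derive (C_derive f) z / C_derive f z)%C =
  (1 - nu) * axis_ratio nu (t ^ 2) + (nu + t ^ 2 / nu) / axis_ratio nu (t ^ 2).
Proof.
  intros Hnu [L [_ HL]] Ht HS z.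
  assert (Hzz : (z * z)%C = RtoC (- t ^ 2)).
  { unfold z, RtoC, Ci, Cmult; simpl. f_equal; ring. }
  assert (Ht2 : 0 <= t ^ 2 < 1) by nra.
  assert (Hphi := bessel_axis_ge_1 nu (t ^ 2) Hnu Ht2).
  set (m := 2 * - t ^ 2 * PSeries (PS_derive (bessel_c nu)) (- t ^ 2) / PSeries (bessel_c nu) (- t ^ 2)).
  assert (N : nu <> 0) by lra.
  assert (Es : (1 + / RtoC nu * RtoC m)%C = RtoC (axis_ratio nu (t ^ 2))).
  { unfold axis_ratio. fold m. rewrite RtoC_plus, RtoC_mult, RtoC_inv by exact N. reflexivity. }
  rewrite (f_nu_second_order nu f L z (Rmin (t / 4) (1 - t)) (RtoC m)).
  - unfold convexity_quotient. rewrite Es, Hzz.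
    rewrite <- RtoC_opp, <- !RtoC_mult, <- !RtoC_minus, <- RtoC_inv by exact N.
    rewrite <- RtoC_mult, <- RtoC_div, <- RtoC_plus by exact HS.
    assert (Em : m = nu * (axis_ratio nu (t ^ 2) - 1)) by (unfold axis_ratio; fold m; field; exact N).
    rewrite Em. change (Re (RtoC ?a)) with a.
    field. split; assumption.
  - lra.
  - exact N.
  - apply Rmin_pos; lra.
  - intros u Hu. assert (Hb := branch_domain_imaginary nu t u Hnu Ht Hu).
    destruct (HL u Hb) as [H1 [H2 H3]].
    rewrite bessel_normalized_cps in H2 by lra.
    split; [apply Hb|]. repeat split; assumption.
  - rewrite Hzz, !cps_RtoC, <- !RtoC_mult. f_equal.
    unfold m. field. lra.
  - rewrite Es. intros E. apply RtoC_inj in E. exact (HS E).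
Qed.

Lemma not_convex_negative_order (nu alpha : R) :
  -1 < nu < 0 -> 0 <= alpha -> ~ f_nu_convex_of_order nu alpha.
Proof.
  intros Hnu Ha [f [Hf [_ [_ [_ [_ H]]]]]].
  set (mu := - nu). assert (Hmu : 0 < mu < 1) by (unfold mu; lra).
  (* A point [y = t^2] where the quotient [(1 + mu) s - (mu + y / mu) / s] is
     nonpositive, [s] being its value of [z f'/f]. *)
  assert (Hy : exists y, 0 < y < 1 /\ 0 < axis_ratio nu y /\ (1 + mu) * axis_ratio nu y ^ 2 <= mu + y / mu).
  { destruct (Rlt_le_dec 0 (axis_ratio nu mu)) as [h|h].
    - exists mu. split; [exact Hmu|]. split; [exact h|].
      assert (H1 := axis_ratio_le_1 nu mu Hnu ltac:(lra)). replace (mu / mu) with 1 by (field; lra).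
      assert (axis_ratio nu mu ^ 2 <= 1) by nra. nra.
    - destruct (Ranalysis5.IVT_interv (fun y => mu / 2 - axis_ratio nu y) 0 mu) as [y [Hy Ey]].
      + intros a Haa. apply (continuity_pt_minus (fun _ => mu / 2) (axis_ratio nu)).
        * apply continuity_pt_const; intros u v; reflexivity.
        * apply continuity_pt_axis_ratio; lra.
      + lra.
      + rewrite axis_ratio_0; lra.
      + lra.
      + exists y. assert (Hy0 : 0 < y).
        { destruct (proj1 Hy) as [k|k]; [exact k|rewrite <- k, axis_ratio_0 in Ey; lra]. }
        split; [lra|]. replace (axis_ratio nu y) with (mu / 2) by lra. split; [lra|].
        assert (0 < y / mu) by (apply Rdiv_lt_0_compat; lra). nra. }
  destruct Hy as [y [Hy [HS Hle]]].
  assert (Hs : sqrt y ^ 2 = y) by (apply pow2_sqrt; lra).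
  assert (Hr : 0 < sqrt y < 1).
  { split; [apply sqrt_lt_R0; lra|]. rewrite <- sqrt_1. apply sqrt_lt_1; lra. }
  specialize (H (RtoC (sqrt y) * Ci)%C).
  rewrite (f_nu_imaginary_quotient nu f (sqrt y) Hnu Hf Hr) in H by (rewrite Hs; lra).
  rewrite Hs in H.
  assert (Hd : in_disk (RtoC (sqrt y) * Ci)%C).
  { unfold in_disk. rewrite Cmod_mult, Cmod_Ci, Cmod_R, Rabs_pos_eq; lra. }
  specialize (H Hd).
  assert (E : (1 - nu) * axis_ratio nu y + (nu + y / nu) / axis_ratio nu y = ((1 + mu) * axis_ratio nu y ^ 2 - (mu + y / mu)) / axis_ratio nu y).
  { unfold mu. field. lra. }
  rewrite E in H.
  assert (((1 + mu) * axis_ratio nu y ^ 2 - (mu + y / mu)) / axis_ratio nu y <= 0).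
  { apply (Rmult_le_reg_r (axis_ratio nu y)); [exact HS|].
    unfold Rdiv at 1; rewrite Rmult_assoc, Rinv_l, Rmult_1_r by lra. lra. }
  lra.
Qed.



(** * The equation for the critical order and the equivalences *)

Lemma bessel_ratio_pos_of_ge_1 (nu : R) : 1 <= nu -> 0 < bessel_ratio nu.
Proof.
  intros [Hnu| <-]; [|exact bessel_ratio_1_pos].
  generalize bessel_ratio_1_pos (bessel_ratio_lt 1 nu ltac:(lra) Hnu); lra.
Qed.

Lemma boundary_quotient_le_iff (mu nu : R) : 0 < mu -> 0 < nu -> 0 < bessel_ratio mu -> 0 < bessel_ratio nu ->
  boundary_quotient mu <= boundary_quotient nu <-> mu <= nu.
Proof.
  intros Hmu Hnu H1 H2. split; intros H.
  - apply Rnot_lt_le; intros Hlt. generalize (boundary_quotient_lt nu mu Hnu Hlt H2); lra.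
  - destruct H as [H| ->]; [left; apply boundary_quotient_lt; assumption|right; reflexivity].
Qed.

(** Writing the order of convexity as G(nu0) treats both claims at once: nu0 = nu_alpha for order
    alpha, and nu0 = 1 for plain convexity. *)
Lemma convex_of_order_iff (nu nu0 : R) :
  -1 < nu -> nu <> 0 -> 1 <= nu0 ->
  f_nu_convex_of_order nu (boundary_quotient nu0) <-> nu0 <= nu.
Proof.
  intros Hnu Hn0 H0. assert (P0 := bessel_ratio_pos_of_ge_1 nu0 H0).
  assert (HG0 : 0 <= boundary_quotient nu0).
  { rewrite <- boundary_quotient_1 by (generalize bessel_ratio_1_pos; lra).
    apply boundary_quotient_le_iff; [lra|lra|exact bessel_ratio_1_pos|exact P0|exact H0]. }
  split; intros H.
  - destruct (Rlt_le_dec nu 0) as [Hneg|Hpos].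
    + exfalso. exact (not_convex_negative_order nu (boundary_quotient nu0) (conj Hnu Hneg) HG0 H).
    + assert (Hpos' : 0 < nu) by lra.
      apply boundary_quotient_le_iff; [lra|lra|exact P0| |].
      * exact (convex_bessel_ratio_pos nu (boundary_quotient nu0) Hpos' HG0 H).
      * exact (convex_boundary_quotient_ge nu (boundary_quotient nu0) Hpos' HG0 H).
  - apply convex_sufficient; [lra|].
    apply boundary_quotient_le_iff; [lra|lra|exact P0|apply bessel_ratio_pos_of_ge_1; lra|exact H].
Qed.

Lemma besselJ_1_pos (nu : R) : 0 < nu -> 0 < besselJ nu 1.
Proof.
  intros Hnu. rewrite besselJ_1 by lra. apply Rmult_lt_0_compat.
  - apply bessel_scale_pos; lra.
  - apply bessel_pos_R; [exact Hnu|rewrite Rabs_R1; lra].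
Qed.

Lemma Derive_besselJ_ratio (nu : R) : 0 < nu -> Derive (besselJ nu) 1 = bessel_ratio nu * besselJ nu 1.
Proof.
  intros Hnu. rewrite Derive_besselJ_1, besselJ_1 by lra. fold (jprime nu).
  rewrite jprime_ratio_eq by exact Hnu. ring.
Qed.

(** With J_nu'(1) = p J_nu(1), the two sides differ by (G - alpha) nu p J_nu(1)^2, whose last three
    factors are positive beyond nu^*. *)
Lemma bessel_equation_iff (nu alpha : R) :
  0 < nu -> 0 < bessel_ratio nu ->
  nu * (nu ^ 2 - 1) * (besselJ nu 1) ^ 2 + (1 - nu) * (Derive (besselJ nu) 1) ^ 2
    = alpha * nu * besselJ nu 1 * Derive (besselJ nu) 1 <-> boundary_quotient nu = alpha.
Proof.
  intros Hnu Hp. rewrite Derive_besselJ_ratio by exact Hnu.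
  assert (HJ := besselJ_1_pos nu Hnu). set (j := besselJ nu 1) in *.
  rewrite boundary_quotient_closed by lra.
  assert (E : nu * (nu ^ 2 - 1) * j ^ 2 + (1 - nu) * (bessel_ratio nu * j) ^ 2 - alpha * nu * j * (bessel_ratio nu * j)
    = ((1 - nu) * bessel_ratio nu / nu + (nu ^ 2 - 1) / bessel_ratio nu - alpha) * (nu * bessel_ratio nu * j ^ 2)) by (field; lra).
  assert (Hk : 0 < nu * bessel_ratio nu * j ^ 2).
  { apply Rmult_lt_0_compat; [apply Rmult_lt_0_compat; assumption|nra]. }
  split; intros H.
  - rewrite H, Rminus_diag in E. symmetry in E. apply Rmult_integral in E. lra.
  - rewrite H, Rminus_diag, Rmult_0_l in E. lra.
Qed.

Lemma Derive_besselJ_neg (nu : R) : -1 < nu < 0 -> Derive (besselJ nu) 1 < 0.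
Proof.
  intros Hnu. rewrite Derive_besselJ_1 by lra. fold (jprime nu).
  generalize (bessel_scale_pos nu ltac:(lra)) (jprime_neg nu Hnu). nra.
Qed.

Theorem theorem4 :
  exists nustar : R,
    (-1 < nustar /\ nustar <> 0 /\ Derive (besselJ nustar) 1 = 0 /\
     (forall nu : R, -1 < nu -> nu <> 0 ->
        Derive (besselJ nu) 1 = 0 -> nu = nustar) /\
     Rabs (nustar - 3901 / 10000) < 1 / 10000) /\
    (forall alpha : R, 0 < alpha < 1 ->
       exists nualpha : R,
         unique
           (fun nu : R =>
              nustar < nu /\
              nu * (nu ^ 2 - 1) * (besselJ nu 1) ^ 2
                + (1 - nu) * (Derive (besselJ nu) 1) ^ 2
              = alpha * nu * besselJ nu 1 * Derive (besselJ nu) 1)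
           nualpha /\
         forall nu : R, -1 < nu -> nu <> 0 ->
           (f_nu_convex_of_order nu alpha <-> nualpha <= nu)) /\
    (forall nu : R, -1 < nu -> nu <> 0 ->
       (f_nu_convex_of_order nu 0 <-> 1 <= nu)).
Proof.
  destruct nustar_exists as [nustar [Hstar Pstar]].
  assert (Hpr : forall nu, nustar < nu -> 0 < bessel_ratio nu).
  { intros nu H. rewrite <- Pstar. apply bessel_ratio_lt; lra. }
  exists nustar. split; [|split].
  - split; [lra|]. split; [lra|]. split.
    { rewrite Derive_besselJ_ratio, Pstar by lra. ring. }
    split.
    + intros nu Hnu Hn0 HD. destruct (Rlt_le_dec nu 0) as [Hneg|Hpos].
      * generalize (Derive_besselJ_neg nu (conj Hnu Hneg)); lra.
      * assert (Hpos' : 0 < nu) by lra.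
        rewrite Derive_besselJ_ratio in HD by exact Hpos'.
        apply Rmult_integral in HD. generalize (besselJ_1_pos nu Hpos'). intros HJ.
        apply bessel_ratio_inj; lra.
    + apply Rabs_lt_between; lra.
  - intros alpha Ha. destruct (boundary_quotient_root alpha Ha) as [na [Hna Ena]].
    exists na. split.
    + split.
      * split; [lra|]. apply bessel_equation_iff; [lra|apply Hpr; lra|exact Ena].
      * intros nu [H1 H2]. assert (Q := Hpr nu H1).
        apply bessel_equation_iff in H2; [|lra|exact Q].
        assert (Q' := Hpr na ltac:(lra)).
        apply Rle_antisym; apply boundary_quotient_le_iff; try lra; assumption.
    + intros nu Hnu Hn0. rewrite <- Ena. apply convex_of_order_iff; [exact Hnu|exact Hn0|lra].
  - intros nu Hnu Hn0. rewrite <- boundary_quotient_1 by (generalize bessel_ratio_1_pos; lra).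
    apply convex_of_order_iff; [exact Hnu|exact Hn0|lra].
Qed.
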